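(* Let $T>0$, $D\in\mathbb N$, $H\in(\tfrac12,1)$, $N\in\mathbb N$ with $N\ge1$, and let $\alpha,\beta,a,b>0$ be arbitrary. Let $m,n,\xi_0,\dots,\xi_n$, $(\gamma_i,\omega_i)_{i=0}^{mn}$ be given by the quadrature construction described in the context (with $\xi_0<\xi_n$), let $\delta_1,\delta_2>0$ with $\delta_2\le\xi_0$, and define $$\widetilde G_H(t):=\omega_0\frac{1-e^{-\delta_1t}}{\delta_1}+\sum_{i=1}^{mn}\omega_i\frac{e^{-(\gamma_i-\delta_2)t}-e^{-(\gamma_i+\delta_1)t}}{\delta_1+\delta_2}.$$ Set $r_{+,N}:=(\xi_n/\xi_0)^{1/n}$, $W_N^+:=\sum_{i=1}^{mn}\omega_i$, $$Q_{N,T}^+:=c_H^2\bigg[\frac{3T^5}{5(\frac52-H)^2}a^{5-2H}e^{-\frac{2\alpha}{A_+}\sqrt N}+\frac{3}{4H^2}b^{-2H}e^{-\frac{2\alpha}{A_+}\sqrt N}+\frac{49\pi^3}{24}\frac{T^{2H}}{H}n^2m^{2-2H}\Big(\frac{r_{+,N}-1}{2}\Big)^{4m+2}\bigg],$$ $$D_N:=\frac{\omega_0\delta_1}{2}+W_N^+\max\{\delta_1,\delta_2\}.$$ Then $$\int_0^T|G_H(t)-\widetilde G_H(t)|^2\,\mathrm dt\le2Q_{N,T}^++\frac{2T^5}{5}D_N^2.$$ Consequently, if $$\mathbf X_t=\rho(t)\mathbf X_0+\int_0^tG_H(t-s)\mathbf b(s)\,\mathrm ds+\int_0^tG_H(t-s)\boldsymbol\Sigma(s)\,\mathrm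 d\mathbf B_s,$$ $$\widehat{\mathbf X}_t=\rho(t)\mathbf X_0+\int_0^t\widetilde G_H(t-s)\mathbf b(s)\,\mathrm ds+\int_0^t\widetilde G_H(t-s)\boldsymbol\Sigma(s)\,\mathrm d\mathbf B_s,\qquad t\in[0,T],$$ then $$\mathbb E\big[\|\mathbf X_T-\widehat{\mathbf X}_T\|^2\big]\le C_T\Big(2Q_{N,T}^++\frac{2T^5}{5}D_N^2\Big).$$
   Context: Kernel: $G_H(t)=\dfrac{t^{H-\frac12}}{\Gamma(H+\frac12)}$ for $t>0$. Constants: $c_H:=\dfrac{1}{\Gamma(H+\frac12)\Gamma(\frac32-H)}$, $A_+:=\Big(\dfrac1H+\dfrac1{\frac52-H}\Big)^{1/2}$. (One has $G_H(t)=c_H\int_0^\infty te^{-\gamma t}\gamma^{\frac12-H}\,\mathrm d\gamma$ for $t>0$.) Process data: $\mathbf B$ is a standard $D$-dimensional Brownian motion; $\mathbf X_0$ is an $\mathbb R^D$-valued initial random variable independent of $\mathbf B$; $\rho(t)=e^{-\kappa t}$ for a fixed constant $\kappa>0$; $\mathbf b\in L^\infty([0,T];\mathbb R^D)$ and $\boldsymbol\Sigma\in L^\infty([0,T];\mathbb R^{D\times D})$ are deterministic. The constant is $$C_T=2T\|\mathbf b\|_{L^\infty(0,T)}^2+2\|\boldsymbol\Sigma\|_{L^\infty(0,T)}^2,$$ where the $L^\infty$ norms use the Euclidean norm on $\mathbb R^D$ and the Frobenius norm on $\mathbb R^{D\times D}$. Gaussian quadrature: for a finite interval $[u,v]$,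 $u<v$, and a continuous positive weight $w$ on $[u,v]$, the $m$-point Gaussian quadrature rule with respect to $w$ is the unique set of nodes $x_1,\dots,x_m\in(u,v)$ and positive weights $\eta_1,\dots,\eta_m$ with $\int_u^vp(x)w(x)\,\mathrm dx=\sum_{k=1}^m\eta_kp(x_k)$ for every polynomial $p$ of degree at most $2m-1$. Construction: $m,n$ are positive integers obtained by rounding, $m\approx\frac{\beta}{A_+}\sqrt N$, $n\approx\frac{A_+}{\beta}\sqrt N$, $mn\approx N$ (the rounding convention is unspecified; the estimate is claimed for whichever positive integers $m,n$ result). Put $$\xi_0:=a\exp\Big(-\frac{\alpha}{(\frac52-H)A_+}\sqrt N\Big),\quad \xi_n:=b\exp\Big(\frac{\alpha}{HA_+}\sqrt N\Big),\quad \xi_j:=\xi_0\Big(\frac{\xi_n}{\xi_0}\Big)^{j/n},\ j=0,\dots,n.$$ On each $[\xi_j,\xi_{j+1}]$, $j=0,\dots,n-1$, take the $m$-point Gaussian quadrature rule with respect to $w_H(\gamma)=c_H\gamma^{\frac12-H}$; relabel all resulting nodes and weights as $(\gamma_i,\omega_i)_{i=1}^{mn}$. Add the zero node $\gamma_0:=0$, $\omega_0:=c_H\int_0^{\xi_0}\gamma^{\frac12-H}\,\mathrm d\gamma=\frac{c_H}{\frac32-H}\xi_0^{\frac32-H}$. (Since Gaussian quadrature integrates constants exactly, $W_N^+=\frac{c_H}{\frac32-H}(\xi_n^{\frac32-H}-\xi_0^{\frac32-H})$.) *)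

(* Defs.v *)
From mathcomp Require Import all_boot all_order all_algebra.
From mathcomp Require Import all_classical all_reals all_analysis.

Set Implicit Arguments.
Unset Strict Implicit.
Unset Printing Implicit Defensive.

Import Order.TTheory GRing.Theory Num.Theory.
Import numFieldNormedType.Exports.

Local Open Scope classical_set_scope.
Local Open Scope ring_scope.

Section kernel_and_quadrature.
Context {R : realType}.
Implicit Types (H T t alpha a b : R) (N m n : nat) (gamma omega : nat -> R).

Let mu := @lebesgue_measure R.

(* Euler's integral; used at positive arguments only. *)
Definition Gamma (s : R) : R :=
  \int[mu]_(x in `]0, +oo[) (x `^ (s - 1) * expR (- x)).

Definition frac_kernel H t : R := t `^ (H - 1 / 2) / Gamma (H + 1 / 2).

Definition cH H : R := (Gamma (H + 1 / 2) * Gamma (3 / 2 - H))^-1.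

Definition A_plus H : R := Num.sqrt (1 / H + 1 / (5 / 2 - H)).

Definition weight H (x : R) : R := cH H * x `^ (1 / 2 - H).

(* [size p <= 2 * m] says that p has degree at most 2m - 1. *)
Definition gauss_rule m (u v : R) (w : R -> R) (x eta : 'I_m -> R) : Prop :=
  [/\ injective x,
      forall k, u < x k < v,
      forall k, 0 < eta k
    & forall p : {poly R}, (size p <= 2 * m)%N ->
        \int[mu]_(y in `[u, v]) (p.[y] * w y) = \sum_(k < m) eta k * p.[x k]].

Definition xi_first H N alpha a : R :=
  a * expR (- (alpha / ((5 / 2 - H) * A_plus H) * Num.sqrt N%:R)).

Definition xi_last H N alpha b : R :=
  b * expR (alpha / (H * A_plus H) * Num.sqrt N%:R).

Definition xi H N alpha a b n (j : nat) : R :=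
  xi_first H N alpha a *
    (xi_last H N alpha b / xi_first H N alpha a) `^ (j%:R / n%:R).

(* Nodes and weights are labelled interval by interval: those of
   [xi_j, xi_(j+1)] carry the labels j m + 1, ..., j m + m.  The numbers m and n
   are left free, so that every rounding of beta sqrt(N) / A_+ and of
   A_+ sqrt(N) / beta to positive integers is covered. *)
Definition quadrature H N alpha a b m n gamma omega : Prop :=
  [/\ gamma 0%N = 0,
      omega 0%N = cH H *
        \int[mu]_(x in `[0, xi_first H N alpha a]) (x `^ (1 / 2 - H))
    & forall j, (j < n)%N ->
        gauss_rule (xi H N alpha a b n j) (xi H N alpha a b n j.+1) (weight H)
          (fun k : 'I_m => gamma (j * m + k).+1)
          (fun k : 'I_m => omega (j * m + k).+1)].

Definition approx_kernel m n gamma omega (delta1 delta2 t : R) : R :=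
  omega 0%N * ((1 - expR (- (delta1 * t))) / delta1) +
  \sum_(1 <= i < (m * n).+1) omega i *
    ((expR (- ((gamma i - delta2) * t)) - expR (- ((gamma i + delta1) * t)))
       / (delta1 + delta2)).

Definition r_plus H N alpha a b n : R :=
  (xi_last H N alpha b / xi_first H N alpha a) `^ (1 / n%:R).

Definition W_plus m n omega : R := \sum_(1 <= i < (m * n).+1) omega i.

Definition Q_plus H T N alpha a b m n : R :=
  cH H ^+ 2 *
  (3 * T ^+ 5 / (5 * (5 / 2 - H) ^+ 2) * a `^ (5 - 2 * H) *
     expR (- (2 * alpha / A_plus H * Num.sqrt N%:R)) +
   3 / (4 * H ^+ 2) * b `^ (- (2 * H)) *
     expR (- (2 * alpha / A_plus H * Num.sqrt N%:R)) +
   49 * pi ^+ 3 / 24 * (T `^ (2 * H) / H) * n%:R ^+ 2 * m%:R `^ (2 - 2 * H) *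
     ((r_plus H N alpha a b n - 1) / 2) ^+ (4 * m + 2)).

Definition D_err m n omega (delta1 delta2 : R) : R :=
  omega 0%N * delta1 / 2 + W_plus m n omega * Num.max delta1 delta2.

End kernel_and_quadrature.

Section coefficients.
Context {R : realType}.
Implicit Types (p q : nat) (T : R).

(* The Euclidean norm when q = 1; the norm `|A| of the library is the maximum
   norm. *)
Definition frobenius p q (A : 'M[R]_(p, q)) : R :=
  Num.sqrt (\sum_i \sum_j A i j ^+ 2).

Definition Linfty_norm p q T (F : R -> 'M[R]_(p, q)) : \bar R :=
  Lnorm (mrestr lebesgue_measure (measurable_itv `[0, T])) +oo%E
    (fun s => (frobenius (F s))%:E).

Definition Linfty p q T (F : R -> 'M[R]_(p, q)) : Prop :=
  (forall i j, measurable_fun `[0, T] (fun s => F s i j)) /\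
  (Linfty_norm T F < +oo)%E.

Definition C_T D T (drift : R -> 'cV[R]_D) (Sigma : R -> 'M[R]_D) : R :=
  2 * T * fine (Linfty_norm T drift) ^+ 2 + 2 * fine (Linfty_norm T Sigma) ^+ 2.

End coefficients.

Section processes.
Context {R : realType} {d : measure_display} {Omega : measurableType d}.
Variable P : probability Omega R.
Variable D : nat.
Implicit Types (X : Omega -> 'cV[R]_D) (B : R -> Omega -> 'cV[R]_D).

Definition random_vector X : Prop :=
  forall i, measurable_fun setT (fun w => X w i 0).

(* The product rule for subfamilies is the case where some A i are setT. *)
Definition mutually_independent (I : finType) (Y : I -> Omega -> R) : Prop :=
  forall A : I -> set R, (forall i, measurable (A i)) ->
    P (\bigcap_i (Y i @^-1` A i)) = (\prod_i P (Y i @^-1` A i))%E.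

Definition brownian_motion B : Prop :=
  [/\ forall t, 0 <= t -> random_vector (B t),
      {ae P, forall w, B 0 w = 0},
      forall s t i, 0 <= s -> s < t -> forall A : set R, measurable A ->
        P ((fun w => B t w i 0 - B s w i 0) @^-1` A) =
          normal_prob 0 (Num.sqrt (t - s)) A,
      forall (k : nat) (t : nat -> R), 0 <= t 0%N ->
        (forall l, t l <= t l.+1) ->
        mutually_independent (fun (li : 'I_k * 'I_D) w =>
          B (t li.1.+1) w li.2 0 - B (t li.1) w li.2 0)
    & {ae P, forall w, forall i,
        {within `[0, +oo[, continuous (fun t => B t w i 0)}}].

Definition sigma_generated (I : Type) (J : set I) (Y : I -> Omega -> R) :
    set (set Omega) :=
  <<s \bigcup_(i in J) preimage_set_system setT (Y i) measurable >>.

Definition independent_of_process X B : Prop :=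
  forall E F,
    sigma_generated setT (fun i w => X w i 0) E ->
    sigma_generated [set ti | 0 <= ti.1]
      (fun (ti : R * 'I_D) w => B ti.1 w ti.2 0) F ->
    P (E `&` F) = (P E * P F)%E.

(* A list of triples ((u, v), A) encodes the step function
   sum of 1_(]u, v]) A. *)
Definition step_fun (phi : seq ((R * R) * 'M[R]_D)) (s : R) : 'M[R]_D :=
  \sum_(x <- phi) (\1_`]x.1.1, x.1.2] s : R) *: x.2.

Definition step_integral B (phi : seq ((R * R) * 'M[R]_D)) (w : Omega) :
    'cV[R]_D :=
  \sum_(x <- phi) x.2 *m (B x.1.2 w - B x.1.1 w).

(* Y is a version of the integral over [0, t] of the deterministic F against dB,
   that is, the L^2(P) limit of the integrals of step functions that converge to
   F in L^2([0, t]). *)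
Definition wiener_integral B (t : R) (F : R -> 'M[R]_D) (Y : Omega -> 'cV[R]_D)
    : Prop :=
  random_vector Y /\
  exists phi : nat -> seq ((R * R) * 'M[R]_D),
    [/\ forall k, all (fun x => [&& 0 <= x.1.1, x.1.1 <= x.1.2 & x.1.2 <= t])
          (phi k),
        (fun k => \int[lebesgue_measure]_(s in `[0%R, t])
           (frobenius (step_fun (phi k) s - F s)%R ^+ 2)%R%:E)%E @ \oo --> 0%E
      & (fun k => 'E_P[(fun w =>
           (frobenius (step_integral B (phi k) w - Y w) ^+ 2)%R)])%E
           @ \oo --> 0%E].

Definition drift_integral (G : R -> R) (drift : R -> 'cV[R]_D) (t : R) :
    'cV[R]_D :=
  \col_i \int[lebesgue_measure]_(s in `[0, t]) (G (t - s) * drift s i 0).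

(* Stochastic integrals are determined up to null sets only, so X t is the sum
   for one version of the integral at time t. *)
Definition volterra_process B (X0 : Omega -> 'cV[R]_D) (kappa T : R)
    (G : R -> R) (drift : R -> 'cV[R]_D) (Sigma : R -> 'M[R]_D)
    (X : R -> Omega -> 'cV[R]_D) : Prop :=
  forall t, 0 <= t <= T ->
    exists2 Y, wiener_integral B t (fun s => G (t - s) *: Sigma s) Y
      & forall w, X t w =
          expR (- (kappa * t)) *: X0 w + drift_integral G drift t + Y w.

End processes.

(* Main.v *)
(* Write G_H(t) = c_H \int_0^oo t exp(- y t) y^(1/2 - H) dy and cut the integral at
   xi_0 and xi_n.  Below xi_0, replacing exp(- y t) by 1 costs O(t^2).  Above
   xi_n, Cauchy-Schwarz followed by Tonelli bounds the L^2(0, T) norm.  On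
   [xi_j, xi_(j+1)] the Gauss rule is exact on the Taylor polynomial of
   exp(- y t) at the midpoint, so its error is at most twice the Taylor
   remainder times the mass of the weight; a Stirling bound turns the maximum
   over t of the remainder into the power of (r - 1) / 2, and each of the n
   intervals contributes the same amount.  Finally, t exp(- gamma t) differs from
   the difference quotient in the approximate kernel by at most
   max(delta_1, delta_2) t^2.

   For the processes, the drift terms are compared by Cauchy-Schwarz and the
   stochastic terms by the Ito isometry.  The isometry for step functions comes
   from the covariance min(a, b) of Brownian motion, and it passes to the limit
   up to factors 1 + e.  The reflection s -> T - s reduces both to the L^2
   bound for the kernels. *)

Require Import Defs.
From mathcomp Require Import all_boot all_order all_algebra.
From mathcomp Require Import all_classical all_reals all_analysis.
From mathcomp Require Import measurable_realfun.
From mathcomp Require Import ring lra.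

Set Implicit Arguments.
Unset Strict Implicit.
Unset Printing Implicit Defensive.

Import Order.TTheory GRing.Theory Num.Theory.
Import numFieldNormedType.Exports.

Local Open Scope classical_set_scope.
Local Open Scope ring_scope.

(** * Exponential and factorial inequalities *)

(** The estimate on one interval must not depend on its position. Squaring the Gauss error on
    [[u, v]] collects [u] and [t] into [(u t)^(4 m + 3 - 2 H) expR (- 2 u t)], leaving [t^(2 H - 1)]
    and a power of [(v / u - 1) / 2]: [4 m] from the Taylor remainder of order [2 m], and 2 from the
    length of the interval. The maximum of the first factor does not see [u], so only the ratio
    [v / u] survives, which a geometric grid keeps constant. Measured against [(2 m)!^2], this
    maximum is of order [m^(2 - 2 H)], the power of [m] in [Q_plus]. The weights of the final bound
    come from grouping four error terms as three plus one. The quadrature term is first obtained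
    with a rational constant; [pi ^+ 3] enters only through a numerical lower bound. A Wiener
    integral is given here only as a limit along some sequence of step functions, with unrelated
    sequences for the two kernels. The difference of two such integrals is therefore estimated
    directly, without first proving uniqueness or linearity. *)

Ltac nonneg := repeat first [ assumption | exact: expR_ge0 | exact: powR_ge0 | exact: sqr_ge0
  | exact: normr_ge0 | apply: mulr_ge0 | apply: addr_ge0 | rewrite invr_ge0 | apply: exprn_ge0
  | exact: ltW | done ].

Lemma is_derive_ge0_le (R : realType) (f df : R -> R) (a b : R) : a <= b ->
  (forall x, a <= x <= b -> is_derive x 1 f (df x)) ->
  (forall x, a <= x <= b -> 0 <= df x) -> f a <= f b.
Proof.
move=> ab fdf df0.
have cf : {within `[a, b], continuous f}.
  by apply: derivable_within_continuous => x; rewrite in_itv /= => /fdf[].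
have [|c cab E] := @MVT_segment R f df a b ab _ cf.
  by move=> x; rewrite in_itv /= => /andP[ax xb]; apply: fdf; rewrite !ltW.
rewrite -subr_ge0 E mulr_ge0 ?subr_ge0//; apply: df0.
by move: cab; rewrite in_itv.
Qed.

(** Induction on [k]: the remainder of order [k + 1] has derivative [e] times the remainder of order
    [k], and the derivative of the bound dominates the bound of order [k]. Both vanish at 0, so
    bound plus and minus remainder are nondecreasing from 0. The cases of interest are [e = b = 1]
    for a growing exponential and [e = -1], [b = 0] for a decaying one, where no exponential factor
    is lost. *)
Lemma expR_taylor (R : realType) (k : nat) (e b z : R) : `|e| <= 1 -> 0 <= b -> e <= b ->
  0 <= z ->
  `|expR (e * z) - \sum_(i < k) (e * z) ^+ i / i`!%:R| <= expR (b * z) * (z ^+ k / k`!%:R).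
Proof.
move=> e1 b0 eb; elim: k z => [|k IH] z z0.
  rewrite big_ord0 subr0 expr0 fact0 divr1 mulr1 ger0_norm ?expR_ge0// ler_expR.
  exact: ler_wpM2r.
pose E (x : R) := expR (e * x) - \sum_(i < k.+1) (e * x) ^+ i / i`!%:R.
pose B (x : R) := expR (b * x) * (x ^+ k.+1 / k.+1`!%:R).
have dE (x : R) : is_derive x 1 E (e * (expR (e * x) - \sum_(i < k) (e * x) ^+ i / i`!%:R)).
  pose P : {poly R} := \sum_(i < k.+1) (e ^+ i / i`!%:R) *: 'X^i.
  have -> : E = (fun x => expR (e * x)) - horner P.
    apply/funext => y; rewrite /E fctE; congr (_ - _).
    rewrite horner_sum; apply: eq_bigr => i _.
    by rewrite hornerZ hornerXn exprMn mulrAC.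
  apply: is_derive_eq.
  rewrite /GRing.scale /= mulr1 mulrBr [expR _ * e]mulrC; congr (_ - _).
  rewrite /P raddf_sum horner_sum big_ord_recl /= derivZ derivXn mulr0n scaler0 horner0 add0r.
  rewrite mulr_sumr; apply: eq_bigr => i _.
  rewrite derivZ derivXn /= hornerZ hornerMn hornerXn -(mulr_natr (_ ^+ _)) exprMn.
  rewrite /bump leq0n !add1n !add0n factS natrM.
  have : (i.+1%:R : R) != 0 by [].
  have : (i`!%:R : R) != 0 by rewrite pnatr_eq0 -lt0n fact_gt0.
  rewrite exprS; move: (i.+1%:R : R) (i`!%:R : R) => p q q0 p0.
  by field; rewrite p0 q0.
have dB (x : R) : is_derive x 1 B (b * B x + expR (b * x) * (x ^+ k / k`!%:R)).
  have -> : B = (fun x => expR (b * x)) * horner ((k.+1`!%:R)^-1 *: 'X^(k.+1)).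
    by apply/funext => y; rewrite /B fctE hornerZ hornerXn [_^-1 * _]mulrC.
  apply: is_derive_eq; rewrite fctE !hornerE /= !derivZ derivXn /= !hornerE hornerMn hornerXn.
  rewrite /GRing.scale /= factS natrM -(mulr_natr (_ ^+ _)).
  have : (k.+1%:R : R) != 0 by [].
  have : (k`!%:R : R) != 0 by rewrite pnatr_eq0 -lt0n fact_gt0.
  rewrite exprS; move: (k.+1%:R : R) (k`!%:R : R) => p q q0 p0.
  by field; rewrite p0 q0.
have E0 : E 0 = 0.
  rewrite /E mulr0 expR0 big_ord_recl /= expr0 fact0 divr1 big1 ?addr0 ?subrr// => i _.
  by rewrite exprS mul0r mul0r.
have B0 : B 0 = 0 by rewrite /B exprS mul0r mul0r mulr0.
have Bge0 (x : R) : 0 <= x -> 0 <= B x.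
  by move=> x0; apply: mulr_ge0 (expR_ge0 _) _; apply: divr_ge0 => //; exact: exprn_ge0.
have key (x : R) : 0 <= x <= z -> `|e * (expR (e * x) - \sum_(i < k) (e * x) ^+ i / i`!%:R)|
     <= b * B x + expR (b * x) * (x ^+ k / k`!%:R).
  move=> /andP[x0 _]; rewrite normrM -[leLHS]add0r; apply: lerD; first exact: mulr_ge0 b0 (Bge0 _ x0).
  by apply: le_trans (IH x x0); rewrite ler_piMl.
rewrite ler_norml -/(E z) -/(B z); apply/andP; split.
- rewrite -subr_ge0 opprK.
  have := @is_derive_ge0_le _ (E + B) _ 0 z z0 (fun x _ => is_deriveD (dE x) (dB x)).
  rewrite !fctE E0 B0 addr0; apply => x xz.
  by move: (key x xz); rewrite ler_norml => /andP[]; lra.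
- rewrite -subr_ge0.
  have := @is_derive_ge0_le _ (B - E) _ 0 z z0 (fun x _ => is_deriveB (dB x) (dE x)).
  rewrite !fctE E0 B0 subrr; apply => x xz.
  by move: (key x xz); rewrite ler_norml => /andP[]; lra.
Qed.

(** The two sides agree at 0, and their difference has derivative [(1 - (1 + x)^-1)^2 / 2], a
    perfect square. *)
Lemma ln1D_le (R : realType) (x : R) : 0 <= x -> ln (1 + x) <= (x + x / (1 + x)) / 2.
Proof.
move=> x0.
pose f (y : R) := (y + (1 - (1 + y)^-1)) / 2 - ln (1 + y).
have E (y : R) : 0 <= y -> y / (1 + y) = 1 - (1 + y)^-1.
  by move=> y0; field; rewrite gt_eqF// ltr_wpDr.
rewrite -subr_ge0 E//.
have /(_ f (fun y => (1 - (1 + y)^-1) ^+ 2 / 2) 0 x x0) := @is_derive_ge0_le R.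
have -> : f 0 = 0 by rewrite /f addr0 invr1 ln1 subrr addr0 mul0r subr0.
apply => y /andP[y0 _]; last first.
  by rewrite divr_ge0 ?sqr_ge0.
have y1 : 0 < 1 + y by rewrite ltr_wpDr.
have y1' : 1 + y != 0 by rewrite gt_eqF.
have d1 : is_derive y 1 (fun y : R => 1 + y) 1.
  have := @is_deriveD R R R (cst 1) id y 1 0 1 (is_derive_cst _ _ _) (is_derive_id _ _).
  by rewrite add0r.
have dv : is_derive y 1 (fun y : R => (1 + y)^-1) (- (1 + y)^-2).
  have := @is_deriveV R (fun y => 1 + y) y 1 1 y1' d1; rewrite /GRing.scale /= mulr1; exact.
have dl : is_derive y 1 (fun y : R => ln (1 + y)) (1 + y)^-1.
  have := @is_derive1_comp R (@ln R) (fun y => 1 + y) y (1 + y)^-1 1 (is_derive1_ln y1) d1.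
  by rewrite mulr1.
apply: is_derive_eq.
by rewrite /GRing.scale /=; field.
Qed.

(* A lower Stirling bound: the correction [(2 n)^-1] in the exponent turns the
   induction step into [ln1D_le]. *)
Lemma fact_sqr_ge (R : realType) (n : nat) : (0 < n)%N ->
  n%:R ^+ (2 * n + 1) * expR (- (2 * n%:R) + 3 / 2 + (2 * n%:R)^-1) <= n`!%:R ^+ 2 :> R.
Proof.
case: n => // n _; elim: n => [|n IH].
  by rewrite expr1n mul1r factS fact0 muln1 expr1n -[leRHS]expR0 ler_expR; lra.
set p : R := n.+1%:R in IH; have p0 : 0 < p by [].
have -> : n.+2%:R = p + 1 :> R by rewrite /p [LHS]mulrSr.
rewrite factS natrM exprMn.
have -> : n.+2%:R = p + 1 :> R by rewrite /p [LHS]mulrSr.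
have p1 : 0 < p + 1 by lra.
apply: le_trans (ler_wpM2l (sqr_ge0 _) IH).
have -> : (2 * n.+2 + 1 = 2 + (2 * n.+1 + 1))%N by rewrite !mul2n.
rewrite exprD -[leLHS]mulrA ler_pM2l ?exprn_gt0//.
have -> : (p + 1) ^+ (2 * n.+1 + 1) = p ^+ (2 * n.+1 + 1) * expR ((2 * p + 1) * ln (1 + p^-1)).
  have -> : 2 * p + 1 = (2 * n.+1 + 1)%:R by rewrite natrD natrM.
  rewrite expRM_natl lnK; last by rewrite posrE addr_gt0 ?invr_gt0.
  by rewrite -exprMn mulrDr mulr1 mulfV ?gt_eqF.
rewrite -mulrA ler_wpM2l ?exprn_ge0 ?(ltW p0)// -expRD ler_expR.
have h : (2 * p + 1) * ln (1 + p^-1) <= 2 + (2 * p)^-1 - (2 * (p + 1))^-1.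
  have := @ln1D_le R p^-1; rewrite invr_ge0 (ltW p0) => /(_ isT).
  rewrite -(@ler_pM2l _ (2 * p + 1)); last by lra.
  move=> /le_trans; apply; rewrite le_eqVlt; apply/orP; left; apply/eqP.
  by field; rewrite !gt_eqF//; lra.
by move: h; move: (_ * ln _) (2 * p)^-1 (2 * (p + 1))^-1 => l i1 i2; lra.
Qed.

(* The maximum of [x `^ p * expR (- 2 x)] is attained at [x = p / 2]. *)
Lemma powR_expR_le (R : realType) (p x : R) : 0 < p -> 0 <= x ->
  x `^ p * expR (- (2 * x)) <= (p / 2) `^ p * expR (- p).
Proof.
move=> p0 x0; have [->|xn0] := eqVneq x 0.
  by rewrite powR0 ?gt_eqF// mul0r mulr_ge0 ?powR_ge0 ?expR_ge0.
have xp : 0 < x by rewrite lt_def xn0.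
have y0 : 0 <= x / (p / 2) by rewrite divr_ge0// divr_ge0// ltW.
have -> : x = (p / 2) * (x / (p / 2)).
  by field; rewrite gt_eqF.
rewrite powRM ?divr_ge0 ?(ltW p0)// -mulrA ler_wpM2l ?powR_ge0//.
have -> : - (2 * (p / 2 * (x / (p / 2)))) = - p + - ((x / (p / 2) - 1) * p).
  by field; rewrite gt_eqF.
rewrite expRD mulrCA -[leRHS]mulr1 ler_wpM2l ?expR_ge0//.
rewrite expRN ler_pdivrMr ?expR_gt0// mul1r expRM ge0_ler_powR ?nnegrE ?(ltW p0) ?expR_ge0//.
by have := expR_ge1Dx (x / (p / 2) - 1); rewrite addrC subrK.
Qed.

(** With [p = 4 m + s], the maximum from [powR_expR_le] is [(2 m + s / 2)^p expR (- p)]. Its base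
    factors as [2 m (1 + s / (4 m))] under the power [4 m], and [(1 + s / (4 m))^(4 m) <= expR s]
    absorbs [expR (- s)]. The remaining power [s] is at most [(3 m)^s <= 9 m^s], and Stirling
    supplies a factor [5 m] in the denominator: hence [9 / 5] and [m^(s - 1)]. *)
Lemma powR_expR_le_fact (R : realType) (m : nat) (s x : R) : (0 < m)%N ->
  1 <= s <= 2 -> 0 <= x ->
  x `^ (4 * m%:R + s) * expR (- (2 * x)) <= 9 / 5 * m%:R `^ (s - 1) * (2 * m)`!%:R ^+ 2.
Proof.
move=> m0 /andP[s1 s2] x0; set M : R := m%:R.
have M1 : 1 <= M by rewrite /M ler1n.
have M0 : 0 < M by lra.
have p0 : 0 < 4 * M + s by lra.
apply: le_trans (powR_expR_le p0 x0) _.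
have -> : (4 * M + s) / 2 = 2 * M + s / 2 by lra.
rewrite [(2 * M + s / 2) `^ _]powRD; last by apply/implyP => _; rewrite gt_eqF//; lra.
have -> : (2 * M + s / 2) `^ (4 * M) = (2 * M) ^+ (4 * m) * (1 + s / (4 * M)) `^ (4 * M).
  rewrite -powR_mulrn; last by lra.
  rewrite natrM -/M -powRM; [|lra|by rewrite addr_ge0// divr_ge0; lra].
  by congr (_ `^ _); field; rewrite gt_eqF.
have h1 : (1 + s / (4 * M)) `^ (4 * M) <= expR s.
  have -> : expR s = expR (s / (4 * M)) `^ (4 * M) by rewrite -expRM mulfVK// gt_eqF//; lra.
  rewrite ge0_ler_powR ?nnegrE ?expR_ge0 ?expR_ge1Dx//; first lra.
  by rewrite addr_ge0// divr_ge0; lra.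
have h2 : (2 * M + s / 2) `^ s <= 9 * (M * M `^ (s - 1)).
  rewrite mulr_powRB1; [|lra|lra].
  apply: (@le_trans _ _ ((3 * M) `^ s)); first by rewrite ge0_ler_powR ?nnegrE; lra.
  rewrite powRM; [|lra|lra]; rewrite ler_wpM2r ?powR_ge0//.
  have -> : 9 = 3 `^ 2%:R :> R by rewrite powR_mulrn//; lra.
  by rewrite ler_powR//; lra.
have := @fact_sqr_ge R (2 * m); rewrite muln_gt0 m0 => /(_ isT).
set F := _%:R ^+ 2; rewrite natrM -/M => hF.
(* [5 / 2] is the lower bound [1 + 3 / 2] for the factor [expR (3 / 2 + ...)] in [fact_sqr_ge]. *)
have h3 : (2 * M) ^+ (4 * m) * (2 * M) * expR (- (4 * M)) * (5 / 2) <= F.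
  apply: le_trans hF; rewrite mulnA addn1 exprSr -[leLHS]mulrA ler_wpM2l//.
    by rewrite mulr_ge0 ?exprn_ge0//; lra.
  rewrite -addrA expRD (_ : 2 * (2 * M) = 4 * M); last lra.
  rewrite ler_wpM2l ?expR_ge0//.
  apply: le_trans (expR_ge1Dx _).
  have : 0 <= (2 * (2 * M))^-1 by rewrite invr_ge0; lra.
  lra.
have -> : expR (- (4 * M + s)) = expR (- (4 * M)) * expR (- s) by rewrite opprD expRD.
set a := (2 * M) ^+ (4 * m) in h3 *; set e4 := expR (- (4 * M)) in h3 *.
have a0 : 0 <= a by rewrite exprn_ge0//; lra.
have e0 : 0 <= e4 by rewrite expR_ge0.
set c := M `^ (s - 1) in h2 *; have c0 : 0 <= c by rewrite powR_ge0.
apply: (@le_trans _ _ (a * expR s * (9 * (M * c)) * (e4 * expR (- s)))).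
  rewrite ler_wpM2r ?mulr_ge0 ?expR_ge0// ler_pM ?mulr_ge0 ?powR_ge0// ler_wpM2l//.
have -> : a * expR s * (9 * (M * c)) * (e4 * expR (- s)) = a * 9 * M * c * e4 * (expR s * expR (- s)) by ring.
rewrite expRxMexpNx_1 mulr1.
apply: le_trans (ler_wpM2l _ h3); last by rewrite mulr_ge0//; lra.
rewrite le_eqVlt; apply/orP; left; apply/eqP; by field.
Qed.

(** * Gauss quadrature of exponentials *)

Lemma continuous_expRM (R : realType) (t : R) : continuous (fun y : R => expR (- (y * t))).
Proof.
move=> y; apply: continuous_comp; last exact: continuous_expR.
by apply: cvgN; apply: cvgM; [exact: cvg_id|exact: cvg_cst].
Qed.

Lemma continuous_powR_within (R : realType) (p u v : R) : 0 < u ->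
  {within `[u, v], continuous (fun y : R => y `^ p)}.
Proof.
move=> u0; apply: derivable_within_continuous => x; rewrite in_itv /= => /andP[ux _].
by apply: derivable_powR; rewrite in_itv/= andbT (lt_le_trans u0).
Qed.

Lemma integrable_itv_continuous (R : realType) (f : R -> R) (u v : R) :
  {within `[u, v], continuous f} ->
  (@lebesgue_measure R).-integrable `[u, v] (EFin \o f).
Proof. by move=> cf; apply: continuous_compact_integrable => //; exact: segment_compact. Qed.

(** Subtracting [p] changes neither side of the error, as the rule is exact on [p]. What is left is
    an integral and a sum of values bounded by [M]. Exactness on the constant 1 makes the positive
    quadrature weights sum to the mass of [w], so each of the two costs [M] times that mass. *)
Lemma gauss_rule_error (R : realType) (m : nat) (u v M : R) (w f : R -> R)
    (x eta : 'I_m -> R) (p : {poly R}) :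
  u <= v -> gauss_rule u v w x eta -> (0 < m)%N -> (size p <= 2 * m)%N ->
  {within `[u, v], continuous w} -> {within `[u, v], continuous f} ->
  (forall y, u <= y <= v -> 0 <= w y) ->
  (forall y, u <= y <= v -> `|f y - p.[y]| <= M) ->
  `|(\int[lebesgue_measure]_(y in `[u, v]) (f y * w y)) - \sum_(k < m) eta k * f (x k)|
    <= 2 * M * \int[lebesgue_measure]_(y in `[u, v]) w y.
Proof.
move=> uv [_ xuv eta0 exact_p] m0 sp cw cf w0 fpM.
have cp : {within `[u, v], continuous (horner p)}.
  by apply: continuous_subspaceT; exact: continuous_horner.
have iw := integrable_itv_continuous cw.
have M0 : 0 <= M by apply: le_trans (fpM u _); rewrite ?lexx.
have W : \int[lebesgue_measure]_(y in `[u, v]) w y = \sum_(k < m) eta k.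
  rewrite [RHS](_ : _ = \sum_(k < m) eta k * (1 : {poly R}).[x k]); last first.
    by apply: eq_bigr => k _; rewrite hornerC mulr1.
  rewrite -exact_p ?size_poly1 ?mul2n -?addnn ?addn_gt0 ?m0//.
  by apply: eq_Rintegral => y _; rewrite hornerC mul1r.
have cM (g h : R -> R) : {within `[u, v], continuous g} -> {within `[u, v], continuous h} ->
    {within `[u, v], continuous (fun y => g y * h y)}.
  by move=> cg ch y; apply: cvgM; [exact: cg|exact: ch].
have cB (g h : R -> R) : {within `[u, v], continuous g} -> {within `[u, v], continuous h} ->
    {within `[u, v], continuous (fun y => g y - h y)}.
  by move=> cg ch y; apply: cvgB; [exact: cg|exact: ch].
have E : (\int[lebesgue_measure]_(y in `[u, v]) (f y * w y)) =
  \int[lebesgue_measure]_(y in `[u, v]) ((f y - p.[y]) * w y) +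
  \int[lebesgue_measure]_(y in `[u, v]) (p.[y] * w y).
  rewrite -RintegralD//; [|exact/integrable_itv_continuous/cM/cw/cB|exact/integrable_itv_continuous/cM].
  by apply: eq_Rintegral => y _; rewrite -mulrDl subrK.
rewrite E exact_p// -addrA -sumrB.
apply: le_trans (ler_normD _ _) _.
rewrite [X in _ <= X](_ : _ = M * (\int[lebesgue_measure]_(y in `[u, v]) w y) +
  M * (\int[lebesgue_measure]_(y in `[u, v]) w y)); last by ring.
apply: lerD.
  apply: le_trans (le_normr_Rintegral _ _) _ => //.
    exact/integrable_itv_continuous/cM/cw/cB.
  rewrite -RintegralZl//; apply: le_Rintegral => //.
  - apply: integrable_itv_continuous => y; apply: cvg_comp; last exact: norm_continuous.
    exact: (cM _ _ (cB _ _ cf cp) cw).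
  - have -> : EFin \o (fun y => M * w y) = (fun y => M%:E * (EFin \o w) y)%E by [].
    exact: integrableZl.
  - move=> y /=; rewrite in_itv /= => yuv; rewrite normrM (ger0_norm (w0 _ yuv)).
    by rewrite ler_wpM2r ?w0 ?fpM.
rewrite {1}W mulr_sumr; apply: le_trans (ler_norm_sum _ _ _) _; apply: ler_sum => k _.
rewrite -mulrBr normrM (ger0_norm (ltW (eta0 k))) mulrC ler_wpM2r ?(ltW (eta0 k))//.
rewrite distrC fpM//; have /andP[h1 h2] := xuv k; by rewrite !ltW.
Qed.

(** The two sides of the midpoint [c] need different forms of [expR_taylor]. To the left, the
    remainder carries [expR ((c - y) t)], which combines with [expR (- c t)] into [expR (- y t)]; to
    the right it carries no exponential. Both are at most [expR (- u t)], and this decay is kept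
    because it is what tames the power of [t] later. *)
Lemma expR_poly_approx (R : realType) (m : nat) (t u v : R) : 0 <= t -> u <= v ->
  exists2 p : {poly R}, (size p <= m)%N &
    forall y, u <= y <= v -> `|expR (- (y * t)) - p.[y]| <=
      expR (- (u * t)) * ((t * ((v - u) / 2)) ^+ m / m`!%:R).
Proof.
move=> t0 uv; pose c := (u + v) / 2.
pose q : {poly R} := \sum_(i < m) ((- t) ^+ i / i`!%:R) *: ('X - c%:P) ^+ i.
exists (expR (- (c * t)) *: q).
  apply: leq_trans (size_scale_leq _ _) _; apply: (leq_trans (size_sum _ _ _)).
  apply/bigmax_leqP => i _; apply: leq_trans (size_scale_leq _ _) _.
  by rewrite size_exp_XsubC.
move=> y /andP[uy yv].
have -> : expR (- (y * t)) = expR (- (c * t)) * expR (- ((y - c) * t)).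
  by rewrite -expRD; congr expR; ring.
have -> : (expR (- (c * t)) *: q).[y] =
    expR (- (c * t)) * \sum_(i < m) (- ((y - c) * t)) ^+ i / i`!%:R.
  rewrite hornerZ horner_sum; congr (_ * _); apply: eq_bigr => i _.
  rewrite hornerZ horner_exp hornerXsubC mulrAC -exprMn; congr (_ ^+ _ / _); ring.
rewrite -mulrBr normrM ger0_norm ?expR_ge0//.
have m0 : 0 < (m`!%:R : R) by rewrite ltr0n fact_gt0.
have [yc|yc] := leP y c.
  have z0 : 0 <= (c - y) * t by rewrite mulr_ge0// subr_ge0.
  have := @expR_taylor R m 1 1 ((c - y) * t); rewrite normr1 !mul1r lexx => /(_ isT ler01 isT z0).
  have -> : - ((y - c) * t) = (c - y) * t by ring.
  move=> h; apply: le_trans (ler_wpM2l (expR_ge0 _) h) _.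
  rewrite [leLHS]mulrA -expRD ler_pM ?expR_ge0 ?divr_ge0 ?exprn_ge0 ?(ltW m0)//.
    by rewrite ler_expR (_ : - (c * t) + (c - y) * t = - (y * t)); [rewrite lerN2 ler_wpM2r|ring].
  rewrite ler_pM2r ?invr_gt0//; apply: lerXn2r; rewrite ?nnegrE ?mulr_ge0//.
    by rewrite subr_ge0.
    by rewrite subr_ge0.
  by rewrite mulrC ler_wpM2l// /c; lra.
have z0 : 0 <= (y - c) * t by rewrite mulr_ge0// subr_ge0 ltW.
have := @expR_taylor R m (-1) 0 ((y - c) * t); rewrite normrN normr1 !mulN1r lexx => /(_ isT (lexx _) (lerN10 _) z0).
rewrite mul0r expR0 mul1r => h; apply: le_trans (ler_wpM2l (expR_ge0 _) h) _.
rewrite ler_pM ?expR_ge0 ?divr_ge0 ?exprn_ge0 ?(ltW m0)//.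
  by rewrite ler_expR lerN2 ler_wpM2r// /c; lra.
rewrite ler_pM2r ?invr_gt0//; apply: lerXn2r; rewrite ?nnegrE ?mulr_ge0//.
  by rewrite subr_ge0 ltW.
  by rewrite subr_ge0.
by rewrite mulrC ler_wpM2l// /c; lra.
Qed.

Lemma powR_ler_neg (R : realType) (p u v : R) : p <= 0 -> 0 < u -> u <= v ->
  v `^ p <= u `^ p.
Proof.
move=> p0 u0 uv; have v0 : 0 < v by exact: lt_le_trans uv.
rewrite -(opprK p) 2!(powRN _ (- p)) lef_pV2 ?posrE ?powR_gt0//.
by rewrite ge0_ler_powR ?nnegrE ?oppr_ge0 ?(ltW u0) ?(ltW v0).
Qed.

(** Squared, the bound contains [(u t)^(4 m)] from the Taylor remainder, [u^2] from the length,
    [u^(1 - 2 H)] from the weight and [t^2] from the prefactor. Together they form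
    [(u t)^(4 m + 3 - 2 H) t^(2 H - 1)], and [powR_expR_le_fact] with [s = 3 - 2 H] removes the
    first factor along with [(2 m)!^2]. *)
Lemma gauss_rule_expR_error (R : realType) (H t u v : R) (m : nat) (x eta : 'I_m -> R) :
  1 / 2 < H < 1 -> 0 <= cH H -> 0 < u -> u < v -> (0 < m)%N -> 0 <= t ->
  gauss_rule u v (weight H) x eta ->
  (t * ((\int[lebesgue_measure]_(y in `[u, v]) (expR (- (y * t)) * weight H y)) -
     \sum_(k < m) eta k * expR (- (x k * t)))) ^+ 2 <=
  144 / 5 * cH H ^+ 2 * m%:R `^ (2 - 2 * H) * ((v / u - 1) / 2) ^+ (4 * m + 2) * t `^ (2 * H - 1).
Proof.
move=> /andP[H1 H2] c0 u0 uv m0 t0 gr; set c := cH H in c0 *.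
set q := (v / u - 1) / 2.
have q0 : 0 <= q by rewrite /q divr_ge0// subr_ge0 ler_pdivlMr// mul1r ltW.
have vuq : (v - u) / 2 = u * q by rewrite /q; field; rewrite gt_eqF.
have cw : {within `[u, v], continuous (weight H)}.
  by move=> y; apply: cvgM; [exact: cvg_cst|exact: continuous_powR_within].
have cf : {within `[u, v], continuous (fun y : R => expR (- (y * t)))}.
  by apply: continuous_subspaceT; exact: continuous_expRM.
have [p sp hp] := @expR_poly_approx R (2 * m) t u v t0 (ltW uv).
have w0 y : u <= y <= v -> 0 <= weight H y.
  by move=> _; rewrite mulr_ge0// powR_ge0.
have := gauss_rule_error (ltW uv) gr m0 sp cw cf w0 hp.
set I := _ - _; set F : R := (2 * m)`!%:R; set W := Rintegral _ _ _ => h.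
have F0 : 0 < F by rewrite ltr0n fact_gt0.
(* The weight is decreasing, so its mass is at most its value at [u] times the length [2 u q]. *)
have hW : W <= c * u `^ (1 / 2 - H) * (u * q * 2).
  have -> : c * u `^ (1 / 2 - H) * (u * q * 2) =
      \int[lebesgue_measure]_(y in `[u, v]) (cst (c * u `^ (1 / 2 - H)) y).
    rewrite Rintegral_cst//; congr (_ * _).
    rewrite /= lebesgue_measure_itv/= lte_fin uv -EFinB.
    by rewrite /= -vuq; field.
  apply: le_Rintegral => //.
  - exact: integrable_itv_continuous.
  - by apply: integrable_itv_continuous => y; exact: cvg_cst.
  - move=> y /=; rewrite in_itv /= => /andP[uy _]; rewrite /weight ler_wpM2l//.
    by apply: powR_ler_neg => //; lra.
have W0 : 0 <= W.
  by apply: Rintegral_ge0 => y /=; rewrite in_itv; exact: w0.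
set e := expR (- (u * t)) in h.
have e0 : 0 <= e by exact: expR_ge0.
have ut0 : 0 <= u * t by rewrite mulr_ge0// ltW.
set k := (2 * m)%N in h.
(* The 4 is the 2 of [gauss_rule_error] times the 2 in [v - u = 2 u q]. Squared and multiplied by
   [9 / 5] it becomes [144 / 5]. *)
have hI : `|t * I| <= t * (4 * (e * ((u * t * q) ^+ k / F)) * (c * u `^ (1 / 2 - H) * (u * q))).
  rewrite normrM ger0_norm// ler_wpM2l//; apply: le_trans h _.
  apply: le_trans (ler_wpM2l _ hW) _.
    by rewrite vuq; nonneg.
  rewrite le_eqVlt; apply/orP; left; apply/eqP.
  rewrite vuq (_ : t * (u * q) = u * t * q); last by ring.
  ring.
rewrite -[leLHS]real_normK ?num_real//.
apply: le_trans (lerXn2r 2 _ _ hI) _; rewrite ?nnegrE ?normr_ge0//.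
  by nonneg.
have [->|tn0] := eqVneq t 0.
  by rewrite mul0r expr0n /=; nonneg.
have tp : 0 < t by rewrite lt_def tn0.
have utp : 0 < u * t by rewrite mulr_gt0.
have := @powR_expR_le_fact R m (3 - 2 * H) (u * t) m0 _ ut0.
rewrite (_ : 1 <= 3 - 2 * H <= 2); last by apply/andP; split; lra.
move=> /(_ isT).
rewrite (_ : 3 - 2 * H - 1 = 2 - 2 * H); last by ring.
rewrite -/k -/F.
have -> : expR (- (2 * (u * t))) = e ^+ 2.
  by rewrite /e -expRM_natl mulrN.
have -> : (u * t) `^ (4 * m%:R + (3 - 2 * H)) =
    (u * t) ^+ (2 * k) * (u `^ (3 - 2 * H) * t `^ (3 - 2 * H)).
  rewrite powRD; last by apply/implyP => _; rewrite gt_eqF.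
  rewrite -powRM ?(ltW u0) ?(ltW tp)//; congr (_ * _).
  by rewrite -powR_mulrn// /k mulnA natrM.
have -> : u `^ (3 - 2 * H) = u ^+ 2 * (u `^ (1 / 2 - H)) ^+ 2.
  rewrite -!powR_mulrn ?powR_ge0 ?(ltW u0)// -powRrM -powRD; last first.
    by apply/implyP => _; rewrite gt_eqF.
  by congr (_ `^ _); field.
set z := u `^ (1 / 2 - H); set M := m%:R `^ (2 - 2 * H).
(* Only the power [3 - 2 H] of [t] is needed to match that of [u]; the rest, [t^(2 H - 1)], is left
   over and integrates to [T^(2 H) / (2 H)]. *)
have E : t ^+ 2 = t `^ (3 - 2 * H) * t `^ (2 * H - 1).
  rewrite -powR_mulrn ?(ltW tp)// -powRD; last first.
    by apply/implyP => _; rewrite gt_eqF.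
  by congr (_ `^ _); field.
set t3 := t `^ (3 - 2 * H) in E *; set t1 := t `^ (2 * H - 1) in E *.
move=> h5.
have -> : (t * (4 * (e * ((u * t * q) ^+ k / F)) * (c * z * (u * q)))) ^+ 2 =
    16 * c ^+ 2 * q ^+ (4 * m + 2) * t1 / F ^+ 2 *
      ((u * t) ^+ (2 * k) * (u ^+ 2 * z ^+ 2 * t3) * e ^+ 2).
  transitivity (t ^+ 2 * (16 * c ^+ 2 * q ^+ (4 * m + 2) / F ^+ 2 *
      ((u * t) ^+ (2 * k) * (u ^+ 2 * z ^+ 2) * e ^+ 2))); last first.
    by rewrite E; ring.
  have -> : q ^+ (4 * m + 2) = (q ^+ k) ^+ 2 * q ^+ 2.
    by rewrite -exprM -exprD /k (mulnC 2 m) -mulnA mulnC.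
  have -> : (u * t) ^+ (2 * k) = ((u * t) ^+ k) ^+ 2 by rewrite -exprM mulnC.
  rewrite [(u * t * q) ^+ k]exprMn.
  move: (q ^+ k) ((u * t) ^+ k) => qk utk.
  by field; rewrite gt_eqF.
apply: le_trans (ler_wpM2l _ h5) _.
  by nonneg.
by rewrite le_eqVlt; apply/orP; left; apply/eqP; field; rewrite gt_eqF.
Qed.

Lemma sin_le_id (R : realType) (x : R) : 0 <= x -> sin x <= x.
Proof.
move=> x0; rewrite -subr_ge0.
have /(_ (fun y => y - sin y) (fun y => 1 - cos y) 0 x x0) := @is_derive_ge0_le R.
rewrite sin0 subrr; apply => y _; last by rewrite subr_ge0 cos_le1.
Qed.

(** The quadrature term comes out with constant [6 * 144 / 10], to be compared with
    [2 * 49 * pi^3 / 24]; this asks for [pi^3] above about 21.16. From [sin (pi / 4)^2 = 1 / 2] and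
    [sin x <= x] one gets [pi >= 2 sqrt 2], hence [pi >= 2.8], whose cube is 21.952. *)
Lemma pi_cube_ge (R : realType) : 2195 / 100 <= pi ^+ 3 :> R.
Proof.
have p0 : 0 <= pi / 4 :> R by rewrite divr_ge0// pi_ge0.
have h : sin (pi / 4) ^+ 2 = 1 / 2 :> R.
  have := @cos_pihalf R; rewrite (_ : pi / 2 = pi / 4 + pi / 4 :> R); last by field.
  rewrite cosD -!expr2; have := cos2Dsin2 (pi / 4 : R); lra.
have h1 : sin (pi / 4) <= pi / 4 :> R by exact: sin_le_id.
have h2 : 0 <= sin (pi / 4) :> R.
  by apply: sin_ge0_pi; rewrite p0 /=; have := @pi_ge0 R; lra.
have h3 : 1 / 2 <= (pi / 4 : R) ^+ 2 by rewrite -h; apply: lerXn2r; rewrite ?nnegrE.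
have h4 : 28 / 10 <= pi :> R.
  by rewrite leNgt; apply/negP => hl; move: h3; rewrite leNgt => /negP; apply; nra.
have : (28 / 10) ^+ 3 <= pi ^+ 3 :> R by apply: lerXn2r; rewrite ?nnegrE ?pi_ge0//; lra.
lra.
Qed.

(** * Laplace transforms of powers *)

Lemma integral_itv_is_derive (R : realType) (f F : R -> R) (u v : R) : u < v ->
  {within `[u, v], continuous f} ->
  {in `[u, v], forall x : R, is_derive x 1 F (f x)} ->
  (\int[lebesgue_measure]_(x in `[u, v]) (f x)%:E = (F v - F u)%:E)%E.
Proof.
move=> uv cf dF'.
have dF x : u <= x <= v -> is_derive x 1 F (f x) by move=> h; apply: dF'; rewrite in_itv.
have cF x : u <= x <= v -> {for x, continuous F}.
  by move=> /dF[dFx _]; exact/differentiable_continuous/derivable1_diffP.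
rewrite (continuous_FTC2 uv cf (F := F))//.
- split.
  + by move=> x; rewrite in_itv /= => /andP[ux xv]; have [] : is_derive x 1 F (f x) by apply: dF; rewrite !ltW.
  + by apply: cvg_at_right_filter; apply: cF; rewrite lexx ltW.
  + by apply: cvg_at_left_filter; apply: cF; rewrite lexx ltW.
- move=> x; rewrite in_itv /= => /andP[ux xv]; rewrite derive1E.
  by have [] : is_derive x 1 F (f x) by apply: dF; rewrite !ltW.
Qed.

(** Improper integrals are reached by monotone convergence along compact intervals, so that the
    fundamental theorem and the change of variables are only ever applied on compact ones. *)
Lemma cvg_integral_itv (R : realType) (f : R -> R) (a b : nat -> R) (D : set R) :
  measurable D -> measurable_fun D f -> (forall x, D x -> 0 <= f x) ->
  (forall n, a n.+1 <= a n) -> (forall n, b n <= b n.+1) ->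
  D = \bigcup_n `[a n, b n]%classic ->
  (\int[lebesgue_measure]_(x in `[a n, b n]) (f x)%:E)%E @[n --> \oo] -->
    (\int[lebesgue_measure]_(x in D) (f x)%:E)%E.
Proof.
move=> mD mf f0 ha hb DE; rewrite DE.
have sub n : `[a n, b n]%classic `<=` D by rewrite DE => x hx; exists n.
have h := @ge0_nondecreasing_set_cvg_integral _ (measurableTypeR R) R
  (fun n => `[a n, b n]%classic) (EFin \o f) lebesgue_measure.
apply: h => //.
- apply/nondecreasing_seqP => n; rewrite subsetEset => x /=; rewrite !in_itv /= => /andP[h1 h2].
  by rewrite (le_trans (ha n) h1) (le_trans h2 (hb n)).
- by move=> n; apply/measurable_EFinP; exact: measurable_funS (sub n) mf.
- by move=> n x /sub /f0; rewrite lee_fin.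
Qed.

Lemma integral_itv_le (R : realType) (f : R -> R) (a b : nat -> R) (D : set R) (M : \bar R) :
  measurable D -> measurable_fun D f -> (forall x, D x -> 0 <= f x) ->
  (forall n, a n.+1 <= a n) -> (forall n, b n <= b n.+1) ->
  D = \bigcup_n `[a n, b n]%classic ->
  (forall n, (\int[lebesgue_measure]_(x in `[a n, b n]) (f x)%:E <= M)%E) ->
  (\int[lebesgue_measure]_(x in D) (f x)%:E <= M)%E.
Proof.
move=> mD mf f0 ha hb DE hM; have h := cvg_integral_itv mD mf f0 ha hb DE.
rewrite -(cvg_lim _ h)//; apply: lime_le; first by apply/cvg_ex; eexists; exact: h.
exact: nearW.
Qed.

Lemma exists_nat_divr_le (R : realType) (c x : R) : 0 < c -> 0 < x ->
  exists n, c / n.+1%:R <= x.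
Proof.
move=> c0 x0; exists (Num.bound (c / x)).
rewrite ler_pdivrMr// mulrC -ler_pdivrMr//.
apply: le_trans (ltW (archi_boundP _)) _; first by rewrite divr_ge0// ltW.
by rewrite ler_nat.
Qed.

Lemma exists_nat_ler_mul (R : realType) (c x : R) : 0 < c -> 0 <= x ->
  exists n, x <= c * n.+1%:R.
Proof.
move=> c0 x0; exists (Num.bound (x / c)).
rewrite -ler_pdivrMl// mulrC; apply: le_trans (ltW (archi_boundP _)) _; first by rewrite divr_ge0// ltW.
by rewrite ler_nat.
Qed.

Lemma divr_natS_le (R : realType) (c : R) (n : nat) : 0 <= c -> c / n.+2%:R <= c / n.+1%:R.
Proof. by move=> c0; rewrite ler_wpM2l// lef_pV2 ?posrE// ler_nat. Qed.

Lemma mulr_natS_le (R : realType) (c : R) (n : nat) : 0 <= c -> c * n.+1%:R <= c * n.+2%:R.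
Proof. by move=> c0; rewrite ler_wpM2l// ler_nat. Qed.

Lemma itv0c_bigcup (R : realType) (c : R) : 0 < c ->
  (`]0, c]%classic : set R) = \bigcup_n `[c / n.+1%:R, c]%classic.
Proof.
move=> c0; apply/seteqP; split => x /=; rewrite in_itv /=.
  move=> /andP[x0 xc]; have [n hn] := exists_nat_divr_le c0 x0.
  by exists n => //=; rewrite in_itv /= hn.
move=> [n _] /=; rewrite in_itv /= => /andP[h ->]; rewrite andbT.
by apply: lt_le_trans h; rewrite divr_gt0.
Qed.

Lemma itvcy_bigcup (R : realType) (c : R) : 0 < c ->
  (`[c, +oo[%classic : set R) = \bigcup_n `[c, c * n.+1%:R]%classic.
Proof.
move=> c0; apply/seteqP; split => x /=; rewrite in_itv /= ?andbT.
  move=> cx; have [n hn] := exists_nat_ler_mul c0 (le_trans (ltW c0) cx).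
  by exists n => //=; rewrite in_itv /= cx.
by move=> [n _] /=; rewrite in_itv /= => /andP[].
Qed.

Lemma itv0y_bigcup (R : realType) (c d : R) : 0 < c -> 0 < d ->
  (`]0, +oo[%classic : set R) = \bigcup_n `[c / n.+1%:R, d * n.+1%:R]%classic.
Proof.
move=> c0 d0; apply/seteqP; split => x /=; rewrite in_itv /= ?andbT.
  move=> x0; have [n hn] := exists_nat_divr_le c0 x0.
  have [k hk] := exists_nat_ler_mul d0 (ltW x0).
  exists (maxn n k) => //=; rewrite in_itv /=; apply/andP; split.
    by apply: le_trans hn; rewrite ler_wpM2l ?(ltW c0)// lef_pV2 ?posrE// ler_nat ltnS leq_maxl.
  by apply: (le_trans hk); rewrite ler_wpM2l ?(ltW d0)// ler_nat ltnS leq_maxr.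
move=> [n _] /=; rewrite in_itv /= => /andP[h _].
by apply: lt_le_trans h; rewrite divr_gt0.
Qed.

Lemma integral_powR_0c_le (R : realType) (p c : R) : -1 < p -> 0 < c ->
  (\int[lebesgue_measure]_(x in `]0%R, c]) (x `^ p)%:E <= (c `^ (p + 1) / (p + 1))%:E)%E.
Proof.
move=> p1 c0; have q0 : 0 < p + 1 by lra.
apply: (@integral_itv_le R _ (fun n => c / n.+1%:R) (fun=> c)) => //.
- by apply: measurable_funTS; exact: measurable_powR.
- by move=> x _; exact: powR_ge0.
- by move=> n; apply: divr_natS_le; exact: ltW.
- exact: itv0c_bigcup.
move=> n; set u := c / _; have u0 : 0 < u by rewrite divr_gt0.
(* For [n = 0] the interval is the single point [c], while [integral_itv_is_derive] asks for
   distinct endpoints. *)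
have [->|uc] := eqVneq u c.
  by rewrite set_itv1 integral_set1 lee_fin divr_ge0 ?powR_ge0 ?ltW.
have {}uc : u < c by rewrite lt_def eq_sym uc /u ler_pdivrMr// ler_peMr ?(ltW c0)// ler1n.
rewrite (@integral_itv_is_derive R (fun x => x `^ p) (fun x => x `^ (p + 1) / (p + 1)))//.
- by rewrite lee_fin gerBl// divr_ge0 ?powR_ge0 ?ltW.
- exact: continuous_powR_within.
- move=> x; rewrite in_itv /= => /andP[ux _]; have x0 : 0 < x by exact: lt_le_trans ux.
  have := @is_deriveM R R (fun y => y `^ (p + 1)) (cst (p + 1)^-1) x 1 _ _ (is_derive1_powR (p + 1) x0) (is_derive_cst _ _ _).
  rewrite scaler0 add0r /GRing.scale /= addrK mulrA mulVf ?gt_eqF// mul1r; exact.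
Qed.

Lemma integral_powR_cy_le (R : realType) (p c : R) : p < -1 -> 0 < c ->
  (\int[lebesgue_measure]_(x in `[c, +oo[) (x `^ p)%:E <= (c `^ (p + 1) / (- (p + 1)))%:E)%E.
Proof.
move=> p1 c0; have q0 : 0 < - (p + 1) by lra.
apply: (@integral_itv_le R _ (fun=> c) (fun n => c * n.+1%:R)) => //.
- by apply: measurable_funTS; exact: measurable_powR.
- by move=> x _; exact: powR_ge0.
- by move=> n; apply: mulr_natS_le; exact: ltW.
- exact: itvcy_bigcup.
move=> n; set v := c * _.
have [->|vc] := eqVneq v c.
  by rewrite set_itv1 integral_set1 lee_fin divr_ge0 ?powR_ge0 ?ltW.
have {}vc : c < v by rewrite lt_def vc /v ler_peMr ?(ltW c0)// ler1n.
rewrite (@integral_itv_is_derive R (fun x => x `^ p) (fun x => x `^ (p + 1) / (p + 1)))//.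
- rewrite lee_fin invrN mulrN gerDr; apply: mulr_ge0_le0; rewrite ?powR_ge0// invr_le0; lra.
- exact: continuous_powR_within.
- move=> x; rewrite in_itv /= => /andP[ux _]; have x0 : 0 < x by exact: lt_le_trans ux.
  have := @is_deriveM R R (fun y => y `^ (p + 1)) (cst (p + 1)^-1) x 1 _ _ (is_derive1_powR (p + 1) x0) (is_derive_cst _ _ _).
  rewrite scaler0 add0r /GRing.scale /= addrK mulrA mulVf ?lt_eqF// ?mul1r; [exact|lra].
Qed.

Lemma measurable_expRM (R : realType) (t : R) (D : set R) :
  measurable_fun D (fun y : R => expR (- (y * t))).
Proof. by apply: measurable_funTS; apply: continuous_measurable_fun; exact: continuous_expRM. Qed.

Lemma measurable_laplace (R : realType) (p t : R) (D : set R) :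
  measurable_fun D (fun y : R => expR (- (y * t)) * y `^ p).
Proof.
by apply: measurable_funM; [exact: measurable_expRM|apply: measurable_funTS; exact: measurable_powR].
Qed.

Lemma continuous_laplace (R : realType) (p t u v : R) : 0 < u ->
  {within `[u, v], continuous (fun y : R => expR (- (y * t)) * y `^ p)}.
Proof.
move=> u0 y; apply: cvgM; last exact: continuous_powR_within.
by apply: continuous_subspaceT; exact: continuous_expRM.
Qed.

(* [(y / (1 + y)) `^ (p + 1)] is bounded, and its derivative dominates the integrand. *)
Lemma integral_gamma_lty (R : realType) (p : R) : -1 < p -> p <= 0 ->
  (\int[lebesgue_measure]_(y in `]0%R, +oo[) (expR (- (y * 1)) * y `^ p)%:E < +oo)%E.
Proof.
move=> p1 p0; have q0 : 0 < p + 1 by lra.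
pose F (y : R) := 4 / (p + 1) * (y / (1 + y)) `^ (p + 1).
pose f (y : R) := 4 * (y / (1 + y)) `^ p * (1 + y) ^- 2.
have pos (y : R) : 0 < y -> 0 < y / (1 + y) by move=> y0; rewrite divr_gt0// addr_gt0.
have dF (y : R) : 0 < y -> is_derive y 1 F (f y).
  move=> y0; have y1 : 0 < 1 + y by rewrite addr_gt0.
  have d1 : is_derive y 1 (fun y : R => 1 + y) 1.
    have := @is_deriveD R R R (cst 1) id y 1 0 1 (is_derive_cst _ _ _) (is_derive_id _ _).
    by rewrite add0r.
  have dv : is_derive y 1 (fun y : R => (1 + y)^-1) (- (1 + y)^-2).
    have := @is_deriveV R (fun y => 1 + y) y 1 1 (lt0r_neq0 y1) d1; rewrite /GRing.scale /= mulr1; exact.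
  have dg : is_derive y 1 (fun y : R => y / (1 + y)) ((1 + y) ^- 2).
    have := @is_deriveM R R id (fun y : R => (1 + y)^-1) y 1 _ _ (is_derive_id _ _) dv.
    move/is_derive_eq; apply; rewrite /GRing.scale /=; field; exact: lt0r_neq0.
  have dp : is_derive (y / (1 + y)) 1 (fun z : R => z `^ (p + 1)) ((p + 1) * (y / (1 + y)) `^ p).
    by have := is_derive1_powR (p + 1) (pos y y0); rewrite addrK.
  have dc := @is_derive1_comp R (fun z : R => z `^ (p + 1)) (fun y : R => y / (1 + y)) y _ _ dp dg.
  have := @is_deriveZ R R R _ (4 / (p + 1)) y 1 _ dc.
  move/is_derive_eq; apply; rewrite /GRing.scale /= /f; field; rewrite gt_eqF//; exact: lt0r_neq0.
apply: (@le_lt_trans _ _ (4 / (p + 1))%:E); last exact: ltry.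
apply: (@integral_itv_le R _ (fun n => 1 / n.+1%:R) (fun n => 2 * n.+1%:R)) => //.
- exact: measurable_laplace.
- by move=> y _; nonneg.
- by move=> n; apply: divr_natS_le.
- by move=> n; apply: mulr_natS_le.
- exact: itv0y_bigcup.
move=> n; set u := 1 / _; set v := 2 * _.
have u0 : 0 < u by rewrite divr_gt0.
have uv : u < v.
  apply: (@le_lt_trans _ _ 1); first by rewrite /u ler_pdivrMr// mul1r ler1n.
  by apply: (@lt_le_trans _ _ 2); [lra|rewrite /v ler_peMr// ler1n].
have cf : {within `[u, v], continuous f}.
  apply: continuous_in_subspaceT => y; rewrite inE /= in_itv /= => /andP[uy _].
  have y0 : 0 < y by exact: lt_le_trans uy.
  have y1 : 0 < 1 + y by rewrite addr_gt0.
  have c1 : (fun z : R => 1 + z) @ y --> 1 + y by apply: cvgD; [exact: cvg_cst|exact: cvg_id].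
  apply: cvgM; last by apply: cvgV; [rewrite lt0r_neq0// exprn_gt0|exact: cvgM].
  apply: cvgM; first exact: cvg_cst.
  apply: (@cvg_comp _ _ _ (fun z : R => z / (1 + z)) (fun z : R => z `^ p) _ (nbhs (y / (1 + y)))).
    by apply: cvgM; [exact: cvg_id|apply: cvgV => //; exact: lt0r_neq0].
  have cp : {for y / (1 + y), continuous (fun z : R => z `^ p)}.
    apply/differentiable_continuous/derivable1_diffP/derivable_powR.
    by rewrite in_itv/= andbT pos.
  exact: cp.
apply: (@le_trans _ _ (\int[lebesgue_measure]_(y in `[u, v]) (f y)%:E)%E).
  apply: ge0_le_integral => //.
  - by move=> y _; rewrite lee_fin; nonneg.
  - by apply/measurable_EFinP; exact: measurable_laplace.
  - by apply/measurable_EFinP; apply: subspace_continuous_measurable_fun => //; exact: cf.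
  - move=> y /=; rewrite in_itv /= lee_fin => /andP[uy _].
    have y0 : 0 < y by exact: lt_le_trans uy.
    have y1 : 0 < 1 + y by rewrite addr_gt0.
    (* The factor 4 comes from [expR y = expR (y / 2)^2 >= (1 + y / 2)^2 >= (1 + y)^2 / 4]. The
       powers compare because [p <= 0] and [y / (1 + y) <= y]. *)
    rewrite /f mulrAC mulr1; apply: ler_pM; rewrite ?expR_ge0 ?powR_ge0//.
      rewrite ler_pdivlMr ?exprn_gt0// expRN mulrC ler_pdivrMr ?expR_gt0//.
      have h : 1 + y / 2 <= expR (y / 2) by exact: expR_ge1Dx.
      have -> : expR y = expR (y / 2) ^+ 2 by rewrite -expRM_natl; congr expR; field.
      nra.
    apply: powR_ler_neg => //; first exact: pos.
    by rewrite ler_pdivrMr// ler_peMr ?(ltW y0)//; lra.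
rewrite (@integral_itv_is_derive R f F)//; last first.
  by move=> y; rewrite in_itv /= => /andP[uy _]; apply: dF; exact: lt_le_trans uy.
rewrite lee_fin; apply: (@le_trans _ _ (F v)).
  by rewrite gerBl /F !mulr_ge0 ?invr_ge0 ?powR_ge0 ?(ltW q0).
rewrite /F ler_piMr//; first by rewrite divr_ge0// ltW.
have v0 : 0 < v by exact: lt_trans uv.
have := @ge0_ler_powR R (p + 1) (ltW q0) (v / (1 + v)) 1.
rewrite powR1; apply; rewrite ?nnegrE ?(ltW (pos _ v0))//.
by rewrite ler_pdivrMr ?addr_gt0// mul1r lerDr.
Qed.

(** This is the substitution of [t y] for [y]. Stated in the extended reals, it also carries
    finiteness from [t = 1] to every positive [t], which is how [integrable_laplace] uses it. *)
Lemma laplace_powR (R : realType) (p t : R) : 0 < t ->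
  (\int[lebesgue_measure]_(y in `]0%R, +oo[) (expR (- (y * 1)) * y `^ p)%:E =
   (t `^ (p + 1))%:E * \int[lebesgue_measure]_(y in `]0%R, +oo[) (expR (- (y * t)) * y `^ p)%:E)%E.
Proof.
move=> t0.
have g0 (s : R) y : 0 <= expR (- (y * s)) * y `^ p by nonneg.
rewrite -ge0_integralZl_EFin ?powR_ge0//; last 2 first.
  by move=> y _; rewrite lee_fin.
  by apply/measurable_EFinP; exact: measurable_laplace.
under [RHS]eq_integral do rewrite -EFinM.
have c1 : 0 < 1 / t by rewrite divr_gt0.
have h1 := @cvg_integral_itv R (fun y => expR (- (y * 1)) * y `^ p)
  (fun n => 1 / n.+1%:R) (fun n => 2 * n.+1%:R) `]0, +oo[%classic (measurable_itv _) (@measurable_laplace R _ _ _)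
  (fun y _ => g0 _ _) (fun n => divr_natS_le n ler01) (fun n => mulr_natS_le n (ler0n _ 2)) (itv0y_bigcup ltr01 (ltr0n _ 2)).
(* The intervals are the preimages, under multiplication by [t], of those in [h1], so the two
   sequences of integrals agree term by term. *)
have h2 := @cvg_integral_itv R (fun y => t `^ (p + 1) * (expR (- (y * t)) * y `^ p))
  (fun n => (1 / t) / n.+1%:R) (fun n => (2 / t) * n.+1%:R) `]0, +oo[%classic (measurable_itv _)
  (measurable_funM (measurable_cst _) (@measurable_laplace R _ _ _))
  (fun y _ => mulr_ge0 (powR_ge0 _ _) (g0 _ _)) (fun n => divr_natS_le n (ltW c1))
  (fun n => mulr_natS_le n _) (itv0y_bigcup c1 (divr_gt0 (ltr0n _ 2) t0)).
have {}h2 := h2 (divr_ge0 (ler0n _ 2) (ltW t0)).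
rewrite -(cvg_lim _ h1)// -(cvg_lim _ h2)//; congr (limn _); apply/funext => n.
set u := 1 / t / _; set v := 2 / t * _.
have -> : 1 / n.+1%:R = t * u by rewrite /u !mulrA mulr1 mulfV ?gt_eqF.
have -> : 2 * n.+1%:R = t * v by rewrite /v !mulrA [t * 2]mulrC mulfK ?gt_eqF.
have u0 : 0 < u by rewrite divr_gt0.
have uv : u <= v.
  rewrite /u /v ler_pdivrMr// -mulrA -[leLHS]mul1r mulrC -mulrA [leRHS](_ : _ = t^-1 * (2 * (n.+1%:R * n.+1%:R))).
    rewrite mul1r ler_wpM2l ?invr_ge0 ?(ltW t0)// -natrM -natrM ler1n muln_gt0//.
  by ring.
have dt (y : R) : is_derive y 1 ( *%R t) t.
  by have := @is_deriveZ R R R id t y 1 _ (is_derive_id _ _); rewrite /GRing.scale /= mulr1.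
have dE : ( *%R t)^`()%classic = cst t.
  by apply/funext => y; rewrite derive1E; have [] := dt y.
rewrite (@integration_by_substitution_increasing R ( *%R t) (fun y => expR (- (y * 1)) * y `^ p))//.
- apply: eq_integral => y; rewrite inE /= in_itv /= => /andP[uy _]; congr EFin.
  have y0 : 0 < y by exact: lt_le_trans uy.
  rewrite fctE dE /= !mulr1 powRM ?(ltW y0) ?(ltW t0)// powRD; last by rewrite (gt_eqF t0) implybT.
  by rewrite powRr1 ?(ltW t0)// (mulrC t y); ring.
- by move=> x y _ _; rewrite ltr_pM2l.
- by rewrite dE => x _; exact: cvg_cst.
- by rewrite dE; exact: is_cvg_cst.
- by rewrite dE; exact: is_cvg_cst.
- have ct (x : R) : {for x, continuous ( *%R t)}.
    by apply/differentiable_continuous/derivable1_diffP; have [] := dt x.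
  split; first by move=> x _; have [] := dt x.
    by apply: cvg_at_right_filter; exact: ct.
  by apply: cvg_at_left_filter; exact: ct.
- by apply: continuous_laplace; rewrite mulr_gt0.
Qed.

Lemma integrable_lebesgueS (R : realType) (E D : set R) (f : R -> R) :
  measurable E -> measurable D -> D `<=` E ->
  (@lebesgue_measure R).-integrable E (EFin \o f) ->
  (@lebesgue_measure R).-integrable D (EFin \o f).
Proof. exact: (@integrableS _ (measurableTypeR R) R lebesgue_measure). Qed.

Lemma Gamma_ge0 (R : realType) (s : R) : 0 <= Gamma s.
Proof. by apply: Rintegral_ge0 => x _; nonneg. Qed.

Lemma cH_ge0 (R : realType) (H : R) : 0 <= cH H.
Proof. by rewrite invr_ge0 mulr_ge0 ?Gamma_ge0. Qed.

Lemma integrable_laplace (R : realType) (p t : R) : -1 < p -> p <= 0 -> 0 < t ->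
  (@lebesgue_measure R).-integrable `]0, +oo[ (EFin \o (fun y => expR (- (y * t)) * y `^ p)).
Proof.
move=> p1 p0 t0; apply/integrableP; split.
  by apply/measurable_EFinP; exact: measurable_laplace.
have -> : (\int[lebesgue_measure]_(y in `]0%R, +oo[) `|(EFin \o (fun y => expR (- (y * t)) * y `^ p)%R) y| =
    \int[lebesgue_measure]_(y in `]0%R, +oo[) (expR (- (y * t)) * y `^ p)%:E)%E.
  by apply: eq_integral => y _ /=; rewrite ger0_norm//; nonneg.
have := integral_gamma_lty p1 p0; rewrite (laplace_powR p t0).
case: (\int[_]_(_ in _) _)%E => [r _||_]; [exact: ltry| |done].
by rewrite gt0_muley ?lte_fin ?powR_gt0.
Qed.

Lemma GammaE (R : realType) (p : R) : 0 < p + 1 ->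
  Gamma (p + 1) = \int[lebesgue_measure]_(y in `]0, +oo[) (expR (- (y * 1)) * y `^ p).
Proof. by move=> _; apply: eq_Rintegral => y _; rewrite addrK mulr1 mulrC. Qed.

(** On [[1, 2]] the integrand is at least [expR (- 2) * 2^p]. Positivity is what allows the division
    by [Gamma (3 / 2 - H)] hidden in [cH]. *)
Lemma Gamma_gt0 (R : realType) (p : R) : -1 < p -> p <= 0 -> 0 < Gamma (p + 1).
Proof.
move=> p1 p0; rewrite GammaE; last by lra.
have i := integrable_laplace p1 p0 ltr01.
set g := fun y : R => expR (- (y * 1)) * y `^ p.
have sub : `[1, 2]%classic `<=` (`]0, +oo[%classic : set R).
  by move=> y /=; rewrite !in_itv /= andbT => /andP[h _]; rewrite (lt_le_trans _ h).
have i12 : (@lebesgue_measure R).-integrable `[1, 2] (EFin \o g).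
  exact: (integrable_lebesgueS _ _ sub i).
apply: (@lt_le_trans _ _ (\int[lebesgue_measure]_(y in `[1, 2]) (cst (expR (- 2) * 2 `^ p) y))).
  rewrite Rintegral_cst// mulr_gt0 ?mulr_gt0 ?expR_gt0 ?powR_gt0//.
  rewrite /= lebesgue_measure_itv/= lte_fin; have -> : (1 : R) < 2 by lra.
  by rewrite -EFinB /=; lra.
apply: (@le_trans _ _ (\int[lebesgue_measure]_(y in `[1, 2]) g y)).
  apply: le_Rintegral => //.
    by apply: integrable_itv_continuous => y; exact: cvg_cst.
  move=> y /=; rewrite in_itv /= => /andP[y1 y2]; apply: ler_pM; rewrite ?expR_ge0 ?powR_ge0//.
    by rewrite ler_expR; lra.
  by apply: powR_ler_neg => //; exact: lt_le_trans y1.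
rewrite /Rintegral fine_le//; [exact: integrable_fin_num|exact: integrable_fin_num|].
apply: ge0_subset_integral => //.
  by apply/measurable_EFinP; exact: measurable_laplace.
by move=> y _; rewrite lee_fin /g; nonneg.
Qed.

(** By scaling, [Gamma (3 / 2 - H)] equals [t^(3 / 2 - H)] times the integral on the right, so this
    factor of [cH] cancels the integral and leaves a power of [t]. *)
Lemma frac_kernelE (R : realType) (H t : R) : 1 / 2 < H < 1 -> 0 < t ->
  frac_kernel H t = cH H * (t * \int[lebesgue_measure]_(y in `]0, +oo[) (expR (- (y * t)) * y `^ (1 / 2 - H))).
Proof.
move=> /andP[H1 H2] t0; set J := Rintegral _ _ _; set p := 1 / 2 - H in J *.
have p1 : -1 < p by rewrite /p; lra.
have p0 : p <= 0 by rewrite /p; lra.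
have E : Gamma (3 / 2 - H) = t `^ (p + 1) * J.
  rewrite (_ : 3 / 2 - H = p + 1); last by rewrite /p; lra.
  rewrite GammaE; last by lra.
  rewrite /Rintegral (laplace_powR p t0) fineM//.
  exact: (integrable_fin_num _ (integrable_laplace p1 p0 t0)).
have G0 : 0 < t `^ (p + 1) * J.
  by rewrite -E (_ : 3 / 2 - H = p + 1); [exact: Gamma_gt0|rewrite /p; lra].
have J0 : J != 0 by apply: contraTneq G0 => ->; rewrite mulr0 ltxx.
rewrite /frac_kernel /cH E invfM invfM.
have -> : t `^ (H - 1 / 2) = t / t `^ (p + 1).
  rewrite -{2}(powRr1 (ltW t0)) -powRB; last by rewrite (gt_eqF t0) implybT.
  by congr (_ `^ _); rewrite /p; lra.
have T0 : t `^ (p + 1) != 0 by rewrite gt_eqF// powR_gt0.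
(* [Gamma (H + 1 / 2)] is outside the range of [Gamma_gt0]. Were it 0, both sides would be 0,
   because the inverse of 0 is 0. *)
have [->|g0] := eqVneq (Gamma (H + 1 / 2)) 0; first by rewrite invr0 !(mul0r, mulr0).
by field; rewrite J0 T0 g0.
Qed.

(** The quadratic [c^2 M - 2 c I + S] is nonnegative for all [c]. Its minimum is at [c = I / M]; for
    [M = 0] it is affine, which forces [I = 0]. *)
Lemma discriminant_le (R : realType) (I M S : R) : 0 <= M -> 0 <= S ->
  (forall c, 2 * c * I <= c ^+ 2 * M + S) -> I ^+ 2 <= M * S.
Proof.
move=> M0 S0 h; have [M1|M1] := eqVneq M 0; last first.
  have {}M0 : 0 < M by rewrite lt_def M1.
  have := h (I / M); rewrite -(ler_pM2r M0).
  have -> : 2 * (I / M) * I * M = 2 * I ^+ 2 by field.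
  have -> : ((I / M) ^+ 2 * M + S) * M = I ^+ 2 + M * S by field.
  lra.
rewrite M1 mul0r; have [->|I0] := eqVneq I 0; first by rewrite expr0n.
(* This [c] would give [S + 1 <= S]. *)
have := h ((S + 1) / (2 * I)); rewrite M1 mulr0 add0r.
have -> : 2 * ((S + 1) / (2 * I)) * I = S + 1 by field.
lra.
Qed.

(** * Truncation at infinity *)

Section cauchy_schwarz.
Context d (T : measurableType d) (R : realType) (mu : {measure set T -> \bar R}).
Variables (D : set T) (f h : T -> R) (M S : R).
Hypotheses (mD : measurable D) (mf : measurable_fun D f) (mh : measurable_fun D h).
Hypothesis fM : (\int[mu]_(x in D) (f x ^+ 2)%:E <= M%:E)%E.
Hypothesis hS : (\int[mu]_(x in D) (h x ^+ 2)%:E <= S%:E)%E.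

Let sqr_integrable (g : T -> R) (K : R) : measurable_fun D g ->
  (\int[mu]_(x in D) (g x ^+ 2)%:E <= K%:E)%E ->
  mu.-integrable D (EFin \o (fun x => g x ^+ 2)).
Proof.
move=> mg gK; apply/integrableP; split.
  by apply/measurable_EFinP; exact: measurable_funX.
rewrite (@eq_integral _ _ _ _ _ (fun y : T => (g y ^+ 2)%:E)); last first.
  by move=> y _ /=; rewrite ger0_norm// sqr_ge0.
exact: le_lt_trans gK (ltry _).
Qed.

Lemma integrable_mul_sqr : mu.-integrable D (EFin \o (fun x => f x * h x)).
Proof.
have := integrableD mD (sqr_integrable mf fM) (sqr_integrable mh hS).
apply: le_integrable => //; first by apply/measurable_EFinP; exact: measurable_funM.
move=> x _ /=; rewrite lee_fin normrM [leRHS]ger0_norm ?addr_ge0 ?sqr_ge0//.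
rewrite -(real_normK (num_real (f x))) -(real_normK (num_real (h x))).
have := sqr_ge0 (`|f x| - `|h x|); have := normr_ge0 (f x); have := normr_ge0 (h x); nra.
Qed.

(** Integrate [(c f - h)^2 >= 0] for every real [c] and apply [discriminant_le]. Upper bounds [M]
    and [S] in place of the two square integrals spare their exact evaluation in the
    applications. *)
Lemma sqr_Rintegral_mul_le : (\int[mu]_(x in D) (f x * h x)) ^+ 2 <= M * S.
Proof.
have if2 := sqr_integrable mf fM; have ih2 := sqr_integrable mh hS.
have M0 : 0 <= M.
  by rewrite -lee_fin; apply: le_trans fM; apply: integral_ge0 => x _; rewrite lee_fin sqr_ge0.
have S0 : 0 <= S.
  by rewrite -lee_fin; apply: le_trans hS; apply: integral_ge0 => x _; rewrite lee_fin sqr_ge0.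
have M1 : \int[mu]_(x in D) (f x ^+ 2) <= M.
  by rewrite -[M]/(fine M%:E) /Rintegral fine_le//; exact: integrable_fin_num.
have S1 : \int[mu]_(x in D) (h x ^+ 2) <= S.
  by rewrite -[S]/(fine S%:E) /Rintegral fine_le//; exact: integrable_fin_num.
apply: discriminant_le => // c.
apply: (@le_trans _ _ (c ^+ 2 * \int[mu]_(x in D) (f x ^+ 2) + \int[mu]_(x in D) (h x ^+ 2))); last first.
  by apply: lerD => //; rewrite ler_wpM2l ?sqr_ge0.
have iz (k : R) (g : T -> R) : mu.-integrable D (EFin \o g) ->
    mu.-integrable D (EFin \o (fun x => k * g x)).
  move=> ig; have -> : EFin \o (fun x => k * g x) = (fun x => k%:E * (EFin \o g) x)%E by [].
  exact: integrableZl.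
rewrite -!RintegralZl//; last exact: integrable_mul_sqr.
rewrite -RintegralD//; last exact: iz.
apply: le_Rintegral => //.
- exact/iz/integrable_mul_sqr.
- exact: (integrableD mD (iz _ _ if2) ih2).
- by move=> x _; have := sqr_ge0 (c * f x - h x); nra.
Qed.

End cauchy_schwarz.

Lemma integral_sqr_expR_le (R : realType) (T s : R) : 0 < T -> 0 < s ->
  (\int[lebesgue_measure]_(t in `[0%R, T]) (t ^+ 2 * expR (- (t * s)))%:E <= (2 / s ^+ 3)%:E)%E.
Proof.
move=> T0 s0.
pose P : {poly R} := - ((s^-1) *: 'X^2 + (2 / s ^+ 2) *: 'X + (2 / s ^+ 3)%:P).
pose F (t : R) := P.[t] * expR (- (t * s)).
have s1 : s != 0 by rewrite gt_eqF.
have PE t : P.[t] = - (t ^+ 2 / s + 2 * t / s ^+ 2 + 2 / s ^+ 3).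
  by rewrite /P hornerN !hornerD !hornerZ hornerXn hornerX hornerC; field.
rewrite (@integral_itv_is_derive R (fun t => t ^+ 2 * expR (- (t * s))) F)//.
- rewrite lee_fin /F !PE mul0r oppr0 expR0 expr0n /= !(mulr0, mul0r) !add0r mulr1 opprK gerDr.
  rewrite mulNr oppr_le0; by move: (ltW T0) (ltW s0) => ? ?; nonneg.
- apply: continuous_subspaceT => t; apply: cvgM; last exact: continuous_expRM.
  by apply: cvgM; exact: cvg_id.
- move=> t _.
  have de : is_derive t 1 (fun t : R => expR (- (t * s))) (- s * expR (- (t * s))).
    have h : is_derive t 1 (fun t : R => - (t * s)) (- s).
      have := @is_deriveZ R R R id (- s) t 1 _ (is_derive_id _ _).
      rewrite /GRing.scale /= mulr1; congr (is_derive _ _ _ _).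
      by apply/funext => z /=; rewrite /GRing.scale /=; ring.
    have := @is_derive1_comp R (@expR R) (fun t => - (t * s)) t _ _ (is_derive_expR _) h.
    by rewrite mulrC.
  have := @is_deriveM R R (horner P) (fun t => expR (- (t * s))) t 1 _ _ (is_derive_poly P t) de.
  move/is_derive_eq; apply; rewrite /GRing.scale /= PE.
  have -> : P^`().[t] = - (2 * t / s + 2 / s ^+ 2).
    by rewrite /P derivN !derivD !derivZ derivXn derivX derivC hornerN !hornerD !hornerZ hornerMn hornerXn !hornerE; field.
  by field.
Qed.

(* Cauchy-Schwarz for the factorization
   [y `^ (1 / 2 - H) = y `^ (- (1 + H) / 2) * y `^ (1 - H / 2)]. *)
Lemma tail_sqr_le (R : realType) (H xi0 t : R) : 1 / 2 < H < 1 -> 0 < xi0 -> 0 <= t ->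
  (((t * \int[lebesgue_measure]_(y in `[xi0, +oo[) (expR (- (y * t)) * y `^ (1 / 2 - H))) ^+ 2)%:E <=
   (xi0 `^ (- H) / H)%:E * \int[lebesgue_measure]_(y in `[xi0, +oo[) (t ^+ 2 * expR (- (y * (2 * t))) * y `^ (2 - H))%:E)%E.
Proof.
move=> /andP[H1 H2] x0 t0; set J := (\int[_]_(_ in _) _)%E.
have J0 : (0 <= J)%E by apply: integral_ge0 => y _; rewrite lee_fin; nonneg.
have M0 : 0 < xi0 `^ (- H) / H by rewrite divr_gt0 ?powR_gt0//; lra.
have [->|tn0] := eqVneq t 0.
  by rewrite mul0r expr0n mule_ge0// lee_fin ltW.
have tp : 0 < t by rewrite lt_def tn0.
have mh : measurable_fun `[xi0, +oo[ (fun y : R => t * expR (- (y * t)) * y `^ (1 - H / 2)).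
  apply: measurable_funM; last by apply: measurable_funTS; exact: measurable_powR.
  by apply: measurable_funM; [exact: measurable_cst|exact: measurable_expRM].
have mf : measurable_fun `[xi0, +oo[ (fun y : R => y `^ (- (1 + H) / 2)).
  by apply: measurable_funTS; exact: measurable_powR.
have f2 : (\int[lebesgue_measure]_(y in `[xi0, +oo[) ((y `^ (- (1 + H) / 2)) ^+ 2)%:E <= (xi0 `^ (- H) / H)%:E)%E.
  have := @integral_powR_cy_le R (-1 - H) xi0; rewrite (_ : -1 - H + 1 = - H); last by ring.
  rewrite opprK => h; apply: le_trans (h _ x0); last by lra.
  rewrite le_eqVlt; apply/orP; left; apply/eqP; apply: eq_integral => ? _; congr EFin.
  by rewrite -powR_mulrn ?powR_ge0// -powRrM; congr (_ `^ _); field.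
have h2 : J = (\int[lebesgue_measure]_(y in `[xi0, +oo[) ((t * expR (- (y * t)) * y `^ (1 - H / 2)) ^+ 2)%:E)%E.
  apply: eq_integral => ? _; congr EFin.
  rewrite 2!exprMn -(powR_mulrn 2 (powR_ge0 _ _)) -powRrM -expRM_natl.
  by congr (_ * expR _ * _ `^ _); field.
(* An infinite right-hand side settles the claim, so finiteness of [J] can be assumed instead of
   proved. *)
have [Joo|Jfin] := eqVneq J +oo%E.
  by rewrite Joo gt0_muley ?lte_fin// leey.
have Jf : J \is a fin_num by rewrite ge0_fin_numE// lt_neqAle Jfin leey.
rewrite -(fineK Jf) -EFinM lee_fin.
have sub : `[xi0, +oo[%classic `<=` (`]0, +oo[%classic : set R).
  by move=> y /=; rewrite !in_itv /= !andbT => h; exact: lt_le_trans h.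
have := @sqr_Rintegral_mul_le _ _ R lebesgue_measure `[xi0, +oo[%classic _ _ (xi0 `^ (- H) / H) (fine J) (measurable_itv _) mf mh f2.
rewrite fineK// -h2 lexx => /(_ isT); congr (_ ^+ 2 <= _).
rewrite -RintegralZl//; last first.
  apply: (integrable_lebesgueS _ _ sub) => //; apply: integrable_laplace => //; lra.
apply: eq_Rintegral => y; rewrite inE /= in_itv /= andbT => hy.
have y0 : 0 < y by exact: lt_le_trans hy.
have -> : 1 / 2 - H = - (1 + H) / 2 + (1 - H / 2) by field.
rewrite [X in _ = _ * (_ * X)]powRD ?(gt_eqF y0) ?implybT//.
by move: (y `^ _) (y `^ _) (expR _) => ? ? ?; ring.
Qed.

(** After Tonelli the inner integral over [t] is at most [2 / (2 y)^3], which turns [y^(2 - H)] into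
    [y^(-1 - H) / 4]. This is the exponent of the other Cauchy-Schwarz factor in [tail_sqr_le]: the
    splitting there is balanced, and each factor contributes one [xi0^(- H)]. The measurability is
    needed to integrate the pointwise bound over [t]. *)
Lemma integral_tail_le (R : realType) (H xi0 T : R) : 1 / 2 < H < 1 -> 0 < xi0 -> 0 < T ->
  let h t := (\int[lebesgue_measure]_(y in `[xi0, +oo[) (t ^+ 2 * expR (- (y * (2 * t))) * y `^ (2 - H))%:E)%E in
  measurable_fun `[0, T] h /\
  (\int[lebesgue_measure]_(t in `[0%R, T]) h t <= (xi0 `^ (- H) / (4 * H))%:E)%E.
Proof.
move=> /andP[H1 H2] x0 T0 h.
pose mR := measurableTypeR R.
(* Both domains are encoded by indicators, so that Tonelli applies on the whole plane. *)
pose k (z : mR * mR) : R := \1_(`[0, T]%classic : set R) z.1 * \1_(`[xi0, +oo[%classic : set R) z.2 *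
  (z.1 ^+ 2 * expR (- (z.2 * (2 * z.1))) * z.2 `^ (2 - H)).
have k0 z : 0 <= k z by rewrite /k; nonneg.
have mk : measurable_fun setT (EFin \o k).
  apply/measurable_EFinP; apply: measurable_funM; first apply: measurable_funM.
  - apply: measurableT_comp => //; exact: measurable_indic.
  - apply: measurableT_comp => //; exact: measurable_indic.
  - apply: measurable_funM.
      apply: measurable_funM; first exact: measurable_funX.
      apply: measurableT_comp => //; apply: measurableT_comp => //.
      by apply: measurable_funM => //; apply: measurable_funM.
    by apply: (@measurableT_comp _ _ _ _ _ _ (fun y : R => y `^ (2 - H))) => //; exact: measurable_powR.
have hE t : `[0, T]%classic t ->
    h t = (\int[@lebesgue_measure R]_(y in [set: mR]) (k (t, y))%:E)%E.
  move=> tT; rewrite /h integral_mkcond; apply: eq_integral => y _.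
  rewrite patchE /k /= !indicE (mem_set tT) mul1r; case: ifPn => hy; first by rewrite mul1r.
  by rewrite mul0r.
have k0e (z : mR * mR) : (0 <= (EFin \o k) z)%E by rewrite lee_fin.
have mF := @measurable_fun_fubini_tonelli_F _ _ mR mR R (@lebesgue_measure R) (EFin \o k) mk k0e.
split.
  apply: (@eq_measurable_fun _ _ mR _ _ (fun t => \int[@lebesgue_measure R]_(y in [set: mR]) (k (t, y))%:E)%E).
    by move=> t; rewrite inE => tT; rewrite -hE.
  exact: measurable_funTS mF.
have -> : (\int[lebesgue_measure]_(t in `[0%R, T]) h t =
    \int[@lebesgue_measure R]_(t in [set: mR]) \int[@lebesgue_measure R]_(y in [set: mR]) (k (t, y))%:E)%E.
  rewrite integral_mkcond; apply: eq_integral => t _; rewrite patchE; case: ifPn.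
    by rewrite inE => tT; rewrite hE.
  move=> tT; rewrite integral0_eq// => y _.
  by rewrite /k /= indicE (negbTE tT) !mul0r.
rewrite (@fubini_tonelli _ _ mR mR R (@lebesgue_measure R) (@lebesgue_measure R) (EFin \o k) mk k0e).
apply: (@le_trans _ _ (\int[lebesgue_measure]_(y in `[xi0, +oo[) (1 / 4 * y `^ (-1 - H))%:E)%E).
  rewrite [leRHS]integral_mkcond; apply: (@ge0_le_integral _ mR R lebesgue_measure setT).
  - exact: measurableT.
  - by move=> y _; apply: integral_ge0 => t _; exact: k0e.
  - exact: (@measurable_fun_fubini_tonelli_G _ _ mR mR R (@lebesgue_measure R) (EFin \o k) mk k0e).
  - apply/(measurable_restrictT _ _).1 => //; apply/measurable_EFinP; apply: measurable_funM => //.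
    by apply: measurable_funTS; exact: measurable_powR.
  - move=> y _; rewrite patchE; case: ifPn; last first.
      move=> hy; rewrite integral0_eq// => t _; rewrite /k /= [X in _ * X * _]indicE (negbTE hy).
      by rewrite mulr0 mul0r.
    rewrite inE /= in_itv /= andbT => hy; have y0 : 0 < y by exact: lt_le_trans hy.
    rewrite [leLHS](_ : _ = (y `^ (2 - H))%:E * \int[lebesgue_measure]_(t in `[0%R, T]) (t ^+ 2 * expR (- (t * (2 * y))))%:E)%E; last first.
      rewrite -ge0_integralZl_EFin ?powR_ge0//; last 2 first.
        by move=> t _; rewrite lee_fin; nonneg.
        apply/measurable_EFinP; apply: measurable_funM; last exact: measurable_expRM.
        by apply: measurable_funTS; exact: measurable_funX.
      rewrite [RHS]integral_mkcond; apply: eq_integral => t _; rewrite patchE /k /= !indicE.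
      have hyin : y \in (`[xi0, +oo[%classic : set R) by rewrite inE /= in_itv /= hy.
      rewrite hyin mulr1; case: ifPn => ht; last by rewrite mul0r.
      by rewrite mul1r -EFinM mulrC; congr ((_ * (_ * expR _))%:E); ring.
    apply: (@le_trans _ _ ((y `^ (2 - H))%:E * (2 / (2 * y) ^+ 3)%:E)%E).
      by apply: lee_wpmul2l; [rewrite lee_fin powR_ge0|apply: integral_sqr_expR_le => //; lra].
    rewrite -EFinM lee_fin le_eqVlt; apply/orP; left; apply/eqP.
    have -> : 2 - H = -1 - H + 3%:R by ring.
    rewrite powRD ?(gt_eqF y0) ?implybT// powR_mulrn ?(ltW y0)//.
    by field; rewrite gt_eqF.
under eq_integral do rewrite EFinM.
rewrite ge0_integralZl_EFin//; last 2 first.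
  by move=> y _; rewrite lee_fin powR_ge0.
  by apply/measurable_EFinP; apply: measurable_funTS; exact: measurable_powR.
have := @integral_powR_cy_le R (-1 - H) xi0; rewrite (_ : -1 - H + 1 = - H); last by ring.
rewrite opprK => h1; apply: le_trans (lee_wpmul2l _ (h1 _ x0)) _; [by rewrite lee_fin; lra|lra|].
rewrite -EFinM lee_fin le_eqVlt; apply/orP; left; apply/eqP; field; rewrite gt_eqF//; lra.
Qed.

(** * Error of the approximate kernel *)

Lemma xi_first_gt0 (R : realType) (H : R) N alpha a : 0 < a -> 0 < xi_first H N alpha a.
Proof. by move=> a0; rewrite mulr_gt0 ?expR_gt0. Qed.

Lemma xi_last_gt0 (R : realType) (H : R) N alpha b : 0 < b -> 0 < xi_last H N alpha b.
Proof. by move=> b0; rewrite mulr_gt0 ?expR_gt0. Qed.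

Section geometric_grid.
Context (R : realType) (H alpha a b : R) (N n : nat).
Hypotheses (ha : 0 < a) (hb : 0 < b) (hn : (0 < n)%N).
Hypothesis hxi : xi_first H N alpha a < xi_last H N alpha b.
Let x0 := xi_first H N alpha a.
Let xn := xi_last H N alpha b.
Let x0_gt0 : 0 < x0. Proof. exact: xi_first_gt0. Qed.
Let xn_gt0 : 0 < xn. Proof. exact: xi_last_gt0. Qed.
Let n_neq0 : n%:R != 0 :> R. Proof. by rewrite pnatr_eq0 -lt0n. Qed.

Lemma xi0E : xi H N alpha a b n 0 = x0.
Proof. by rewrite /xi mul0r powRr0 mulr1. Qed.

Lemma xinE : xi H N alpha a b n n = xn.
Proof. by rewrite /xi mulfV// powRr1 ?divr_ge0 ?ltW// mulrC divfK// gt_eqF. Qed.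

Lemma xi_gt0 j : 0 < xi H N alpha a b n j.
Proof. by rewrite /xi mulr_gt0 ?powR_gt0 ?divr_gt0. Qed.

Lemma r_plus_gt1 : 1 < r_plus H N alpha a b n.
Proof.
have h : 1 < xn / x0 by rewrite ltr_pdivlMr ?mul1r.
have p0 : 0 < 1 / n%:R :> R by rewrite divr_gt0// ltr0n.
have := @gt0_ltr_powR R _ p0 1 (xn / x0); rewrite powR1; apply => //; rewrite nnegrE//.
exact: ltW (lt_trans ltr01 h).
Qed.

Lemma xiS j : xi H N alpha a b n j.+1 = xi H N alpha a b n j * r_plus H N alpha a b n.
Proof.
rewrite /xi /r_plus -mulrA; congr (_ * _); rewrite -powRD; last first.
  by apply/implyP => _; rewrite gt_eqF// divr_gt0.
by congr (_ `^ _); rewrite -natr1 mulrDl.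
Qed.

Lemma xi_lt j : xi H N alpha a b n j < xi H N alpha a b n j.+1.
Proof. by rewrite xiS ltr_pMr ?xi_gt0// r_plus_gt1. Qed.

Lemma xi_le i j : (i <= j)%N -> xi H N alpha a b n i <= xi H N alpha a b n j.
Proof.
move=> ij; rewrite -(subnKC ij); elim: (j - i)%N => [|k IH]; first by rewrite addn0.
by rewrite addnS; apply: le_trans IH (ltW (xi_lt _)).
Qed.

End geometric_grid.

Lemma sum_blocks (R : realType) (m n : nat) (F : nat -> R) :
  \sum_(1 <= i < (m * n).+1) F i = \sum_(j < n) \sum_(k < m) F (j * m + k).+1.
Proof.
rewrite big_add1 /=; elim: n => [|n IH]; first by rewrite muln0 big_nil big_ord0.
rewrite big_ord_recr /= -IH (big_cat_nat (n := (m * n)%N)) ?leq_mul//=; congr (_ + _).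
rewrite -{1}[(m * n)%N]add0n big_addn mulnS addnK big_mkord; apply: eq_bigr => k _.
by rewrite addnC (mulnC n m).
Qed.

Lemma expRN_quad_le (R : realType) (x : R) : 0 <= x ->
  `|expR (- x) - (1 - x)| <= x ^+ 2 / 2.
Proof.
move=> x0; have := @expR_taylor R 2 (-1) 0 x; rewrite normrN normr1 lexx => /(_ isT (lexx _) (lerN10 _) x0).
rewrite !mulN1r mul0r expR0 mul1r !big_ord_recl big_ord0 /= expr0 expr1 fact0 /bump /= !add1n.
by rewrite (_ : 2`! = 2)%N // (_ : 1`! = 1)%N // !divr1 addr0.
Qed.

(** With [A >= E >= C] the three exponentials, [1 + x <= expR x] gives [E d2 t <= A - E <= A d2 t]
    and [C d1 t <= E - C <= E d1 t]. Hence [t E (d1 + d2) - (A - C)] lies between [- (d2 t)^2] and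
    [(d1 t)^2]; the bounds [A <= 1], which is where [d2 <= g] enters, and [E <= 1] are used here.
    Both squares are at most [max d1 d2 * (d1 + d2) * t^2]. *)
Lemma mollified_expR_le (R : realType) (g d1 d2 t : R) : 0 < d1 -> 0 < d2 -> d2 <= g -> 0 <= t ->
  `|t * expR (- (g * t)) - (expR (- ((g - d2) * t)) - expR (- ((g + d1) * t))) / (d1 + d2)|
    <= Num.max d1 d2 * t ^+ 2.
Proof.
move=> d10 d20 dg t0.
set A := expR (- ((g - d2) * t)); set E := expR (- (g * t)); set C := expR (- ((g + d1) * t)).
have A1 : A <= 1 by rewrite /A -[leRHS]expR0 ler_expR oppr_le0 mulr_ge0// subr_ge0.
have E0 : 0 < E by exact: expR_gt0.
have C0 : 0 < C by exact: expR_gt0.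
have A0 : 0 < A by exact: expR_gt0.
have hEA1 : E * (d2 * t) <= A - E.
  have -> : A = E * expR (d2 * t) by rewrite /A /E -expRD; congr expR; ring.
  by have := expR_ge1Dx (d2 * t); nra.
have hEA2 : A - E <= A * (d2 * t).
  have -> : E = A * expR (- (d2 * t)) by rewrite /A /E -expRD; congr expR; ring.
  by have := expR_ge1Dx (- (d2 * t)); nra.
have hCE1 : C * (d1 * t) <= E - C.
  have -> : E = C * expR (d1 * t) by rewrite /C /E -expRD; congr expR; ring.
  by have := expR_ge1Dx (d1 * t); nra.
have hCE2 : E - C <= E * (d1 * t).
  have -> : C = E * expR (- (d1 * t)) by rewrite /C /E -expRD; congr expR; ring.
  by have := expR_ge1Dx (- (d1 * t)); nra.
have s0 : 0 < d1 + d2 by lra.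
have d1t : 0 <= d1 * t by nra.
have d2t : 0 <= d2 * t by nra.
have E1 : E <= 1 by have := mulr_ge0 (ltW E0) d2t; lra.
set M := Num.max d1 d2.
have M1 : d1 <= M by rewrite /M le_max lexx.
have M2 : d2 <= M by rewrite /M le_max lexx orbT.
have -> : t * E - (A - C) / (d1 + d2) = (t * E * (d1 + d2) - (A - C)) / (d1 + d2).
  by field; rewrite gt_eqF.
rewrite normrM [`|_^-1|]gtr0_norm ?invr_gt0// ler_pdivrMr// ler_norml.
have t2 : 0 <= t ^+ 2 by exact: sqr_ge0.
apply/andP; split.
- have h : A - C - t * E * (d1 + d2) <= (d2 * t) * (d2 * t).
    have : d2 * t * (A - E) <= d2 * t * (d2 * t) by apply: ler_wpM2l => //; nra.
    nra.
  have : d2 * d2 * t ^+ 2 <= M * (d1 + d2) * t ^+ 2.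
    by apply: ler_wpM2r => //; apply: ler_pM; lra.
  nra.
- have h : t * E * (d1 + d2) - (A - C) <= (d1 * t) * (d1 * t).
    have : d1 * t * (E - C) <= d1 * t * (d1 * t) by apply: ler_wpM2l => //; nra.
    nra.
  have : d1 * d1 * t ^+ 2 <= M * (d1 + d2) * t ^+ 2.
    by apply: ler_wpM2r => //; apply: ler_pM; lra.
  nra.
Qed.

(** The zero node loses [d1 t^2 / 2] by the second-order expansion of the exponential, every other
    node [max d1 d2 * t^2]; these are the two summands of [D_err]. *)
Lemma mollified_kernel_le (R : realType) (m n : nat) (gamma omega : nat -> R) (d1 d2 t : R) :
  0 < d1 -> 0 < d2 -> 0 <= t -> 0 <= omega 0%N ->
  (forall i, (1 <= i < (m * n).+1)%N -> 0 <= omega i) ->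
  (forall i, (1 <= i < (m * n).+1)%N -> d2 <= gamma i) ->
  `|omega 0%N * t + \sum_(1 <= i < (m * n).+1) omega i * (t * expR (- (gamma i * t))) -
    approx_kernel m n gamma omega d1 d2 t| <= D_err m n omega d1 d2 * t ^+ 2.
Proof.
move=> d10 d20 t0 w0 wi gi; rewrite /approx_kernel /D_err [leRHS]mulrDl.
rewrite opprD addrACA -mulrBr -sumrB; apply: le_trans (ler_normD _ _) _; apply: lerD.
  rewrite normrM ger0_norm// -!mulrA ler_wpM2l//.
  have x0 : 0 <= d1 * t by rewrite mulr_ge0// ltW.
  have -> : t - (1 - expR (- (d1 * t))) / d1 = (expR (- (d1 * t)) - (1 - d1 * t)) / d1.
    by field; rewrite gt_eqF.
  rewrite normrM [`|_^-1|]gtr0_norm ?invr_gt0// ler_pdivrMr//.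
  apply: le_trans (expRN_quad_le x0) _; rewrite le_eqVlt; apply/orP; left; apply/eqP; by field.
rewrite /W_plus -mulrA mulr_suml; apply: le_trans (ler_norm_sum _ _ _) _.
rewrite !big_nat; apply: ler_sum => i hi.
by rewrite -mulrBr normrM ger0_norm ?wi// ler_wpM2l ?wi// mollified_expR_le// gi.
Qed.

(** The errors of the intervals are added without using any cancellation; this is the source of
    [n^2] in [Q_plus]. *)
Lemma sqr_sum_le (R : realType) (n : nat) (F : 'I_n -> R) (K : R) :
  (forall i, F i ^+ 2 <= K) -> (\sum_i F i) ^+ 2 <= n%:R ^+ 2 * K.
Proof.
case: n F => [|n] F h; first by rewrite big_ord0 expr0n mul0r.
have K0 : 0 <= K by exact: le_trans (sqr_ge0 _) (h ord0).
rewrite -(sqr_sqrtr K0) -exprMn -[leLHS]real_normK ?num_real//.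
apply: lerXn2r; rewrite ?nnegrE ?mulr_ge0 ?sqrtr_ge0//.
apply: le_trans (ler_norm_sum _ _ _) _.
apply: (@le_trans _ _ (\sum_(i < n.+1) Num.sqrt K)); last first.
  by rewrite sumr_const card_ord mulr_natl.
by apply: ler_sum => i _; rewrite -sqrtr_sqr ler_sqrt.
Qed.

Lemma Rintegral_itv_split (R : realType) (f : R -> R) (u v : R) (b : itv_bound R) :
  (BRight u <= BRight v)%O -> (BRight v <= b)%O ->
  (@lebesgue_measure R).-integrable [set` Interval (BRight u) b] (EFin \o f) ->
  \int[lebesgue_measure]_(x in [set` Interval (BRight u) b]) f x =
  \int[lebesgue_measure]_(x in `]u, v]) f x + \int[lebesgue_measure]_(x in [set` Interval (BRight v) b]) f x.
Proof. by move=> uv vb fi; rewrite -(Rintegral_itvB fi uv vb) addrC subrK. Qed.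

Lemma Rintegral_grid (R : realType) (f : R -> R) (x : nat -> R) (n : nat) :
  0 < x 0%N -> (forall j, x j <= x j.+1) ->
  (@lebesgue_measure R).-integrable `]0, +oo[ (EFin \o f) ->
  \int[lebesgue_measure]_(y in `]x 0%N, x n]) f y = \sum_(j < n) \int[lebesgue_measure]_(y in `[x j, x j.+1]) f y.
Proof.
move=> x0 xS fi.
have xj j : x 0%N <= x j by elim: j => // j IH; apply: le_trans IH (xS j).
have xp j : 0 < x j by exact: lt_le_trans (xj j).
have sub u v : 0 < u -> `]u, v]%classic `<=` (`]0, +oo[%classic : set R).
  by move=> u0 y /=; rewrite !in_itv /= andbT => /andP[h _]; exact: lt_trans h.
elim: n => [|n IH]; first by rewrite big_ord0 set_itvoc0 Rintegral_set0.
rewrite big_ord_recr /= -IH [LHS](@Rintegral_itv_split R f _ (x n)) ?bnd_simp//; last first.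
  exact: (integrable_lebesgueS _ _ (sub _ _ x0) fi).
congr (_ + _); rewrite Rintegral_itv_obnd_cbnd//.
exact: (integrable_lebesgueS _ _ (sub _ _ (xp n)) fi).
Qed.

Lemma measurable_frac_kernel (R : realType) (H : R) : measurable_fun setT (frac_kernel H).
Proof. by apply: measurable_funM => //; exact: measurable_powR. Qed.

Lemma measurable_approx_kernel (R : realType) (m n : nat) (gamma omega : nat -> R) (d1 d2 : R) :
  measurable_fun setT (approx_kernel m n gamma omega d1 d2).
Proof.
have me (k : R) : measurable_fun setT (fun t : R => expR (- (k * t))).
  by apply: measurableT_comp => //; apply: measurableT_comp => //; exact: measurable_funM.
apply: measurable_funD.
  by apply: measurable_funM => //; apply: measurable_funM => //; exact: measurable_funB.
apply: measurable_sum => i; apply: measurable_funM => //; apply: measurable_funM => //.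
exact: measurable_funB.
Qed.

Lemma Rintegral_split3 (R : realType) (f : R -> R) (u v : R) : 0 < u -> u < v ->
  (@lebesgue_measure R).-integrable `]0, +oo[ (EFin \o f) ->
  \int[lebesgue_measure]_(y in `]0, +oo[) f y = \int[lebesgue_measure]_(y in `]0, u]) f y +
    \int[lebesgue_measure]_(y in `]u, v]) f y + \int[lebesgue_measure]_(y in `[v, +oo[) f y.
Proof.
move=> u0 uv fi.
have sub s : 0 < s -> `]s, +oo[%classic `<=` (`]0, +oo[%classic : set R).
  by move=> s0 y /=; rewrite !in_itv /= !andbT; exact: lt_trans.
rewrite (@Rintegral_itv_split R f 0 u (BInfty R false))//; last by rewrite bnd_simp ltW.
rewrite (@Rintegral_itv_split R f u v (BInfty R false))//; last 2 first.
- by rewrite bnd_simp ltW.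
- exact: (integrable_lebesgueS _ _ (sub _ u0) fi).
rewrite [X in _ + (_ + X)](@Rintegral_itv_obnd_cbnd R v (BInfty R false) f); first by rewrite addrA.
exact: (integrable_lebesgueS _ _ (sub _ (lt_trans u0 uv)) fi).
Qed.

(** The four terms are grouped as three plus one: [2 (x + y)^2]-type weights separate the
    mollification error, and a further factor 3 separates low part, middle part and tail. So the
    first three get 6, which is 2 times the 3 inside [Q_plus], and the last gets 2. The tail [w] has
    no discrete counterpart. *)
Lemma sqr_diff_le4 (R : realType) (u v w u' v' z : R) :
  (u + v + w - z) ^+ 2 <=
  6 * (u - u') ^+ 2 + 6 * (v - v') ^+ 2 + 6 * w ^+ 2 + 2 * (u' + v' - z) ^+ 2.
Proof.
have -> : u + v + w - z = (u - u') + (v - v') + w + (u' + v' - z) by ring.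
move: (u - u') (v - v') (u' + v' - z) => a1 a3 a4.
have := sqr_ge0 (a1 + a3 + w - a4); have := sqr_ge0 (a1 - a3); have := sqr_ge0 (a1 - w).
by have := sqr_ge0 (a3 - w); lra.
Qed.

Section quadrature_error.
Context (R : realType) (T H alpha a b : R) (N m n : nat) (gamma omega : nat -> R) (d1 d2 : R).
Hypotheses (hT : 0 < T) (hH : 1 / 2 < H < 1) (ha : 0 < a) (hb : 0 < b).
Hypotheses (hm : (0 < m)%N) (hn : (0 < n)%N).
Hypothesis hxi : xi_first H N alpha a < xi_last H N alpha b.
Hypothesis hquad : quadrature H N alpha a b m n gamma omega.
Hypotheses (hd1 : 0 < d1) (hd2 : 0 < d2) (hd2xi : d2 <= xi_first H N alpha a).

Let x0 := xi_first H N alpha a.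
Let xn := xi_last H N alpha b.
Let x := xi H N alpha a b n.
Let c := cH H.
Let p := 1 / 2 - H.
Let r := r_plus H N alpha a b n.
Let g (t y : R) := expR (- (y * t)) * y `^ p.
Let K := 144 / 5 * c ^+ 2 * m%:R `^ (2 - 2 * H) * ((r - 1) / 2) ^+ (4 * m + 2).

Let H1 : 1 / 2 < H. Proof. by case/andP: hH. Qed.
Let H2 : H < 1. Proof. by case/andP: hH. Qed.
Let p_gtN1 : -1 < p. Proof. rewrite /p; move: H1 H2; lra. Qed.
Let p_le0 : p <= 0. Proof. rewrite /p; move: H1 H2; lra. Qed.
Let x0_gt0 : 0 < x0. Proof. exact: xi_first_gt0. Qed.
Let xn_gt0 : 0 < xn. Proof. exact: xi_last_gt0. Qed.
Let c_ge0 : 0 <= c. Proof. exact: cH_ge0. Qed.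

Lemma quadrature_node i : (1 <= i < (m * n).+1)%N -> 0 < omega i /\ x0 <= gamma i.
Proof.
move=> /andP[i1 i2]; have [_ _ hj] := hquad.
have mn : (i.-1 %/ m < n)%N by rewrite ltn_divLR// mulnC; case: i i1 i2.
have km : (i.-1 %% m < m)%N by rewrite ltn_mod.
(* This inverts the labelling: [i - 1 = j m + k], with [j] the interval and [k] the node in it. *)
have E : i = (i.-1 %/ m * m + Ordinal km).+1 by rewrite /= -divn_eq prednK.
have [_ hx he _] := hj _ mn; rewrite E; split; first exact: (he (Ordinal km)).
have /andP[h _] := hx (Ordinal km); apply: le_trans (ltW h).
by rewrite /x0 -(xi0E H alpha a b N n) xi_le.
Qed.

Lemma middle_part_le (t : R) : 0 < t ->
  (c * (t * \int[lebesgue_measure]_(y in `]x0, xn]) g t y) -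
    \sum_(1 <= i < (m * n).+1) omega i * (t * expR (- (gamma i * t)))) ^+ 2 <=
  n%:R ^+ 2 * (K * t `^ (2 * H - 1)).
Proof.
move=> t0; have [_ _ hj] := hquad.
have -> : x0 = x 0%N by rewrite /x xi0E.
have -> : xn = x n by rewrite /x xinE.
rewrite (@Rintegral_grid R (g t) x n); last 3 first.
- exact: xi_gt0.
- by move=> j; apply: ltW; apply: xi_lt.
- exact: integrable_laplace.
rewrite sum_blocks !mulr_sumr -sumrB; apply: sqr_sum_le => j.
have := @gauss_rule_expR_error R H t _ _ m _ _ hH c_ge0 (xi_gt0 H alpha N n ha hb j)
  (xi_lt ha hb hn hxi j) hm (ltW t0) (hj j (ltn_ord j)).
have -> : xi H N alpha a b n j.+1 / xi H N alpha a b n j = r.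
  by rewrite xiS// mulrC mulKf// gt_eqF// xi_gt0.
rewrite -/c; apply: le_trans; rewrite le_eqVlt; apply/orP; left; apply/eqP; congr (_ ^+ 2).
rewrite mulrBr; congr (_ - _); last by rewrite mulr_sumr; apply: eq_bigr => k _; ring.
rewrite mulrCA; congr (_ * _); rewrite -RintegralZl//; last first.
  apply: (@integrable_lebesgueS R `]0, +oo[%classic) => //; last exact: integrable_laplace.
  move=> y /=; rewrite !in_itv /= andbT => /andP[h _]; apply: lt_le_trans h; exact: xi_gt0.
by apply: eq_Rintegral => y _; rewrite /weight /g -/c -/p; ring.
Qed.

(** The zero weight is exactly [c] times the mass of [y^p] on []0, x0]], so only
    [1 - expR (- y t) <= y t] is lost. The extra [y] raises the exponent, and [p + 2 = 5 / 2 - H]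
    explains both the denominator and the power of [x0]. *)
Lemma low_part_le (t : R) : 0 < t ->
  (c * (t * \int[lebesgue_measure]_(y in `]0, x0]) g t y) - omega 0%N * t) ^+ 2 <=
  c ^+ 2 * (x0 `^ (5 - 2 * H) / (5 / 2 - H) ^+ 2) * t ^+ 4.
Proof.
move=> t0; have [_ w0 _] := hquad.
have isub : (@lebesgue_measure R).-integrable `]0, x0] (EFin \o g t).
  apply: (@integrable_lebesgueS R `]0, +oo[%classic) => //; last exact: integrable_laplace.
  by move=> y /=; rewrite !in_itv /= andbT => /andP[].
have ipow q : -1 < q -> (@lebesgue_measure R).-integrable `]0, x0] (EFin \o (fun y => y `^ q)).
  move=> q1; apply/integrableP; split.
    by apply/measurable_EFinP; apply: measurable_funTS; exact: measurable_powR.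
  have -> : (\int[lebesgue_measure]_(y in `]0%R, x0]) `|(EFin \o (fun y => y `^ q)%R) y| =
    \int[lebesgue_measure]_(y in `]0%R, x0]) (y `^ q)%:E)%E.
    by apply: eq_integral => y _ /=; rewrite ger0_norm// powR_ge0.
  exact: le_lt_trans (integral_powR_0c_le q1 x0_gt0) (ltry _).
have -> : omega 0%N = c * \int[lebesgue_measure]_(y in `]0, x0]) (y `^ p).
  by rewrite w0 Rintegral_itv_obnd_cbnd//; exact: ipow.
set A := Rintegral _ _ _; set B := Rintegral _ _ _.
have -> : c * (t * A) - c * B * t = c * (t * (A - B)) by ring.
rewrite /A /B -RintegralB//; last exact: ipow.
rewrite exprMn -[leRHS]mulrA; apply: ler_wpM2l; first exact: sqr_ge0.
have q1 : -1 < p + 1 by move: p_gtN1; lra.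
set X := Rintegral _ _ _; set Y := x0 `^ (p + 1 + 1) / (p + 1 + 1).
have -> : x0 `^ (5 - 2 * H) / (5 / 2 - H) ^+ 2 * t ^+ 4 = t ^+ 2 * (Y * t) ^+ 2.
  have -> : x0 `^ (5 - 2 * H) / (5 / 2 - H) ^+ 2 = Y ^+ 2.
    rewrite /Y exprMn exprVn -(powR_mulrn 2 (powR_ge0 _ _)) -powRrM.
    by congr (_ `^ _ / _ ^+ 2); rewrite /p; field.
  by ring.
rewrite exprMn; apply: ler_wpM2l; first exact: sqr_ge0.
rewrite -[leLHS]real_normK ?num_real//.
apply: lerXn2r; rewrite ?nnegrE ?normr_ge0 ?mulr_ge0 ?invr_ge0 ?powR_ge0 ?(ltW t0)//.
  by move: q1; lra.
apply: le_trans (le_normr_Rintegral _ _) _ => //.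
  exact: (integrableB _ isub (ipow p p_gtN1)).
apply: (@le_trans _ _ (\int[lebesgue_measure]_(y in `]0, x0]) (y `^ (p + 1) * t))).
  apply: le_Rintegral => //.
  - exact: (integrable_abse (integrableB _ isub (ipow p p_gtN1))).
  - have -> : EFin \o (fun y : R => y `^ (p + 1) * t) = ((EFin \o (fun y : R => y `^ (p + 1))%R) \* cst t%:E)%E by [].
    by apply: integrableZr => //; exact: ipow.
  - move=> y /=; rewrite in_itv /= => /andP[y0 _].
    have -> : y `^ (p + 1) = y `^ p * y.
      by rewrite powRD ?(gt_eqF y0) ?implybT// powRr1// ltW.
    have -> : g t y - y `^ p = y `^ p * (expR (- (y * t)) - 1) by rewrite /g; ring.
    rewrite normrM ger0_norm ?powR_ge0// -mulrA ler_wpM2l ?powR_ge0//.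
    have yt : 0 <= y * t by rewrite mulr_ge0// ltW.
    have := expR_ge1Dx (- (y * t)).
    have : expR (- (y * t)) <= 1 by rewrite -[leRHS]expR0 ler_expR oppr_le0.
    by rewrite ler_norml => h1 h2; apply/andP; split; lra.
rewrite RintegralZr//; last exact: ipow.
rewrite ler_wpM2r ?(ltW t0)// -lee_fin fineK; first exact: integral_powR_0c_le.
exact: (integrable_fin_num _ (ipow _ q1)).
Qed.

Lemma kernel_error_pointwise_le (t : R) : 0 <= t ->
  (((frac_kernel H t - approx_kernel m n gamma omega d1 d2 t) ^+ 2)%:E <=
  ((6 * (c ^+ 2 * (x0 `^ (5 - 2 * H) / (5 / 2 - H) ^+ 2)) + 2 * D_err m n omega d1 d2 ^+ 2) * t ^+ 4 +
    6 * (n%:R ^+ 2 * K) * t `^ (2 * H - 1))%:E +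
  (6 * c ^+ 2 * (xn `^ (- H) / H))%:E *
    \int[lebesgue_measure]_(y in `[xn, +oo[) (t ^+ 2 * expR (- (y * (2 * t))) * y `^ (2 - H))%:E)%E.
Proof.
move=> t0; set h := (\int[_]_(_ in _) _)%E.
have h0 : (0 <= h)%E by apply: integral_ge0 => y _; rewrite lee_fin; nonneg.
have HM : 0 < xn `^ (- H) / H by rewrite divr_gt0 ?powR_gt0//; move: H1; lra.
have HM6 : 0 <= 6 * c ^+ 2 * (xn `^ (- H) / H) by move: (ltW HM) => ?; nonneg.
(* The Laplace representation holds for [t > 0] only. At 0 both kernels vanish, [frac_kernel]
   because its exponent [H - 1 / 2] is positive. *)
have [t00|tn0] := eqVneq t 0.
  rewrite t00 /frac_kernel powR0 ?mul0r; last by rewrite gt_eqF// subr_gt0.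
  have -> : approx_kernel m n gamma omega d1 d2 0 = 0.
    rewrite /approx_kernel !mulr0 oppr0 expR0 subrr mul0r mulr0 add0r big1// => i _.
    by rewrite !mulr0 oppr0 expR0 subrr mul0r mulr0.
  rewrite subr0 !expr0n /= powR0 ?mulr0 ?addr0 ?add0e; last by rewrite gt_eqF//; move: H1; lra.
  by rewrite mule_ge0// lee_fin.
have {tn0}tp : 0 < t by rewrite lt_def tn0.
have ig := integrable_laplace p_gtN1 p_le0 tp.
have sub u : 0 < u -> `]u, +oo[%classic `<=` (`]0, +oo[%classic : set R).
  by move=> u0 y /=; rewrite !in_itv /= !andbT; exact: lt_trans.
have w0 : 0 <= omega 0%N.
  by have [_ -> _] := hquad; apply: mulr_ge0 => //; apply: Rintegral_ge0 => y _; exact: powR_ge0.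
have h4' := @mollified_kernel_le R m n gamma omega d1 d2 t hd1 hd2 t0 w0
  (fun i hi => ltW (quadrature_node hi).1) (fun i hi => le_trans hd2xi (quadrature_node hi).2).
(* The pieces are turned into opaque reals, so that no integral is left in the arithmetic that
   follows. *)
have [G1 [G3 [A2 [S [-> h1 h3 h2 h4]]]]] : exists G1 G3 A2 S,
  [/\ frac_kernel H t = G1 + G3 + c * A2,
      (G1 - omega 0%N * t) ^+ 2 <= c ^+ 2 * (x0 `^ (5 - 2 * H) / (5 / 2 - H) ^+ 2) * t ^+ 4,
      (G3 - S) ^+ 2 <= n%:R ^+ 2 * (K * t `^ (2 * H - 1)),
      ((A2 ^+ 2)%:E <= (xn `^ (- H) / H)%:E * h)%E
    & `|omega 0%N * t + S - approx_kernel m n gamma omega d1 d2 t| <= D_err m n omega d1 d2 * t ^+ 2].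
  exists (c * (t * \int[lebesgue_measure]_(y in `]0, x0]) g t y)).
  exists (c * (t * \int[lebesgue_measure]_(y in `]x0, xn]) g t y)).
  exists (t * \int[lebesgue_measure]_(y in `[xn, +oo[) g t y).
  exists (\sum_(1 <= i < (m * n).+1) omega i * (t * expR (- (gamma i * t)))).
  split; [|exact: low_part_le|exact: middle_part_le|exact: (tail_sqr_le hH xn_gt0 t0)|exact: h4'].
  have -> : frac_kernel H t = c * (t * \int[lebesgue_measure]_(y in `]0, +oo[) g t y).
    exact: frac_kernelE.
  by rewrite (Rintegral_split3 x0_gt0 hxi ig) !mulrDr.
have {}h4 : (omega 0%N * t + S - approx_kernel m n gamma omega d1 d2 t) ^+ 2 <=
    D_err m n omega d1 d2 ^+ 2 * t ^+ 4.
  have -> : D_err m n omega d1 d2 ^+ 2 * t ^+ 4 = (D_err m n omega d1 d2 * t ^+ 2) ^+ 2 by ring.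
  rewrite -[leLHS]real_normK ?num_real//.
  by apply: lerXn2r; rewrite ?nnegrE ?normr_ge0//; apply: le_trans h4.
have := sqr_diff_le4 G1 G3 (c * A2) (omega 0%N * t) S (approx_kernel m n gamma omega d1 d2 t).
move: h1 h3 h4; rewrite exprMn.
move: ((_ - approx_kernel _ _ _ _ _ _ _) ^+ 2) ((G1 - _) ^+ 2) ((G3 - S) ^+ 2) => v1 v2 v3 h1 h3 h4 key.
apply: (@le_trans _ _ ((6 * v2 + 6 * v3 + 2 * v1)%:E + (6 * c ^+ 2 * A2 ^+ 2)%:E)%E).
  by rewrite -EFinD lee_fin; apply: le_trans key _; lra.
apply: leeD; first by rewrite lee_fin; lra.
rewrite EFinM [X in (_ <= X * _)%E]EFinM -muleA; apply: lee_wpmul2l => //.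
by rewrite lee_fin; nonneg.
Qed.

Lemma kernel_error_le :
  (\int[lebesgue_measure]_(t in `[0%R, T])
     ((frac_kernel H t - approx_kernel m n gamma omega d1 d2 t) ^+ 2)%:E <=
   (2 * Q_plus H T N alpha a b m n + 2 * T ^+ 5 / 5 * D_err m n omega d1 d2 ^+ 2)%:E)%E.
Proof.
pose h (t : R) := (\int[lebesgue_measure]_(y in `[xn, +oo[) (t ^+ 2 * expR (- (y * (2 * t))) * y `^ (2 - H))%:E)%E.
have [mh hI] : measurable_fun `[0, T] h /\
    (\int[lebesgue_measure]_(t in `[0%R, T]) h t <= (xn `^ (- H) / (4 * H))%:E)%E.
  exact: integral_tail_le.
have h0 t : (0 <= h t)%E by apply: integral_ge0 => y _; rewrite lee_fin; nonneg.
have Hp : 0 < H by move: H1; lra.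
set C1 := 6 * (c ^+ 2 * (x0 `^ (5 - 2 * H) / (5 / 2 - H) ^+ 2)) + 2 * D_err m n omega d1 d2 ^+ 2.
set C2 := 6 * (n%:R ^+ 2 * K); set C3 := 6 * c ^+ 2 * (xn `^ (- H) / H).
have r1 : 0 <= (r - 1) / 2 by rewrite divr_ge0// subr_ge0 ltW// r_plus_gt1.
have K0 : 0 <= K by rewrite /K; nonneg.
have C10 : 0 <= C1 by rewrite /C1; nonneg.
have C20 : 0 <= C2 by rewrite /C2; nonneg.
have C30 : 0 <= C3 by rewrite /C3; nonneg.
pose f1 (t : R) := C1 * t ^+ 4 + C2 * t `^ (2 * H - 1).
have f10 t : 0 <= f1 t.
  by rewrite /f1 (_ : t ^+ 4 = (t ^+ 2) ^+ 2); [nonneg|ring].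
have mf1 : measurable_fun `[0, T] f1.
  apply: measurable_funTS; apply: measurable_funD.
    by apply: measurable_funM; [exact: measurable_cst|exact: exprn_measurable].
  by apply: measurable_funM; [exact: measurable_cst|exact: measurable_powR].
apply: (@le_trans _ _ (\int[lebesgue_measure]_(t in `[0%R, T]) ((f1 t)%:E + C3%:E * h t))%E).
  apply: (@ge0_le_integral _ (measurableTypeR R) R lebesgue_measure `[0, T]%classic) => //.
  - by move=> t _; rewrite lee_fin sqr_ge0.
  - apply/measurable_EFinP; apply: measurable_funTS; apply: measurable_funX.
    by apply: measurable_funB; [exact: measurable_frac_kernel|exact: measurable_approx_kernel].
  - apply: emeasurable_funD; first exact/measurable_EFinP.
    exact: measurable_funeM.
  - by move=> t /=; rewrite in_itv /= => /andP[t0 _]; exact: kernel_error_pointwise_le.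
rewrite ge0_integralD//; last 4 first.
- by move=> t _; rewrite lee_fin.
- exact/measurable_EFinP.
- by move=> t _; rewrite mule_ge0// lee_fin.
- exact: measurable_funeM.
rewrite ge0_integralZl_EFin//.
have I1 : (\int[lebesgue_measure]_(t in `[0%R, T]) (f1 t)%:E <=
    (C1 * (T ^+ 5 / 5) + C2 * (T `^ (2 * H) / (2 * H)))%:E)%E.
  (* The point 0 is dropped because [integral_powR_0c_le] concerns []0, T]], where moreover [t ^+ 4]
     is a real power. *)
  rewrite -integral_itv_obnd_cbnd; last by apply/measurable_EFinP; apply: measurable_funS mf1 => //; exact: subset_itv_oc_cc.
  rewrite (_ : (\int[lebesgue_measure]_(t in `]0%R, T]) (f1 t)%:E =
    \int[lebesgue_measure]_(t in `]0%R, T]) (C1%:E * (t `^ 4%:R)%:E + C2%:E * (t `^ (2 * H - 1))%:E))%E); last first.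
    apply: eq_integral => t; rewrite inE /= in_itv /= => /andP[t0 _].
    by rewrite powR_mulrn ?ltW// -!EFinM -EFinD.
  have mp q : measurable_fun `]0, T] (fun t : R => (t `^ q)%:E).
    by apply/measurable_EFinP; apply: measurable_funTS; exact: measurable_powR.
  rewrite ge0_integralD//; last 4 first.
  - by move=> t _; rewrite -EFinM lee_fin; nonneg.
  - by apply: measurable_funeM; exact: mp.
  - by move=> t _; rewrite -EFinM lee_fin; nonneg.
  - by apply: measurable_funeM; exact: mp.
  rewrite ge0_integralZl_EFin//; last 2 first.
  - by move=> t _; rewrite lee_fin powR_ge0.
  - exact: mp.
  rewrite ge0_integralZl_EFin//; last 2 first.
  - by move=> t _; rewrite lee_fin powR_ge0.
  - exact: mp.
  have J1 : (\int[lebesgue_measure]_(t in `]0%R, T]) (t `^ 4%:R)%:E <= (T ^+ 5 / 5)%:E)%E.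
    have := @integral_powR_0c_le R 4%:R T; rewrite (_ : 4%:R + 1 = 5%:R :> R); last by ring.
    by rewrite powR_mulrn ?(ltW hT)//; apply => //; lra.
  have J2 : (\int[lebesgue_measure]_(t in `]0%R, T]) (t `^ (2 * H - 1))%:E <= (T `^ (2 * H) / (2 * H))%:E)%E.
    by have := @integral_powR_0c_le R (2 * H - 1) T; rewrite subrK; apply => //; move: H1; lra.
  have C10e : (0 <= C1%:E)%E by rewrite lee_fin.
  have C20e : (0 <= C2%:E)%E by rewrite lee_fin.
  exact: leeD (lee_wpmul2l C10e J1) (lee_wpmul2l C20e J2).
apply: le_trans (leeD I1 (lee_wpmul2l _ hI)) _; first by rewrite lee_fin.
rewrite -EFinM -EFinD lee_fin.
have AH0 : 0 < A_plus H.
  rewrite sqrtr_gt0 addr_gt0// divr_gt0//; move: H2; lra.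
(* The truncation points are tuned to each other: the rates [alpha / ((5 / 2 - H) A_+)] and
   [alpha / (H A_+)], multiplied by the exponents [5 - 2 H] and [2 H], both become
   [2 alpha / A_+]. *)
have e0 : x0 `^ (5 - 2 * H) = a `^ (5 - 2 * H) * expR (- (2 * alpha / A_plus H * Num.sqrt N%:R)).
  rewrite /x0 /xi_first powRM ?expR_ge0 ?(ltW ha)// -expRM; congr (_ * expR _).
  have -> : 5 - 2 * H = 2 * (5 / 2 - H) by field.
  have : 5 / 2 - H != 0 by rewrite gt_eqF//; move: H2; lra.
  move: (5 / 2 - H) (A_plus H) (lt0r_neq0 AH0) => z A A0 z0; field; by rewrite A0 z0.
have en : xn `^ (- H) * xn `^ (- H) = b `^ (- (2 * H)) * expR (- (2 * alpha / A_plus H * Num.sqrt N%:R)).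
  rewrite -powRD; last by apply/implyP => _; rewrite gt_eqF.
  rewrite /xn /xi_last powRM ?expR_ge0 ?(ltW hb)// -expRM; congr (_ `^ _ * expR _); first by ring.
  by move: (A_plus H) (lt0r_neq0 AH0) (lt0r_neq0 Hp) => A A0 h0'; field; rewrite A0 h0'.
rewrite /Q_plus -/c -/r /C1 /C2 /C3 /K e0.
set E := expR _ in en *.
have -> : 6 * c ^+ 2 * (xn `^ (- H) / H) * (xn `^ (- H) / (4 * H)) = 2 * (c ^+ 2 * (3 / (4 * H ^+ 2) * b `^ (- (2 * H)) * E)).
  transitivity (6 * c ^+ 2 * (xn `^ (- H) * xn `^ (- H)) / (4 * H ^+ 2)); last by rewrite en; field; rewrite gt_eqF.
  by field; rewrite gt_eqF.
set Z := T `^ (2 * H) / H * n%:R ^+ 2 * m%:R `^ (2 - 2 * H) * ((r - 1) / 2) ^+ (4 * m + 2).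
have Z0 : 0 <= Z by move: (ltW Hp) => ?; rewrite /Z; nonneg.
have hh : 5 / 2 - H != 0 by rewrite gt_eqF//; move: H2; lra.
have -> : 6 * (n%:R ^+ 2 * (144 / 5 * c ^+ 2 * m%:R `^ (2 - 2 * H) * ((r - 1) / 2) ^+ (4 * m + 2))) * (T `^ (2 * H) / (2 * H)) =
   c ^+ 2 * (6 * 144 / 10 * Z).
  by rewrite /Z; field; rewrite gt_eqF.
have hpi : 6 * 144 / 10 * Z <= 2 * (49 * pi ^+ 3 / 24 * Z).
  by rewrite mulrA ler_wpM2r//; have := pi_cube_ge R; lra.
have := ler_wpM2l (sqr_ge0 c) hpi.
have -> : 49 * pi ^+ 3 / 24 * (T `^ (2 * H) / H) * n%:R ^+ 2 * m%:R `^ (2 - 2 * H) * ((r - 1) / 2) ^+ (4 * m + 2) = 49 * pi ^+ 3 / 24 * Z.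
  by rewrite /Z !mulrA.
have -> : (6 * (c ^+ 2 * (a `^ (5 - 2 * H) * E / (5 / 2 - H) ^+ 2)) + 2 * D_err m n omega d1 d2 ^+ 2) * (T ^+ 5 / 5) =
  2 * (c ^+ 2 * (3 * T ^+ 5 / (5 * (5 / 2 - H) ^+ 2) * a `^ (5 - 2 * H) * E)) + 2 * T ^+ 5 / 5 * D_err m n omega d1 d2 ^+ 2.
  by move: (5 / 2 - H) hh (a `^ (5 - 2 * H)) => z z0 a'; field.
move: (c ^+ 2) (49 * pi ^+ 3 / 24 * Z) (6 * 144 / 10 * Z) => c2 z1 z2.
move: (3 * _ / _ * _ * _) (3 / _ * _ * _) (2 * T ^+ 5 / 5 * _) => u v w.
rewrite !mulrDr; lra.
Qed.

End quadrature_error.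

(** * Normal variance and independence *)

(** The abstract change of variables involves the Radon-Nikodym derivative of the normal law. It has
    the same integral as [normal_pdf] over every measurable set, hence equals it almost
    everywhere. *)
Lemma ge0_integral_normal_prob (R : realType) (m s : R) (f : measurableTypeR R -> \bar R) :
  measurable_fun setT f -> (forall x, 0 <= f x)%E ->
  (\int[normal_prob m s]_x f x = \int[lebesgue_measure]_x (f x * (normal_pdf m s x)%:E))%E.
Proof.
move=> mf f0.
pose nu : probability (measurableTypeR R) R := normal_prob m s.
have numu : nu `<< (@lebesgue_measure R) := normal_prob_dominates m s.
have h := @Radon_Nikodym_SigmaFinite.change_of_variables _ (measurableTypeR R) R nu lebesgue_measure numu f setT f0 measurableT mf.
transitivity (\int[nu]_x f x)%E; first by [].
rewrite -h.
have ig := @Radon_Nikodym_SigmaFinite.f_integrable _ (measurableTypeR R) R nu lebesgue_measure numu.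
have mp : measurable_fun setT (fun x : measurableTypeR R => (normal_pdf m s x)%:E).
  by apply/measurable_EFinP; exact: measurable_normal_pdf.
apply: ae_eq_integral => //.
- by apply: emeasurable_funM => //; exact: (measurable_int _ ig).
- exact: emeasurable_funM.
- apply: ae_eqe_mul2l; apply: integral_ae_eq => // E _ mE.
  by rewrite -(@Radon_Nikodym_SigmaFinite.f_integral _ (measurableTypeR R) R nu lebesgue_measure numu E mE).
Qed.

Lemma itvNNy_bigcup (R : realType) : [set: R] = \bigcup_n `[- n%:R, n%:R]%classic.
Proof.
apply/seteqP; split => // x _; exists (Num.bound `|x|) => //=; rewrite in_itv /= -ler_norml.
exact: ltW (archi_boundP (normr_ge0 x)).
Qed.

(** Integration by parts: [- s^2 x normal_pdf 0 s x] has derivative [(x^2 - s^2) normal_pdf 0 s x].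
    On [[-n, n]] the second moment is therefore [s^2] times the mass minus a boundary term [r n],
    and the mass tends to 1. *)
Lemma integral_sqr_normal_pdf (R : realType) (s : R) : 0 < s ->
  (\int[lebesgue_measure]_x (x ^+ 2 * normal_pdf 0 s x)%:E = (s ^+ 2)%:E)%E.
Proof.
move=> s0; have sn0 : s != 0 by rewrite gt_eqF.
set f := fun x : R => x ^+ 2 * normal_pdf 0 s x.
have pE x : normal_pdf 0 s x = normal_peak s * expR (- (x ^+ 2 / (2 * s ^+ 2))).
  by rewrite normal_pdfE// /normal_fun subr0 mulNr -mulr_natl.
have cN n : - n.+1%:R <= - n%:R :> R by rewrite lerN2 ler_nat.
have cP n : n%:R <= n.+1%:R :> R by rewrite ler_nat.
have mpdf : measurable_fun [set: R] (normal_pdf 0 s) by exact: measurable_normal_pdf.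
have mf : measurable_fun [set: R] f by apply: measurable_funM => //; exact: exprn_measurable.
have h1 := @cvg_integral_itv R f (fun n => - n%:R) (fun n => n%:R) setT measurableT mf
  (fun x _ => mulr_ge0 (sqr_ge0 x) (normal_pdf_ge0 0 s x)) cN cP (itvNNy_bigcup R).
have h2 := @cvg_integral_itv R (normal_pdf 0 s) (fun n => - n%:R) (fun n => n%:R) setT measurableT mpdf
  (fun x _ => normal_pdf_ge0 0 s x) cN cP (itvNNy_bigcup R).
rewrite integral_normal_pdf in h2.
pose F (x : R) := - (s ^+ 2 * x * normal_pdf 0 s x).
pose r n : R := 2 * s ^+ 2 * n%:R * normal_pdf 0 s n%:R.
have dp (x : R) : is_derive x 1 (normal_pdf 0 s) (- (x / s ^+ 2) * normal_pdf 0 s x).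
  have -> : normal_pdf 0 s = (fun x => normal_peak s * expR (- (x ^+ 2 / (2 * s ^+ 2)))).
    by apply/funext => y; exact: pE.
  have d1 : is_derive x 1 (fun x : R => - (x ^+ 2 / (2 * s ^+ 2))) (- (x / s ^+ 2)).
    have -> : (fun x : R => - (x ^+ 2 / (2 * s ^+ 2))) = horner (- (2 * s ^+ 2)^-1 *: 'X^2).
      by apply/funext => y; rewrite hornerZ hornerXn mulNr [_^-1 * _]mulrC.
    apply: is_derive_eq; rewrite derivZ derivXn hornerZ hornerMn hornerXn /=; by field.
  have d2 := @is_derive1_comp R (@expR R) (fun x : R => - (x ^+ 2 / (2 * s ^+ 2))) x _ _ (is_derive_expR _) d1.
  have := @is_deriveZ R R R _ (normal_peak s) x 1 _ d2.
  by move/is_derive_eq; apply; rewrite /GRing.scale /=; ring.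
have dF (x : R) : is_derive x 1 F (f x - s ^+ 2 * normal_pdf 0 s x).
  have := @is_deriveZ R R R _ (- s ^+ 2) x 1 _ (@is_deriveM R R id (normal_pdf 0 s) x 1 _ _ (is_derive_id _ _) (dp x)).
  rewrite (_ : - s ^+ 2 \*: (id * normal_pdf 0 s) = F); last first.
    by apply/funext => y; rewrite /F fctE /= /GRing.scale /=; ring.
  by move/is_derive_eq; apply; rewrite /f /GRing.scale /=; field.
have cpdf : continuous (normal_pdf 0 s) by exact: continuous_normal_pdf.
have cf : continuous f by move=> x; apply: cvgM; [apply: exprn_continuous|exact: cpdf].
have E n : (\int[lebesgue_measure]_(x in `[(- n%:R)%R, n%:R]) (f x)%:E =
    (s ^+ 2)%:E * \int[lebesgue_measure]_(x in `[(- n%:R)%R, n%:R]) (normal_pdf 0 s x)%:E - (r n)%:E)%E.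
  case: n => [|n].
    by rewrite oppr0 set_itv1 !integral_set1 mule0 /r mulr0 mul0r sube0.
  have Nn : - n.+1%:R < n.+1%:R :> R by rewrite -subr_gt0 opprK addr_gt0.
  have i1 : (@lebesgue_measure R).-integrable `[- n.+1%:R, n.+1%:R] (EFin \o f).
    by apply: integrable_itv_continuous; exact: continuous_subspaceT.
  have i2 : (@lebesgue_measure R).-integrable `[- n.+1%:R, n.+1%:R] (EFin \o (fun x => s ^+ 2 * normal_pdf 0 s x)).
    apply: integrable_itv_continuous; apply: continuous_subspaceT => x.
    by apply: cvgM; [exact: cvg_cst|exact: cpdf].
  have := @integral_itv_is_derive R _ F _ _ Nn _ (fun x _ => dF x).
  rewrite /F; have -> : normal_pdf 0 s (- n.+1%:R) = normal_pdf 0 s n.+1%:R by rewrite !pE sqrrN.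
  move=> /(_ _)/wrap[].
    apply: continuous_subspaceT => x; apply: cvgB; first exact: cf.
    by apply: cvgM; [exact: cvg_cst|exact: cpdf].
  rewrite (_ : - _ - - _ = - r n.+1); last by rewrite /r; ring.
  rewrite (_ : (\int[_]_(_ in _) _)%E = (\int[lebesgue_measure]_(x in `[(- n.+1%:R)%R, n.+1%:R]) (f x)%:E -
     \int[lebesgue_measure]_(x in `[(- n.+1%:R)%R, n.+1%:R]) (s ^+ 2 * normal_pdf 0 s x)%:E)%E); last first.
    by rewrite -integralB_EFin.
  rewrite -ge0_integralZl_EFin ?sqr_ge0//; last 2 first.
    by move=> x _; rewrite lee_fin normal_pdf_ge0.
    by apply/measurable_EFinP; exact: measurable_funTS.
  under [X in _ -> _ = (X - _)%E]eq_integral do rewrite -EFinM.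
  have f1 : (\int[lebesgue_measure]_(x in `[(- n.+1%:R)%R, n.+1%:R]) (f x)%:E)%E \is a fin_num by exact: (integrable_fin_num _ i1).
  have f2 : (\int[lebesgue_measure]_(x in `[(- n.+1%:R)%R, n.+1%:R]) (s ^+ 2 * normal_pdf 0 s x)%:E)%E \is a fin_num by exact: (integrable_fin_num _ i2).
  have aux (u v : \bar R) (c : R) : u \is a fin_num -> v \is a fin_num -> (u - v = (- c)%:E -> u = v - c%:E)%E.
    by case: u => // u _; case: v => // v _; rewrite -!EFinB => -[?]; congr EFin; lra.
  exact: (aux _ _ _ f1 f2).
(* [expR (- z) <= 1 / (1 + z)] already gives decay of order [1 / n]. The inequality [n <= n^2] for
   naturals lets the bound be written as [C / (n + 1)] from [n = 0] on. *)
have r0 : r n @[n --> \oo] --> 0.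
  pose C := 8 * s ^+ 4 * normal_peak s.
  apply: (@squeeze_cvgr _ _ _ _ (fun=> 0) (fun n => C * n.+1%:R^-1)).
  - apply: nearW => n; apply/andP; split.
      by rewrite /r; have := normal_pdf_ge0 0 s n%:R; move: (ltW s0) => ? ?; nonneg.
    rewrite /r /C pE; have pk := normal_peak_ge0 s.
    have s2 : 0 < 2 * s ^+ 2 by rewrite mulr_gt0// exprn_gt0.
    have h := expR_ge1Dx (n%:R ^+ 2 / (2 * s ^+ 2)).
    have q0 : 0 < 1 + n%:R ^+ 2 / (2 * s ^+ 2) :> R.
      by rewrite ltr_pwDl// divr_ge0 ?sqr_ge0// ltW.
    have h1' : expR (- (n%:R ^+ 2 / (2 * s ^+ 2))) <= (1 + n%:R ^+ 2 / (2 * s ^+ 2))^-1.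
      by rewrite expRN lef_pV2 ?posrE ?expR_gt0.
    have nn : n%:R <= n%:R ^+ 2 :> R by rewrite -natrX ler_nat; case: (n) => // k; rewrite leq_pmulr.
    apply: (@le_trans _ _ (2 * s ^+ 2 * n%:R * (normal_peak s * (1 + n%:R ^+ 2 / (2 * s ^+ 2))^-1))).
      by apply: ler_wpM2l; [nonneg|apply: ler_wpM2l].
    rewrite ler_pdivlMr//.
    have -> : 2 * s ^+ 2 * n%:R * (normal_peak s * (1 + n%:R ^+ 2 / (2 * s ^+ 2))^-1) * n.+1%:R =
        4 * s ^+ 4 * normal_peak s * ((n%:R * n.+1%:R) / (2 * s ^+ 2 + n%:R ^+ 2)).
      field; rewrite gt_eqF//=; last by move: q0; rewrite -(pmulr_lgt0 _ s2) mulrDl mul1r divfK// gt_eqF.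
    have -> : 8 * s ^+ 4 * normal_peak s = 4 * s ^+ 4 * normal_peak s * 2 by ring.
    apply: ler_wpM2l; first by move: (ltW s0) => ?; nonneg.
    have q1 : 0 < 2 * s ^+ 2 + n%:R ^+ 2 by rewrite ltr_pwDl// sqr_ge0.
    by rewrite ler_pdivrMr// -natr1; nra.
  - exact: cvg_cst.
  - by rewrite -(mulr0 C); apply: cvgM; [exact: cvg_cst|exact: cvg_harmonic].
have : (\int[lebesgue_measure]_(x in `[(- n%:R)%R, n%:R]) (f x)%:E)%E @[n --> \oo] --> ((s ^+ 2)%:E * 1 - 0%:E)%E.
  under eq_fun do rewrite E.
  apply: cvgeB => //; last by apply: cvg_EFin => //; exact: nearW.
  exact: cvgeZl.
rewrite mule1 sube0 => h3; exact: (cvg_unique _ h1 h3).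
Qed.

Section product_of_independent.
Context d (Omega : measurableType d) (R : realType) (P : probability Omega R).

(** Independence says that the joint law agrees with the product of the marginal laws on rectangles,
    hence everywhere by uniqueness of the product measure. Fubini on the plane then factors the
    integral of [z.1 * z.2]. *)
Lemma indep_expectation_mul (X Y : Omega -> R) :
  measurable_fun setT X -> measurable_fun setT Y ->
  P.-integrable setT (EFin \o X) -> P.-integrable setT (EFin \o Y) ->
  P.-integrable setT (EFin \o (fun w => X w * Y w)) ->
  (forall A B : set R, measurable A -> measurable B ->
    P (X @^-1` A `&` Y @^-1` B) = (P (X @^-1` A) * P (Y @^-1` B))%E) ->
  \int[P]_w (X w * Y w) = (\int[P]_w X w) * (\int[P]_w Y w).
Proof.
move=> mX mY iX iY iXY ind.
pose mR := measurableTypeR R.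
pose Z (w : Omega) : mR * mR := (X w, Y w).
have mZ : measurable_fun setT Z by exact: measurable_fun_pair.
pose X0 : Omega -> mR := X; pose Y0 : Omega -> mR := Y.
have mX0 : measurable_fun setT X0 := mX; have mY0 : measurable_fun setT Y0 := mY.
pose X' : {mfun Omega >-> mR} := mfun_Sub (mem_set mX0).
pose Y' : {mfun Omega >-> mR} := mfun_Sub (mem_set mY0).
pose Z' : {mfun Omega >-> (mR * mR)%type} := mfun_Sub (mem_set mZ).
pose mx : probability mR R := distribution P X'.
pose my : probability mR R := distribution P Y'.
pose mz : probability (mR * mR)%type R := distribution P Z'.
have mzE A : measurable A -> (mx \x my)%E A = mz A.
  apply: product_measure_unique => A1 A2 mA1 mA2.
  by rewrite /mz /mx /my /distribution /pushforward /= -ind.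
pose f (z : mR * mR) : \bar R := (z.1 * z.2)%:E.
have mf : measurable_fun setT f.
  by apply/measurable_EFinP; apply: measurable_funM.
have mid : measurable_fun setT (EFin : mR -> \bar R) by exact/measurable_EFinP.
have iz : (mx \x my)%E.-integrable setT f.
  apply/integrableP; split => //.
  rewrite (@eq_measure_integral _ _ _ _ mz); last by move=> A mA _; exact: mzE.
  rewrite ge0_integral_distribution//; last exact: measurableT_comp.
  by have /integrableP[] := iXY.
have EX : (\int[mx]_x x%:E = \int[P]_w (X w)%:E)%E by exact: (@integral_distribution _ _ _ _ _ P X' EFin mid iX).
have EY : (\int[my]_x x%:E = \int[P]_w (Y w)%:E)%E by exact: (@integral_distribution _ _ _ _ _ P Y' EFin mid iY).
have ix : mx.-integrable setT (EFin : mR -> \bar R) by exact: (@integrable_pushforward _ _ _ _ _ X' _ P setT EFin mid iX measurableT).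
have iy : my.-integrable setT (EFin : mR -> \bar R) by exact: (@integrable_pushforward _ _ _ _ _ Y' _ P setT EFin mid iY measurableT).
have EXY : (\int[P]_w (X w * Y w)%:E = \int[mz]_z f z)%E.
  by rewrite -(@integral_distribution _ _ _ _ _ P Z' f mf iXY).
rewrite /Rintegral EXY -(@eq_measure_integral _ _ _ _ mz (mx \x my)%E); last by move=> A mA _; exact: mzE.
rewrite -integral12_prod_meas1//.
rewrite (_ : (\int[mx]_x _)%E = (\int[mx]_x (x%:E * \int[my]_y y%:E))%E); last first.
  by apply: eq_integral => x _; rewrite /fubini_F -integralZl//; apply: eq_integral => y _; rewrite EFinM.
rewrite EY -(fineK (integrable_fin_num measurableT iY)) integralZr// EX fineM//.
exact: (integrable_fin_num measurableT iX).
Qed.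

End product_of_independent.

Lemma mutually_independent_pair d (Omega : measurableType d) (R : realType) (P : probability Omega R)
    (I : finType) (Y : I -> Omega -> R) (p q : I) (A B : set R) :
  mutually_independent P Y -> p != q -> measurable A -> measurable B ->
  P (Y p @^-1` A `&` Y q @^-1` B) = (P (Y p @^-1` A) * P (Y q @^-1` B))%E.
Proof.
move=> ind pq mA mB.
pose C i : set R := if i == p then A else if i == q then B else setT.
have mC i : measurable (C i) by rewrite /C; case: ifP => // _; case: ifP.
have Cp : C p = A by rewrite /C eqxx.
have Cq : C q = B by rewrite /C eqxx eq_sym (negbTE pq).
have := ind C mC.
rewrite (bigD1 p)//= (bigD1 q)/=; last by rewrite eq_sym.
rewrite big1 ?mule1 ?Cp ?Cq; last first.
  move=> i /andP[ip iq]; rewrite /C (negbTE ip) (negbTE iq) preimage_setT.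
  exact: probability_setT.
move=> <-; congr (P _); apply/seteqP; split => w /=.
  by move=> [wA wB] i _; rewrite /C; case: eqP => [->//|_]; case: eqP => [->//|].
by move=> h; split; [rewrite -Cp; exact: h|rewrite -Cq; exact: h].
Qed.

(** * Square-integrable functions *)

Section square_integrable.
Context d (T : measurableType d) (R : realType) (mu : {measure set T -> \bar R}).
Variable (D : set T).
Hypothesis mD : measurable D.

Definition square_integrable (f : T -> R) : Prop :=
  measurable_fun D f /\ (\int[mu]_(x in D) (f x ^+ 2)%:E < +oo)%E.

Lemma square_integrable_le (f : T -> R) (M : R) : measurable_fun D f ->
  (\int[mu]_(x in D) (f x ^+ 2)%:E <= M%:E)%E -> square_integrable f.
Proof. by move=> mf fM; split => //; exact: le_lt_trans fM (ltry _). Qed.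

Lemma square_integrableE (f : T -> R) : square_integrable f ->
  (\int[mu]_(x in D) (f x ^+ 2)%:E = (\int[mu]_(x in D) (f x ^+ 2))%:E)%E.
Proof.
move=> [_ f2]; rewrite /Rintegral fineK// ge0_fin_numE//.
by apply: integral_ge0 => x _; rewrite lee_fin sqr_ge0.
Qed.

Lemma square_integrable_mul (f g : T -> R) : square_integrable f -> square_integrable g ->
  mu.-integrable D (EFin \o (fun x => f x * g x)).
Proof.
move=> Lf Lg.
have hf : (\int[mu]_(x in D) (f x ^+ 2)%:E <= (\int[mu]_(x in D) (f x ^+ 2))%:E)%E.
  by rewrite square_integrableE.
have hg : (\int[mu]_(x in D) (g x ^+ 2)%:E <= (\int[mu]_(x in D) (g x ^+ 2))%:E)%E.
  by rewrite square_integrableE.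
exact: (integrable_mul_sqr mD Lf.1 Lg.1 hf hg).
Qed.

Lemma square_integrableZ (c : R) (f : T -> R) : square_integrable f ->
  square_integrable (fun x => c * f x).
Proof.
move=> Lf; have [mf f2] := Lf; apply: (@square_integrable_le _ (c ^+ 2 * \int[mu]_(x in D) (f x ^+ 2))).
  by apply: measurable_funM => //; exact: measurable_cst.
rewrite EFinM -square_integrableE// -ge0_integralZl_EFin ?sqr_ge0//; last 2 first.
  by move=> x _; rewrite lee_fin sqr_ge0.
  by apply/measurable_EFinP; exact: measurable_funX.
by rewrite le_eqVlt; apply/orP; left; apply/eqP; apply: eq_integral => x _; rewrite -EFinM exprMn.
Qed.

Lemma square_integrableD (f g : T -> R) : square_integrable f -> square_integrable g ->
  square_integrable (fun x => f x + g x).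
Proof.
move=> Lf Lg; have [mf f2] := Lf; have [mg g2] := Lg.
apply: (@square_integrable_le _ (2 * \int[mu]_(x in D) (f x ^+ 2) + 2 * \int[mu]_(x in D) (g x ^+ 2))).
  exact: measurable_funD.
rewrite EFinD !EFinM -!square_integrableE//.
have mX (h : T -> R) : measurable_fun D h -> measurable_fun D (fun x => (h x ^+ 2)%:E).
  by move=> mh; apply/measurable_EFinP; exact: measurable_funX.
have p (h : T -> R) x : D x -> (0 <= (h x ^+ 2)%:E)%E by move=> _; rewrite lee_fin sqr_ge0.
have mZ (h : T -> R) : measurable_fun D h -> measurable_fun D (fun x => 2%:E * (h x ^+ 2)%:E)%E.
  by move=> mh; apply: emeasurable_funM; [exact: measurable_cst|exact: mX].
have pZ (h : T -> R) x : D x -> (0 <= 2%:E * (h x ^+ 2)%:E)%E by move=> Dx; rewrite mule_ge0// p.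
have Z (h : T -> R) : measurable_fun D h ->
    (2%:E * \int[mu]_(x in D) (h x ^+ 2)%:E = \int[mu]_(x in D) (2%:E * (h x ^+ 2)%:E))%E.
  by move=> mh; rewrite ge0_integralZl_EFin//; [exact: p|exact: mX].
rewrite !Z// -ge0_integralD//; [|exact: pZ|exact: mZ|exact: pZ|exact: mZ].
apply: ge0_le_integral => //.
- exact: (p (fun x => f x + g x)).
- by apply: mX; exact: measurable_funD.
- by apply: emeasurable_funD; exact: mZ.
- move=> x _; rewrite -!EFinM -EFinD lee_fin; have := sqr_ge0 (f x - g x); nra.
Qed.

Lemma square_integrableB (f g : T -> R) : square_integrable f -> square_integrable g ->
  square_integrable (fun x => f x - g x).
Proof.
move=> Lf Lg; have := square_integrableD Lf (square_integrableZ (-1) Lg).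
by under [X in square_integrable X -> _]eq_fun do rewrite mulN1r.
Qed.

Lemma square_integrable0 : square_integrable (fun=> 0).
Proof.
apply: (@square_integrable_le _ 0); first exact: measurable_cst.
by rewrite integral0_eq// => x _; rewrite expr0n.
Qed.

Lemma square_integrable_sum (I : eqType) (s : seq I) (c : I -> R) (f : I -> T -> R) :
  (forall i, i \in s -> square_integrable (f i)) ->
  square_integrable (fun x => \sum_(i <- s) c i * f i x).
Proof.
elim: s => [|i s ih] h.
  by under eq_fun do rewrite big_nil; exact: square_integrable0.
under eq_fun do rewrite big_cons.
apply: square_integrableD; first by apply/square_integrableZ/h; rewrite mem_head.
by apply: ih => j js; apply: h; rewrite in_cons js orbT.
Qed.

Lemma Rintegral_sum_mulr (I : eqType) (s : seq I) (c : I -> R) (f : I -> T -> R) (g : T -> R) :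
  (forall i, i \in s -> square_integrable (f i)) -> square_integrable g ->
  \int[mu]_(x in D) ((\sum_(i <- s) c i * f i x) * g x) =
  \sum_(i <- s) c i * \int[mu]_(x in D) (f i x * g x).
Proof.
move=> + Lg; elim: s => [|i s ih] h.
  rewrite big_nil; have -> : (fun x => (\sum_(i <- [::]) c i * f i x) * g x) = (fun=> 0).
    by apply/funext => x; rewrite big_nil mul0r.
  by rewrite Rintegral_cst// mul0r.
have Lf : square_integrable (f i) by apply: h; rewrite mem_head.
have Ls j : j \in s -> square_integrable (f j) by move=> js; apply: h; rewrite in_cons js orbT.
have -> : (fun x => (\sum_(j <- i :: s) c j * f j x) * g x) =
    (fun x => c i * f i x * g x + (\sum_(j <- s) c j * f j x) * g x).
  by apply/funext => x; rewrite big_cons mulrDl.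
rewrite RintegralD//; last 2 first.
- by apply: square_integrable_mul => //; exact: square_integrableZ.
- by apply: square_integrable_mul => //; exact: square_integrable_sum.
rewrite big_cons ih//; congr (_ + _).
rewrite -RintegralZl//; last exact: square_integrable_mul.
by congr (fine _); apply: eq_integral => x _; rewrite mulrA.
Qed.

Lemma Rintegral_sum_mul (I J : eqType) (s : seq I) (r : seq J) (b : I -> R) (c : J -> R)
    (f : I -> T -> R) (g : J -> T -> R) :
  (forall i, i \in s -> square_integrable (f i)) ->
  (forall j, j \in r -> square_integrable (g j)) ->
  \int[mu]_(x in D) ((\sum_(i <- s) b i * f i x) * \sum_(j <- r) c j * g j x) =
  \sum_(i <- s) \sum_(j <- r) b i * c j * \int[mu]_(x in D) (f i x * g j x).
Proof.
move=> hf hg; rewrite Rintegral_sum_mulr//; last exact: square_integrable_sum.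
apply: eq_big_seq => i si.
have -> : \int[mu]_(x in D) (f i x * \sum_(j <- r) c j * g j x) =
    \int[mu]_(x in D) ((\sum_(j <- r) c j * g j x) * f i x).
  by congr (fine _); apply: eq_integral => x _; rewrite mulrC.
rewrite Rintegral_sum_mulr//; last exact: hf.
rewrite mulr_sumr; apply: eq_bigr => j _; rewrite mulrA; congr (_ * _).
by congr (fine _); apply: eq_integral => x _; rewrite mulrC.
Qed.

(** This bilinear expansion is used on both sides of the isometry: with values of Brownian motion on
    [Omega], and with indicators of []0, a]] on the time axis. *)
Lemma Rintegral_mulBB (f f' g g' : T -> R) :
  square_integrable f -> square_integrable f' -> square_integrable g -> square_integrable g' ->
  \int[mu]_(x in D) ((f x - f' x) * (g x - g' x)) =
  \int[mu]_(x in D) (f x * g x) - \int[mu]_(x in D) (f x * g' x) -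
  (\int[mu]_(x in D) (f' x * g x) - \int[mu]_(x in D) (f' x * g' x)).
Proof.
move=> Lf Lf' Lg Lg'.
have Lgg := square_integrableB Lg Lg'.
have E h : square_integrable h -> \int[mu]_(x in D) (h x * (g x - g' x)) =
    \int[mu]_(x in D) (h x * g x) - \int[mu]_(x in D) (h x * g' x).
  move=> Lh; rewrite -RintegralB//; [|exact: square_integrable_mul..].
  by congr (fine _); apply: eq_integral => x _; rewrite mulrBr.
rewrite -!E// -RintegralB//; [|exact: square_integrable_mul..].
by congr (fine _); apply: eq_integral => x _; rewrite mulrBl.
Qed.

End square_integrable.

Section probability_square_integrable.
Context d (Omega : measurableType d) (R : realType) (P : probability Omega R).

Lemma square_integrable_integrable (X : Omega -> R) :
  square_integrable P setT X -> P.-integrable setT (EFin \o X).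
Proof.
move=> LX; have L1 : square_integrable P setT (fun=> 1 : R).
  apply: (@square_integrable_le _ _ _ _ _ _ 1); first exact: measurable_cst.
  by rewrite expr1n integral_cst// mul1e; exact: probability_le1.
have := square_integrable_mul measurableT LX L1.
by under [X in P.-integrable _ (_ \o X) -> _]eq_fun do rewrite mulr1.
Qed.

End probability_square_integrable.

(** * Covariance of Brownian motion and the Wiener isometry *)

Section brownian_covariance.
Context d (Omega : measurableType d) (R : realType) (P : probability Omega R) (D : nat).
Variable B : R -> Omega -> 'cV[R]_D.
Hypothesis hB : brownian_motion P B.
Let Z (s t : R) (i : 'I_D) (w : Omega) : R := B t w i 0 - B s w i 0.

Lemma measurable_increment s t i : 0 <= s -> 0 <= t -> measurable_fun setT (Z s t i).
Proof. by case: hB => mB _ _ _ _ s0 t0; apply: measurable_funB; [exact: mB t t0 i|exact: mB s s0 i]. Qed.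

Lemma increment_law (f : R -> \bar R) s t i : 0 <= s -> s < t ->
  measurable_fun setT f -> (forall x, 0 <= f x)%E ->
  (\int[P]_w f (Z s t i w) = \int[normal_prob 0 (Num.sqrt (t - s))]_x f x)%E.
Proof.
move=> s0 st mf f0; have t0 : 0 <= t by rewrite (le_trans s0)// ltW.
pose Z0 : Omega -> measurableTypeR R := Z s t i.
have mZ0 : measurable_fun setT Z0 := measurable_increment i s0 t0.
pose X : {mfun Omega >-> measurableTypeR R} := mfun_Sub (mem_set mZ0).
have := @ge0_integral_distribution _ _ _ (measurableTypeR R) R P X f mf f0.
rewrite /comp /= => <-; apply: eq_measure_integral => A mA _.
by case: hB => _ _ hN _ _; exact: hN s t i s0 st A mA.
Qed.

Lemma integral_sqr_increment s t i : 0 <= s -> s <= t ->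
  (\int[P]_w (Z s t i w ^+ 2)%:E = (t - s)%:E)%E.
Proof.
move=> s0; rewrite le_eqVlt => /predU1P[<-|st].
  by rewrite subrr integral0_eq// => w _; rewrite /Z subrr expr0n.
have mX : measurable_fun setT (fun x : R => (x ^+ 2)%:E).
  by apply/measurable_EFinP; exact: exprn_measurable.
have X0 (x : R) : (0 <= (x ^+ 2)%:E)%E by rewrite lee_fin sqr_ge0.
rewrite (@increment_law (fun x => (x ^+ 2)%:E) s t i)//.
rewrite ge0_integral_normal_prob//.
under eq_integral do rewrite -EFinM.
have ts : 0 < t - s by rewrite subr_gt0.
by rewrite integral_sqr_normal_pdf ?sqrtr_gt0// sqr_sqrtr// ltW.
Qed.

Lemma square_integrable_increment s t i : 0 <= s -> s <= t -> square_integrable P setT (Z s t i).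
Proof.
move=> s0 st; apply: (@square_integrable_le _ _ _ _ _ _ (t - s)).
  by apply: measurable_increment => //; exact: le_trans st.
by rewrite integral_sqr_increment.
Qed.

Lemma Rintegral_mul_disjoint_increment s t u i j : 0 <= s -> s <= t -> t <= u ->
  \int[P]_w (Z s t i w * Z t u j w) = \int[P]_w (Z s t i w) * \int[P]_w (Z t u j w).
Proof.
move=> s0 st tu; have t0 := le_trans s0 st.
have LX := square_integrable_increment i s0 st; have LY := square_integrable_increment j t0 tu.
apply: indep_expectation_mul; [exact: LX.1|exact: LY.1|exact: square_integrable_integrable..|
  exact: square_integrable_mul|] => A A' mA mA'.
case: hB => _ _ _ hI _.
(* [brownian_motion] takes an infinite nondecreasing sequence of times; this one stays at [u], and
   only its first two increments are used. *)
pose tau (l : nat) := if l is l'.+1 then (if l' is _.+1 then u else t) else s.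
have tauS l : tau l <= tau l.+1 by case: l => [|[|l]] /=.
have ind := hI 2 tau s0 tauS.
exact: (mutually_independent_pair (p := (ord0, i)) (q := (lift ord0 ord0, j)) ind _ mA mA').
Qed.

Lemma Rintegral_mul_coord_increment s t i j : 0 <= s -> s <= t -> i != j ->
  \int[P]_w (Z s t i w * Z s t j w) = \int[P]_w (Z s t i w) * \int[P]_w (Z s t j w).
Proof.
move=> s0 st ij.
have LX := square_integrable_increment i s0 st; have LY := square_integrable_increment j s0 st.
apply: indep_expectation_mul; [exact: LX.1|exact: LY.1|exact: square_integrable_integrable..|
  exact: square_integrable_mul|] => A A' mA mA'.
case: hB => _ _ _ hI _.
pose tau (l : nat) := if l is l'.+1 then t else s.
have tauS l : tau l <= tau l.+1 by case: l.
have ind := hI 1%N tau s0 tauS.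
apply: (mutually_independent_pair (p := (ord0, i)) (q := (ord0, j)) ind _ mA mA').
by rewrite xpair_eqE eqxx.
Qed.

Lemma Rintegral_sqr_increment s t i : 0 <= s -> s <= t ->
  \int[P]_w (Z s t i w * Z s t i w) = t - s.
Proof. by move=> s0 st; rewrite /Rintegral; under eq_integral do rewrite -expr2; rewrite integral_sqr_increment. Qed.

Lemma Rintegral_increment_law s t i : 0 <= s -> s < t ->
  \int[P]_w (Z s t i w) = \int[normal_prob 0 (Num.sqrt (t - s))]_x x.
Proof.
move=> s0 st; have t0 : 0 <= t by rewrite (le_trans s0)// ltW.
pose Z0 : Omega -> measurableTypeR R := Z s t i.
have mZ0 : measurable_fun setT Z0 := measurable_increment i s0 t0.
pose X : {mfun Omega >-> measurableTypeR R} := mfun_Sub (mem_set mZ0).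
have mid : measurable_fun setT (EFin : measurableTypeR R -> \bar R) by exact/measurable_EFinP.
have iX : P.-integrable setT (EFin \o X).
  by apply: (@square_integrable_integrable _ _ _ P Z0); apply: square_integrable_increment => //; exact: ltW.
have := @integral_distribution _ _ _ (measurableTypeR R) R P X EFin mid iX.
rewrite /comp /= /Rintegral => <-; congr (fine _); apply: eq_measure_integral => A mA _.
by case: hB => _ _ hN _ _; exact: hN s t i s0 st A mA.
Qed.

(* With X, Y the increments over the adjacent intervals [s, t] and [t, 2t - s] of
   equal length, Var(X + Y) = Var X + Var Y forces 0 = E X E Y = (E X)^2. *)
Lemma Rintegral_increment s t i : 0 <= s -> s <= t -> \int[P]_w (Z s t i w) = 0.
Proof.
move=> s0; rewrite le_eqVlt => /predU1P[<-|st].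
  rewrite /Rintegral integral0_eq// => w _; by rewrite /Z subrr.
have t0 : 0 <= t by rewrite (le_trans s0)// ltW.
pose u := 2 * t - s; have tu : t < u by rewrite /u; lra.
have st' := ltW st; have tu' := ltW tu; have su' := le_trans st' tu'.
have LX := square_integrable_increment i s0 st'; have LY := square_integrable_increment i t0 tu'.
have XY := Rintegral_mul_disjoint_increment i i s0 st' tu'.
have EXY : \int[P]_w (Z s t i w) = \int[P]_w (Z t u i w).
  have ut : u - t = t - s by rewrite /u; ring.
  by rewrite (Rintegral_increment_law i s0 st) (Rintegral_increment_law i t0 tu) ut.
have := Rintegral_sqr_increment i s0 su'.
have -> : \int[P]_w (Z s u i w * Z s u i w) =
    \int[P]_w ((Z s t i w - (-1) * Z t u i w) * (Z s t i w - (-1) * Z t u i w)).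
  by congr (fine _); apply: eq_integral => w _; congr EFin; rewrite /Z; ring.
have LY' := square_integrableZ measurableT (-1) LY.
rewrite Rintegral_mulBB// Rintegral_sqr_increment//.
have N1 (f : Omega -> R) : P.-integrable setT (EFin \o f) -> \int[P]_w (-1 * f w) = - \int[P]_w f w.
  by move=> fi; rewrite RintegralZl// mulN1r.
have iXY := square_integrable_mul measurableT LX LY.
have iYY := square_integrable_mul measurableT LY LY.
have -> : \int[P]_w (Z s t i w * (-1 * Z t u i w)) = - \int[P]_w (Z s t i w * Z t u i w).
  by rewrite -N1//; congr (fine _); apply: eq_integral => w _; congr EFin; ring.
have -> : \int[P]_w (-1 * Z t u i w * Z s t i w) = - \int[P]_w (Z s t i w * Z t u i w).
  by rewrite -N1//; congr (fine _); apply: eq_integral => w _; congr EFin; ring.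
have -> : \int[P]_w (-1 * Z t u i w * (-1 * Z t u i w)) = \int[P]_w (Z t u i w * Z t u i w).
  by congr (fine _); apply: eq_integral => w _; congr EFin; ring.
rewrite Rintegral_sqr_increment// XY -EXY => E.
have /eqP : \int[P]_w (Z s t i w) * \int[P]_w (Z s t i w) = 0 by move: E; rewrite /u; lra.
by rewrite mulf_eq0 orbb => /eqP.
Qed.

(** For [a <= b], split the increment up to [b] at time [a]: the second piece is independent of the
    first and centred, so only the product over [[0, a]] remains. *)
Lemma Rintegral_mul_brownian a b i j : 0 <= a -> 0 <= b ->
  \int[P]_w (Z 0 a i w * Z 0 b j w) = (i == j)%:R * Num.min a b.
Proof.
wlog ab : a b i j / a <= b => [wl a0 b0|].
  have [ab|/ltW ba] := leP a b; first by rewrite wl// (min_idPl ab).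
  have -> : \int[P]_w (Z 0 a i w * Z 0 b j w) = \int[P]_w (Z 0 b j w * Z 0 a i w).
    by congr (fine _); apply: eq_integral => w _; rewrite mulrC.
  by rewrite wl// eq_sym (min_idPl ba).
move=> a0 b0; rewrite (min_idPl ab).
have LX k := square_integrable_increment k (lexx 0) a0; have LY := square_integrable_increment j a0 ab.
have -> : \int[P]_w (Z 0 a i w * Z 0 b j w) = \int[P]_w (Z 0 a i w * Z 0 a j w + Z 0 a i w * Z a b j w).
  by congr (fine _); apply: eq_integral => w _; congr EFin; rewrite /Z; ring.
rewrite RintegralD//; [|exact: square_integrable_mul..].
rewrite Rintegral_mul_disjoint_increment// Rintegral_increment// mul0r addr0.
have [<-|ij] := eqVneq i j; first by rewrite Rintegral_sqr_increment// subr0 mul1r.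
by rewrite Rintegral_mul_coord_increment// Rintegral_increment// !mul0r.
Qed.

(** The combination of minima is the length of the overlap of []u, v]] and []u', v']]. It is kept in
    this form because [Rintegral_mul_indic] yields the same expression, so the isometry needs no
    case analysis on the relative position of the intervals. *)
Lemma Rintegral_mul_increment u v u' v' i j :
  0 <= u -> u <= v -> 0 <= u' -> u' <= v' ->
  \int[P]_w (Z u v i w * Z u' v' j w) =
  (i == j)%:R * (Num.min v v' - Num.min v u' - (Num.min u v' - Num.min u u')).
Proof.
move=> u0 uv u0' uv'; have v0 := le_trans u0 uv; have v0' := le_trans u0' uv'.
have L k a : 0 <= a -> square_integrable P setT (Z 0 a k) by move=> a0; exact: square_integrable_increment.
have -> : \int[P]_w (Z u v i w * Z u' v' j w) =
    \int[P]_w ((Z 0 v i w - Z 0 u i w) * (Z 0 v' j w - Z 0 u' j w)).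
  by congr (fine _); apply: eq_integral => w _; congr EFin; rewrite /Z; ring.
by rewrite Rintegral_mulBB//; [rewrite !Rintegral_mul_brownian//; ring|exact: L..].
Qed.

End brownian_covariance.

Section indicator_covariance.
Context (R : realType) (t : R).
Hypothesis t0 : 0 <= t.

Lemma square_integrable_indic (u v : R) :
  square_integrable (@lebesgue_measure R) `[0, t] (\1_`]u, v] : R -> R).
Proof.
apply: (@square_integrable_le _ (measurableTypeR R) _ _ _ _ t).
  by apply: measurable_indic; exact: measurable_itv.
apply: (@le_trans _ _ (\int[lebesgue_measure]_(x in `[0%R, t]) 1)%E).
  apply: ge0_le_integral => //.
  - by apply/measurable_EFinP; apply: measurable_funX; apply: measurable_indic; exact: measurable_itv.
  - by move=> x _; rewrite lee_fin indicE; case: (_ \in _); rewrite ?expr1n// expr0n.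
rewrite integral_cst// mul1e.
have -> : (lebesgue_measure `[0%R, t] <= t%:E)%E = true; last by [].
by rewrite lebesgue_measure_itv /= lte_fin; case: ifP => _; rewrite ?sube0 ?lexx// lee_fin t0.
Qed.

Lemma Rintegral_mul_indic0 (a b : R) : 0 <= a <= t -> 0 <= b <= t ->
  \int[lebesgue_measure]_(x in `[0, t]) ((\1_`]0, a] x : R) * \1_`]0, b] x) = Num.min a b.
Proof.
move=> /andP[a0 at_] /andP[b0 bt].
pose c := Num.min a b; have c0 : 0 <= c by rewrite /c le_min a0.
have ct : c <= t by rewrite /c ge_min at_.
have -> : \int[lebesgue_measure]_(x in `[0, t]) ((\1_`]0, a] x : R) * \1_`]0, b] x) =
    fine (\int[lebesgue_measure]_(x in `[0%R, t]) (\1_`]0%R, c] x : R)%:E)%E.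
  congr (fine _); apply: eq_integral => x _; congr EFin.
  rewrite !indicE -natrM mulnb; congr (_%:R); congr nat_of_bool.
  by rewrite !mem_setE !in_itv /= /c le_min; case: (0 < x).
rewrite integral_indic//.
rewrite (_ : _ `&` _ = `]0, c]%classic); last first.
  apply/seteqP; split => [x []//|x /=]; rewrite !in_itv /= => /andP[x0 xc].
  by rewrite x0 xc (ltW x0) (le_trans xc ct).
have := @lebesgue_measure_itv R `]0, c]; rewrite /= lte_fin => E.
rewrite (_ : fine _ = fine (lebesgue_measure `]0, c])) ?E//.
by case: ltP => [_|c0']; rewrite ?sube0//=; apply/eqP; rewrite eq_le c0.
Qed.

(** The indicator of []u, v]] is the difference of those of []0, v]] and []0, u]], just as an
    increment is a difference of values, and []0, a]] and []0, b]] overlap in length [min a b]. *)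
Lemma Rintegral_mul_indic (u v u' v' : R) :
  0 <= u -> u <= v -> v <= t -> 0 <= u' -> u' <= v' -> v' <= t ->
  \int[lebesgue_measure]_(x in `[0, t]) ((\1_`]u, v] x : R) * \1_`]u', v'] x) =
  Num.min v v' - Num.min v u' - (Num.min u v' - Num.min u u').
Proof.
move=> u0 uv vt u0' uv' vt'.
have v0 := le_trans u0 uv; have v0' := le_trans u0' uv'.
have ut := le_trans uv vt; have ut' := le_trans uv' vt'.
have E (p q x : R) : 0 <= p -> p <= q -> (\1_`]p, q] x : R) = \1_`]0, q] x - \1_`]0, p] x.
  move=> p0 pq; rewrite !indicE !mem_setE !in_itv /=.
  have [px|xp] := ltP p x; have [xq|qx] := leP x q; have [x0|x0] := ltP 0 x => /=;
    rewrite ?subrr ?subr0//; lra.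
have -> : \int[lebesgue_measure]_(x in `[0, t]) ((\1_`]u, v] x : R) * \1_`]u', v'] x) =
    \int[lebesgue_measure]_(x in `[0, t]) (((\1_`]0, v] x : R) - \1_`]0, u] x) * ((\1_`]0, v'] x : R) - \1_`]0, u'] x)).
  by congr (fine _); apply: eq_integral => x _; rewrite -!E.
rewrite (@Rintegral_mulBB _ (measurableTypeR R)); [|exact: measurable_itv|exact: square_integrable_indic..].
by rewrite !Rintegral_mul_indic0 ?u0 ?v0 ?u0' ?v0'.
Qed.

End indicator_covariance.

Section isometry.
Context d (Omega : measurableType d) (R : realType) (P : probability Omega R) (D : nat).
Variable B : R -> Omega -> 'cV[R]_D.
Hypothesis hB : brownian_motion P B.
Variables (t : R) (phi : seq ((R * R) * 'M[R]_D)).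
Hypothesis t0 : 0 <= t.
Hypothesis hphi : all (fun x => [&& 0 <= x.1.1, x.1.1 <= x.1.2 & x.1.2 <= t]) phi.

Lemma frobenius_sqr p q (A : 'M[R]_(p, q)) : frobenius A ^+ 2 = \sum_i \sum_j A i j ^+ 2.
Proof. by rewrite /frobenius sqr_sqrtr// sumr_ge0// => i _; rewrite sumr_ge0// => j _; rewrite sqr_ge0. Qed.

(** The double sum over steps and columns becomes a single sum over a list of pairs, the shape
    required by [Rintegral_sum_mul]. *)
Lemma step_integralE i w : step_integral B phi w i 0 =
  \sum_(p <- [seq (x, j) | x <- phi, j <- index_enum 'I_D])
     p.1.2 i p.2 * (B p.1.1.2 w p.2 0 - B p.1.1.1 w p.2 0).
Proof.
rewrite big_allpairs_dep /step_integral summxE; apply: eq_bigr => x _.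
by rewrite mxE; apply: eq_bigr => j _; rewrite !mxE.
Qed.

Lemma step_funE i j s : step_fun phi s i j = \sum_(x <- phi) x.2 i j * \1_`]x.1.1, x.1.2] s.
Proof. by rewrite /step_fun summxE; apply: eq_bigr => x _; rewrite mxE mulrC. Qed.

Let phiP x : x \in phi -> [/\ 0 <= x.1.1, x.1.1 <= x.1.2 & x.1.2 <= t].
Proof. by move/(allP hphi)/and3P. Qed.

Lemma square_integrable_step_fun i j :
  square_integrable (@lebesgue_measure R) `[0, t] (fun s => step_fun phi s i j).
Proof.
have -> : (fun s => step_fun phi s i j) = (fun s => \sum_(x <- phi) x.2 i j * \1_`]x.1.1, x.1.2] s).
  by apply/funext => s; rewrite step_funE.
apply: (@square_integrable_sum _ (measurableTypeR R) R _ _ _ _ phi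
  (fun x : (R * R) * 'M[R]_D => x.2 i j)
  (fun (x : (R * R) * 'M[R]_D) (s : R) => \1_`]x.1.1, x.1.2] s)); first exact: measurable_itv.
by move=> x _; exact: square_integrable_indic.
Qed.

Let increment (p : ((R * R) * 'M[R]_D) * 'I_D) (w : Omega) : R :=
  B p.1.1.2 w p.2 0 - B p.1.1.1 w p.2 0.

Let Lincrement p : p \in [seq (x, j) | x <- phi, j <- index_enum 'I_D] ->
  square_integrable P setT (increment p).
Proof.
move=> /allpairsP[[x j] /= [xphi _ ->]]; have [x0 xx _] := phiP xphi.
exact: (square_integrable_increment hB j x0 xx).
Qed.

Lemma square_integrable_step_integral i :
  square_integrable P setT (fun w => step_integral B phi w i 0).
Proof.
under eq_fun do rewrite step_integralE.
exact: (square_integrable_sum measurableT (fun p : ((R * R) * 'M[R]_D) * 'I_D => p.1.2 i p.2) Lincrement).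
Qed.

(** The steps of [phi] may overlap, so no orthogonality of the summands is available. Both sides are
    expanded over all pairs of steps and matched term by term through the common covariance [K]. *)
Lemma Rintegral_sqr_step_integral i :
  \int[P]_w (step_integral B phi w i 0 * step_integral B phi w i 0) =
  \sum_j \int[lebesgue_measure]_(s in `[0, t]) (step_fun phi s i j * step_fun phi s i j).
Proof.
pose S := [seq (x, j) | x <- phi, j <- index_enum 'I_D].
pose c (p : ((R * R) * 'M[R]_D) * 'I_D) : R := p.1.2 i p.2.
have -> : \int[P]_w (step_integral B phi w i 0 * step_integral B phi w i 0) =
    \int[P]_w ((\sum_(p <- S) c p * increment p w) * (\sum_(p <- S) c p * increment p w)).
  by congr (fine _); apply: eq_integral => w _; rewrite step_integralE.
rewrite (Rintegral_sum_mul measurableT c c Lincrement Lincrement).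
pose K (x y : (R * R) * 'M[R]_D) : R := Num.min x.1.2 y.1.2 - Num.min x.1.2 y.1.1 - (Num.min x.1.1 y.1.2 - Num.min x.1.1 y.1.1).
transitivity (\sum_(x <- phi) \sum_j \sum_(y <- phi) x.2 i j * y.2 i j * K x y).
  rewrite big_allpairs_dep; apply: eq_big_seq => x xphi; apply: eq_bigr => j _.
  rewrite big_allpairs_dep; apply: eq_big_seq => y yphi.
  have [x0 xx _] := phiP xphi; have [y0 yy _] := phiP yphi.
  (* Distinct coordinates of Brownian motion are uncorrelated, so only the column [j] survives. *)
  rewrite (bigD1 j)//= big1 ?addr0.
    by rewrite /increment /= (Rintegral_mul_increment hB)// eqxx mul1r.
  by move=> k kj; rewrite /increment /= (Rintegral_mul_increment hB)// eq_sym (negbTE kj) mul0r mulr0.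
rewrite exchange_big; apply: eq_bigr => j _.
pose f (x : (R * R) * 'M[R]_D) (s : R) : R := \1_`]x.1.1, x.1.2] s.
have Lf x : x \in phi -> square_integrable (@lebesgue_measure R) `[0, t] (f x).
  by move=> _; exact: square_integrable_indic.
pose e (x : (R * R) * 'M[R]_D) : R := x.2 i j.
have -> : \int[lebesgue_measure]_(s in `[0, t]) (step_fun phi s i j * step_fun phi s i j) =
    \int[lebesgue_measure]_(s in `[0, t]) ((\sum_(x <- phi) e x * f x s) * (\sum_(x <- phi) e x * f x s)).
  by congr (fine _); apply: eq_integral => s _; rewrite step_funE.
rewrite (@Rintegral_sum_mul _ (measurableTypeR R) R _ _ (measurable_itv _) _ _ phi phi e e f f Lf Lf).
apply: eq_big_seq => x xphi; apply: eq_big_seq => y yphi.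
have [x0 xx xt] := phiP xphi; have [y0 yy yt] := phiP yphi.
by rewrite /f Rintegral_mul_indic.
Qed.

Lemma wiener_isometry_step :
  (\int[P]_w (frobenius (step_integral B phi w) ^+ 2)%:E =
   \int[lebesgue_measure]_(s in `[0%R, t]) (frobenius (step_fun phi s) ^+ 2)%:E)%E.
Proof.
transitivity (\sum_i (\int[P]_w (step_integral B phi w i 0 ^+ 2)%:E))%E.
  rewrite -ge0_integral_sum//; last 2 first.
  - by move=> i; apply/measurable_EFinP; apply: measurable_funX; exact: (square_integrable_step_integral i).1.
  - by move=> i w _; rewrite lee_fin sqr_ge0.
  apply: eq_integral => w _; rewrite frobenius_sqr sumEFin; congr EFin.
  by apply: eq_bigr => i _; rewrite big_ord1.
transitivity (\sum_i \sum_j (\int[lebesgue_measure]_(s in `[0%R, t]) (step_fun phi s i j ^+ 2)%:E))%E.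
  apply: eq_bigr => i _; rewrite (square_integrableE (square_integrable_step_integral i)).
  have -> : \int[P]_w (step_integral B phi w i 0 ^+ 2) =
      \int[P]_w (step_integral B phi w i 0 * step_integral B phi w i 0).
    by congr (fine _); apply: eq_integral => w _; rewrite expr2.
  rewrite Rintegral_sqr_step_integral -sumEFin; apply: eq_bigr => j _.
  rewrite (square_integrableE (square_integrable_step_fun i j)); congr EFin.
have mphi i j : measurable_fun `[0, t] (fun s => (step_fun phi s i j ^+ 2)%:E).
  by apply/measurable_EFinP; apply: measurable_funX; exact: (square_integrable_step_fun i j).1.
transitivity (\sum_i (\int[lebesgue_measure]_(s in `[0%R, t]) (\sum_j step_fun phi s i j ^+ 2)%:E))%E.
  apply: eq_bigr => i _; rewrite -ge0_integral_sum//; last 2 first.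
  - by move=> j; exact: mphi.
  - by move=> j s _; rewrite lee_fin sqr_ge0.
  by apply: eq_integral => s _; rewrite sumEFin.
rewrite -ge0_integral_sum//; last 2 first.
- by move=> i; apply/measurable_EFinP; apply: measurable_sum => j; apply: measurable_funX; exact: (square_integrable_step_fun i j).1.
- by move=> i s _; rewrite lee_fin sumr_ge0// => j _; rewrite sqr_ge0.
by apply: eq_integral => s _; rewrite frobenius_sqr sumEFin.
Qed.

End isometry.

Lemma frobenius_subC (R : realType) p q (A A' : 'M[R]_(p, q)) : frobenius (A - A') = frobenius (A' - A).
Proof. by rewrite /frobenius; congr Num.sqrt; apply: eq_bigr => i _; apply: eq_bigr => j _; rewrite !mxE -sqrrN opprB. Qed.

(** A symmetric splitting of the square would leave a factor 2 in the limit. The weight [1 + e]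
    stays on the main term, and the large factor [1 + e^-1] falls on approximation errors that tend
    to 0 for fixed [e]. *)
Lemma frobenius_sqr_perturb_le (R : realType) p q (e : R) (A A' U U' : 'M[R]_(p, q)) : 0 < e ->
  frobenius (A - A') ^+ 2 <= (1 + e) * frobenius (U - U') ^+ 2 +
    2 * (1 + e^-1) * (frobenius (U - A) ^+ 2 + frobenius (U' - A') ^+ 2).
Proof.
move=> e0; rewrite !frobenius_sqr -big_split /= !mulr_sumr -big_split; apply: ler_sum => i _ /=.
rewrite -big_split !mulr_sumr -big_split; apply: ler_sum => j _ /=; rewrite !mxE.
set x := A i j; set x' := A' i j; set u := U i j; set u' := U' i j.
have ee : 0 < e^-1 by rewrite invr_gt0.
have e1 : e * e^-1 = 1 by rewrite divff// gt_eqF.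
(* Young: [(p - q)^2 <= (1 + e) p^2 + (1 + 1 / e) q^2] with [p = u - u']. *)
have h : (x - x') ^+ 2 <= (1 + e) * (u - u') ^+ 2 + (1 + e^-1) * ((u - x) - (u' - x')) ^+ 2.
  have := mulr_ge0 (ltW ee) (sqr_ge0 (e * (u - u') + ((u - x) - (u' - x')))).
  have -> : e^-1 * (e * (u - u') + ((u - x) - (u' - x'))) ^+ 2 =
     (e * e^-1) * e * (u - u') ^+ 2 + 2 * (e * e^-1) * (u - u') * ((u - x) - (u' - x')) + e^-1 * ((u - x) - (u' - x')) ^+ 2 by ring.
  by rewrite e1; nra.
apply: (le_trans h); rewrite lerD2l.
have : ((u - x) - (u' - x')) ^+ 2 <= 2 * ((u - x) ^+ 2 + (u' - x') ^+ 2).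
  by have := sqr_ge0 ((u - x) + (u' - x')); nra.
by move=> h'; rewrite [2 * _]mulrC -mulrA ler_wpM2l// addr_ge0// ltW.
Qed.

Section frobenius_integral.
Context d (T : measurableType d) (R : realType) (mu : {measure set T -> \bar R}).
Variable (D : set T).
Hypothesis mD : measurable D.

Lemma measurable_frobenius_sqr p q (F : T -> 'M[R]_(p, q)) :
  (forall i j, measurable_fun D (fun s => F s i j)) ->
  measurable_fun D (fun s => (frobenius (F s) ^+ 2)%:E).
Proof.
move=> mF; apply/measurable_EFinP.
under eq_fun do rewrite frobenius_sqr.
by do 2 (apply: measurable_sum => ?); apply: measurable_funX.
Qed.

Lemma measurable_mx_sub p q (F G : T -> 'M[R]_(p, q)) :
  (forall i j, measurable_fun D (fun s => F s i j)) ->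
  (forall i j, measurable_fun D (fun s => G s i j)) ->
  forall i j, measurable_fun D (fun s => (F s - G s) i j).
Proof. by move=> mF mG i j; under eq_fun do rewrite !mxE; exact: measurable_funB. Qed.

Lemma integral_frobenius_perturb_le p q (e : R) (A A' U U' : T -> 'M[R]_(p, q)) : 0 < e ->
  (forall i j, measurable_fun D (fun s => A s i j)) ->
  (forall i j, measurable_fun D (fun s => A' s i j)) ->
  (forall i j, measurable_fun D (fun s => U s i j)) ->
  (forall i j, measurable_fun D (fun s => U' s i j)) ->
  (\int[mu]_(s in D) (frobenius (A s - A' s) ^+ 2)%:E <=
   (1 + e)%:E * \int[mu]_(s in D) (frobenius (U s - U' s) ^+ 2)%:E +
   (2 * (1 + e^-1))%:E * (\int[mu]_(s in D) (frobenius (U s - A s) ^+ 2)%:E +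
                          \int[mu]_(s in D) (frobenius (U' s - A' s) ^+ 2)%:E))%E.
Proof.
move=> e0 mA mA' mU mU'.
have p0 (F : T -> 'M[R]_(p, q)) s : D s -> (0 <= (frobenius (F s) ^+ 2)%:E)%E by move=> _; rewrite lee_fin sqr_ge0.
have m1 := measurable_frobenius_sqr (measurable_mx_sub mA mA').
have m2 := measurable_frobenius_sqr (measurable_mx_sub mU mU').
have m3 := measurable_frobenius_sqr (measurable_mx_sub mU mA).
have m4 := measurable_frobenius_sqr (measurable_mx_sub mU' mA').
have c1 : 0 <= 1 + e by rewrite addr_ge0// ltW.
have c2 : 0 <= 2 * (1 + e^-1) by rewrite mulr_ge0// addr_ge0// invr_ge0 ltW.
have p34 s : D s -> (0 <= (frobenius (U s - A s) ^+ 2)%:E + (frobenius (U' s - A' s) ^+ 2)%:E)%E.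
  by move=> Ds; rewrite adde_ge0// lee_fin sqr_ge0.
have m34 := emeasurable_funD m3 m4.
rewrite -ge0_integralD//; [|exact: (p0 (fun s => U s - A s))|exact: (p0 (fun s => U' s - A' s))].
rewrite -!ge0_integralZl_EFin//; last exact: (p0 (fun s => U s - U' s)).
have mz (c : R) f : measurable_fun D f -> measurable_fun D (fun s => c%:E * f s)%E.
  by move=> mf; apply: emeasurable_funM => //; exact: measurable_cst.
rewrite -ge0_integralD//; [|by move=> s Ds; rewrite mule_ge0 ?lee_fin ?sqr_ge0|exact: mz
  |by move=> s Ds; rewrite mule_ge0 ?lee_fin//; exact: p34|exact: mz].
apply: ge0_le_integral => //; [exact: (p0 (fun s => A s - A' s))|by apply: emeasurable_funD; exact: mz|].
move=> s _; rewrite -EFinD lee_fin; exact: frobenius_sqr_perturb_le.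
Qed.

End frobenius_integral.

Section wiener_integral_isometry.
Context d (Omega : measurableType d) (R : realType) (P : probability Omega R) (D : nat).
Variable B : R -> Omega -> 'cV[R]_D.
Hypothesis hB : brownian_motion P B.
Variables (t : R).
Hypothesis t0 : 0 <= t.

(** With concatenation, this writes a difference of step functions as one step function, so
    [wiener_isometry_step] applies to differences. *)
Let neg (phi : seq ((R * R) * 'M[R]_D)) := [seq (x.1, - x.2) | x <- phi].

Lemma step_integral_catN phi psi w :
  step_integral B (phi ++ neg psi) w = step_integral B phi w - step_integral B psi w.
Proof.
rewrite /step_integral big_cat big_map /=; congr (_ + _).
by rewrite -sumrN; apply: eq_bigr => x _; rewrite mulNmx.
Qed.

Lemma step_fun_catN (phi psi : seq ((R * R) * 'M[R]_D)) s :
  step_fun (phi ++ neg psi) s = step_fun phi s - step_fun psi s.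
Proof.
rewrite /step_fun big_cat big_map /=; congr (_ + _).
by rewrite -sumrN; apply: eq_bigr => x _; rewrite scalerN.
Qed.

Lemma wiener_isometry_le (F F' : R -> 'M[R]_D) (Y Y' : Omega -> 'cV[R]_D) (S : R) :
  (forall i j, measurable_fun `[0, t] (fun s => F s i j)) ->
  (forall i j, measurable_fun `[0, t] (fun s => F' s i j)) ->
  wiener_integral P B t F Y -> wiener_integral P B t F' Y' ->
  (\int[lebesgue_measure]_(s in `[0%R, t]) (frobenius (F s - F' s) ^+ 2)%:E <= S%:E)%E ->
  (\int[P]_w (frobenius (Y w - Y' w) ^+ 2)%:E <= S%:E)%E.
Proof.
move=> mF mF' [mY [phi [aphi cphi cY]]] [mY' [psi [apsi cpsi cY']]] FS.
have S0 : 0 <= S by rewrite -lee_fin; apply: le_trans FS; apply: integral_ge0 => s _; rewrite lee_fin sqr_ge0.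
have mY0 i j : measurable_fun setT (fun w => Y w i j) by rewrite (ord1 j); exact: mY.
have mY0' i j : measurable_fun setT (fun w => Y' w i j) by rewrite (ord1 j); exact: mY'.
have mI ph : all (fun x => [&& 0 <= x.1.1, x.1.1 <= x.1.2 & x.1.2 <= t]) ph ->
    forall i j, measurable_fun setT (fun w => step_integral B ph w i j).
  by move=> aph i j; rewrite (ord1 j); exact: (square_integrable_step_integral hB aph i).1.
have mS (ph : seq ((R * R) * 'M[R]_D)) i j : measurable_fun `[0, t] (fun s => step_fun ph s i j).
  exact: (square_integrable_step_fun ph t0 i j).1.
set V := (\int[P]_w _)%E.
pose dk k := (\int[lebesgue_measure]_(s in `[0%R, t]) (frobenius (step_fun (phi k) s - F s) ^+ 2)%:E)%E.
pose dk' k := (\int[lebesgue_measure]_(s in `[0%R, t]) (frobenius (step_fun (psi k) s - F' s) ^+ 2)%:E)%E.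
pose ek k := (\int[P]_w (frobenius (step_integral B (phi k) w - Y w) ^+ 2)%:E)%E.
pose ek' k := (\int[P]_w (frobenius (step_integral B (psi k) w - Y' w) ^+ 2)%:E)%E.
have cek : ek k @[k --> \oo] --> 0%E by move: cY; rewrite unlock.
have cek' : ek' k @[k --> \oo] --> 0%E by move: cY'; rewrite unlock.
(* [Y - Y'] is compared with the difference of the step integrals, the isometry moves that to the
   difference of the step functions, and this is compared with [F - F']. The two comparisons cost a
   factor [1 + e] each. *)
have main (e : R) k : 0 < e ->
    (V <= (1 + e)%:E * ((1 + e)%:E * S%:E + (2 * (1 + e^-1))%:E * (dk k + dk' k)) +
       (2 * (1 + e^-1))%:E * (ek k + ek' k))%E.
  move=> e0; have c1 : 0 <= 1 + e by rewrite addr_ge0// ltW.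
  have := integral_frobenius_perturb_le P measurableT e0 mY0 mY0' (mI _ (aphi k)) (mI _ (apsi k)).
  move/le_trans; apply; rewrite leeD2r// lee_wpmul2l ?lee_fin//.
  have aneg : all (fun x => [&& 0 <= x.1.1, x.1.1 <= x.1.2 & x.1.2 <= t]) (phi k ++ neg (psi k)).
    by rewrite all_cat aphi /neg all_map; exact: apsi.
  have := wiener_isometry_step hB t0 aneg.
  have -> : (\int[P]_w (frobenius (step_integral B (phi k ++ neg (psi k)) w) ^+ 2)%:E =
      \int[P]_w (frobenius (step_integral B (phi k) w - step_integral B (psi k) w) ^+ 2)%:E)%E.
    by apply: eq_integral => w _; rewrite step_integral_catN.
  have -> : (\int[lebesgue_measure]_(s in `[0%R, t]) (frobenius (step_fun (phi k ++ neg (psi k)) s) ^+ 2)%:E =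
      \int[lebesgue_measure]_(s in `[0%R, t]) (frobenius (step_fun (phi k) s - step_fun (psi k) s) ^+ 2)%:E)%E.
    by apply: eq_integral => s _; rewrite step_fun_catN.
  move=> ->.
  have := @integral_frobenius_perturb_le _ (measurableTypeR R) R lebesgue_measure `[0, t]%classic (measurable_itv _) _ _ e
    (step_fun (phi k)) (step_fun (psi k)) F F' e0 (mS _) (mS _) mF mF'.
  have -> : (\int[lebesgue_measure]_(s in `[0%R, t]) (frobenius (F s - step_fun (phi k) s) ^+ 2)%:E = dk k)%E.
    by apply: eq_integral => s _; rewrite frobenius_subC.
  have -> : (\int[lebesgue_measure]_(s in `[0%R, t]) (frobenius (F' s - step_fun (psi k) s) ^+ 2)%:E = dk' k)%E.
    by apply: eq_integral => s _; rewrite frobenius_subC.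
  move/le_trans; apply; rewrite leeD2r// lee_wpmul2l ?lee_fin//.
have lim (e : R) : 0 < e -> (V <= ((1 + e) ^+ 2 * S)%:E)%E.
  move=> e0.
  have key : ((1 + e)%:E * ((1 + e)%:E * S%:E + (2 * (1 + e^-1))%:E * (dk k + dk' k)) +
       (2 * (1 + e^-1))%:E * (ek k + ek' k))%E @[k --> \oo] --> ((1 + e) ^+ 2 * S)%:E.
    have -> : ((1 + e) ^+ 2 * S)%:E = ((1 + e)%:E * ((1 + e)%:E * S%:E + (2 * (1 + e^-1))%:E * (0 + 0)) +
         (2 * (1 + e^-1))%:E * (0 + 0))%E.
      by rewrite !adde0 !mule0 !adde0 -!EFinM; congr EFin; ring.
    apply: cvgeD => //.
      apply: cvgeZl => //; apply: cvgeD => //; first exact: cvg_cst.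
      by apply: cvgeZl => //; apply: cvgeD.
    by apply: cvgeZl => //; apply: cvgeD.
  exact: (cvge_ge (nearW _ (fun k => main e k e0)) key).
apply/lee_addgt0Pr => r r0.
(* For [e <= 1] the excess [(2 e + e^2) S] is at most [3 e S <= r]; the [+ 1] keeps the denominator
   positive when [S = 0]. *)
pose e := Num.min 1 (r / (3 * S + 1)).
have s1 : 0 < 3 * S + 1 by rewrite ltr_wpDl// mulr_ge0.
have e0 : 0 < e by rewrite lt_min ltr01 divr_gt0.
have e1 : e <= 1 by rewrite ge_min lexx.
have er : e * (3 * S + 1) <= r by rewrite -ler_pdivlMr// ge_min lexx orbT.
apply: (le_trans (lim e e0)); rewrite -EFinD lee_fin.
have -> : (1 + e) ^+ 2 * S = S + (2 * e + e * e) * S by ring.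
rewrite lerD2l; apply: le_trans er.
have eS : e * e * S <= e * S by rewrite ler_wpM2r// ler_piMl// ltW.
by move: eS e0; generalize e => x; nra.
Qed.

End wiener_integral_isometry.

(** * Volterra processes *)

(** Differentiability gives continuity at positive points only. The endpoint 0 is treated by its
    one-sided limit, where [0 < p] enters; the kernel uses [p = H - 1 / 2]. *)
Lemma continuous_powR_within0 (R : realType) (p T : R) : 0 < p -> 0 < T ->
  {within `[0, T], continuous (fun y : R => y `^ p)}.
Proof.
move=> p0 T0.
have c (y : R) : 0 < y -> {for y, continuous (fun y : R => y `^ p)}.
  move=> y0; apply/differentiable_continuous/derivable1_diffP.
  by apply: derivable_powR; rewrite in_itv/= andbT.
apply/continuous_within_itvP => //; split.
- by move=> y; rewrite in_itv /= => /andP[y0 _]; exact: c.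
- by rewrite powR0 ?gt_eqF//; exact: powR_cvg0.
- by apply: cvg_at_left_filter; exact: c.
Qed.

(** The substitution rule asks for a continuous integrand, which is why the kernels are shown to be
    continuous on the closed interval, 0 included. *)
Lemma integral_itv_reflect (R : realType) (T : R) (g : R -> R) : 0 < T ->
  {within `[0, T], continuous g} ->
  (\int[lebesgue_measure]_(s in `[0%R, T]) (g (T - s))%:E =
   \int[lebesgue_measure]_(s in `[0%R, T]) (g s)%:E)%E.
Proof.
move=> T0 cg; pose F (s : R) := T - s.
have dF (s : R) : is_derive s 1 F (- 1).
  by have := @is_deriveB R R R (cst T) id s 1 _ _ (is_derive_cst _ _ _) (is_derive_id _ _); rewrite sub0r.
have F' : F^`()%classic = cst (- 1).
  by apply/funext => s; rewrite derive1E; exact: derive_val.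
have cF : continuous F.
  by move=> s; apply/differentiable_continuous/derivable1_diffP; exact: (@ex_derive _ _ _ _ _ _ _ (dF s)).
have := @integration_by_substitution_decreasing R F g 0 T (ltW T0).
have FT : F T = 0 by rewrite /F subrr.
have F0 : F 0 = T by rewrite /F subr0.
rewrite FT F0 F' => -> //.
- by apply: eq_integral => s _; congr EFin; rewrite /= opprK mulr1.
- by move=> x y _ _ xy; rewrite /F ltrD2l ltrN2.
- by move=> x _; exact: cvg_cst.
- exact: is_cvg_cst.
- exact: is_cvg_cst.
- split; [by move=> x _; exact: (@ex_derive _ _ _ _ _ _ _ (dF x))|by apply: cvg_at_right_filter; exact: cF|by apply: cvg_at_left_filter; exact: cF].
Qed.

Lemma continuous_within_sqr (R : realType) (A : set R) (g : R -> R) :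
  {within A, continuous g} -> {within A, continuous (fun s => g s ^+ 2)}.
Proof. by move=> cg s; exact: (cvgM (cg s) (cg s)). Qed.

Lemma continuous_frac_kernel (R : realType) (H T : R) : 1 / 2 < H -> 0 < T ->
  {within `[0, T], continuous (frac_kernel H)}.
Proof.
move=> hH T0 y; apply: cvgM; last exact: cvg_cst.
by apply: continuous_powR_within0 => //; rewrite subr_gt0.
Qed.

Lemma continuous_approx_kernel (R : realType) (m n : nat) (gamma omega : nat -> R) (d1 d2 : R) :
  continuous (approx_kernel m n gamma omega d1 d2).
Proof.
have cE (c : R) : continuous (fun t : R => expR (- (c * t))).
  by move=> t; apply: continuous_comp; [apply: cvgN; apply: cvgM; [exact: cvg_cst|exact: cvg_id]|exact: continuous_expR].
pose f i (t : R) : R := omega i *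
    ((expR (- ((gamma i - d2) * t)) - expR (- ((gamma i + d1) * t))) / (d1 + d2)).
have cf i : continuous (f i).
  move=> t; apply: cvgM; first exact: cvg_cst.
  by apply: cvgM; [apply: cvgB; exact: cE|exact: cvg_cst].
have cs (s : seq nat) : continuous (fun t => \sum_(i <- s) f i t).
  elim: s => [|i s ih] t.
    by have -> : (fun t => \sum_(i <- [::]) f i t) = cst 0; [apply/funext => u; rewrite big_nil|exact: cvg_cst].
  have -> : (fun t => \sum_(j <- i :: s) f j t) = (fun t => f i t + \sum_(j <- s) f j t).
    by apply/funext => u; rewrite big_cons.
  by apply: cvgD; [exact: cf|exact: ih].
move=> t; apply: cvgD; last exact: cs.
apply: cvgM; first exact: cvg_cst.
by apply: cvgM; [apply: cvgB; [exact: cvg_cst|exact: cE]|exact: cvg_cst].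
Qed.

Section essential_bound.
Context (R : realType) (T : R).
Hypothesis T0 : 0 < T.
Context (p q : nat) (F : R -> 'M[R]_(p, q)).
Hypothesis hF : Linfty T F.
Let L := fine (Linfty_norm T F).

Lemma Linfty_norm_fine_ge0 : 0 <= L.
Proof. by rewrite /L fine_ge0// /Linfty_norm Lnorm_ge0. Qed.

Lemma frobenius_le_Linfty_norm :
  {ae (@lebesgue_measure R), forall s, `[0, T]%classic s -> frobenius (F s) <= L}.
Proof.
have Lfin : Linfty_norm T F = L%:E.
  by rewrite /L fineK// ge0_fin_numE; [exact: hF.2|rewrite /Linfty_norm Lnorm_ge0].
move: Lfin; rewrite {1}/Linfty_norm unlock /=.
(* The norm with exponent [+oo] is the essential supremum only when the whole space has positive
   measure; here that measure is [T]. *)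
have -> : (0 < mrestr lebesgue_measure (measurable_itv `[0%R, T]) [set: measurableTypeR R])%E.
  by rewrite /mrestr setTI lebesgue_measure_itv /= lte_fin T0 sube0 lte_fin.
move=> E.
have [N [mN N0 sub]] := ess_sup_inf.ess_sup_ge (mrestr lebesgue_measure (measurable_itv `[0, T])) (abse \o (fun s : measurableTypeR R => (frobenius (F s))%:E)).
(* [N] is null for the restricted measure, which means that its trace on [[0, T]] is Lebesgue
   null. *)
exists (N `&` `[0, T]%classic); split.
- by apply: measurableI => //; exact: measurable_itv.
- exact: N0.
- move=> s /= /not_implyP[s0T hs]; split => //; apply: sub => /= h; apply: hs.
  rewrite -lee_fin -E; apply: le_trans h; rewrite /= lee_fin; exact: ler_norm.
Qed.

Lemma integral_Linfty_mul_le (f : R -> R) (M : R) : measurable_fun `[0, T] f ->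
  (\int[lebesgue_measure]_(s in `[0%R, T]) (f s ^+ 2)%:E <= M%:E)%E ->
  (\int[lebesgue_measure]_(s in `[0%R, T]) (f s ^+ 2 * frobenius (F s) ^+ 2)%:E <= (L ^+ 2 * M)%:E)%E.
Proof.
move=> mf fM; have L0 := Linfty_norm_fine_ge0.
have mf2 : measurable_fun `[0, T] (fun s => f s ^+ 2) by exact: measurable_funX.
have mfr : measurable_fun `[0, T] (fun s => frobenius (F s) ^+ 2).
  by apply/measurable_EFinP; apply: (@measurable_frobenius_sqr _ (measurableTypeR R)); exact: hF.1.
apply: (@le_trans _ _ (\int[lebesgue_measure]_(s in `[0%R, T]) ((L ^+ 2)%:E * (f s ^+ 2)%:E))%E).
  apply: ae_ge0_le_integral.
  - exact: measurable_itv.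
  - by move=> s _; rewrite lee_fin mulr_ge0 ?sqr_ge0.
  - by apply/measurable_EFinP; exact: measurable_funM.
  - by move=> s _; rewrite -EFinM lee_fin mulr_ge0 ?sqr_ge0.
  - by apply/measurable_EFinP; apply: measurable_funM => //; exact: measurable_cst.
  - have [N [mN N0 sub]] := frobenius_le_Linfty_norm; exists N; split => // s /= hs.
    apply: sub => /= h; apply: hs => sT; rewrite -EFinM lee_fin mulrC ler_wpM2r ?sqr_ge0//.
    by rewrite ler_pXn2r ?nnegrE ?h// /frobenius sqrtr_ge0.
rewrite ge0_integralZl_EFin ?sqr_ge0//; last 2 first.
- by move=> s _; rewrite lee_fin sqr_ge0.
- exact/measurable_EFinP.
by rewrite (EFinM (L ^+ 2)) lee_wpmul2l// lee_fin sqr_ge0.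
Qed.

Lemma integral_Linfty_le :
  (\int[lebesgue_measure]_(s in `[0%R, T]) (frobenius (F s) ^+ 2)%:E <= (L ^+ 2 * T)%:E)%E.
Proof.
have h1 : (\int[lebesgue_measure]_(s in `[0%R, T]) ((1 : R) ^+ 2)%:E <= T%:E)%E.
  rewrite integral_cst//= expr1n mul1e.
  apply: (@le_trans _ _ (lebesgue_measure `[0, T])); first exact: lexx.
  by rewrite lebesgue_measure_itv /= lte_fin T0 sube0.
have := integral_Linfty_mul_le (measurable_cst _) h1.
have -> // : (\int[lebesgue_measure]_(s in `[0%R, T]) ((1 : R) ^+ 2 * frobenius (F s) ^+ 2)%:E =
  \int[lebesgue_measure]_(s in `[0%R, T]) (frobenius (F s) ^+ 2)%:E)%E.
by apply: eq_integral => s _; rewrite expr1n mul1r.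
Qed.

End essential_bound.

Section drift_difference.
Context (R : realType) (T : R).
Hypothesis T0 : 0 < T.
Context (D : nat) (drift : R -> 'cV[R]_D) (G G' : R -> R).
Hypothesis hdrift : Linfty T drift.
Hypotheses (cG : {within `[0, T], continuous G}) (cG' : {within `[0, T], continuous G'}).

Lemma square_integrable_reflect (g : R -> R) : {within `[0, T], continuous g} ->
  square_integrable (@lebesgue_measure R) `[0, T] (fun s => g (T - s)).
Proof.
move=> cg.
have mg : measurable_fun `[0, T] (fun s => g (T - s)).
  apply: (@measurable_comp _ _ _ _ _ _ `[0, T]%classic g `[0, T]%classic (fun s => T - s)).
  - exact: measurable_itv.
  - by move=> y [s] /=; rewrite !in_itv /= => /andP[s0 sT] <-; rewrite subr_ge0 sT lerBlDr lerDl.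
  - by apply: subspace_continuous_measurable_fun => //; exact: measurable_itv.
  - by apply: measurable_funB; [exact: measurable_cst|exact: measurable_id].
split => //.
have c2 : {within `[0, T], continuous (fun s => g s ^+ 2)}.
  by exact: continuous_within_sqr.
rewrite (@integral_itv_reflect R T (fun s => g s ^+ 2) T0 c2).
have /integrableP[_] := integrable_itv_continuous c2.
by under eq_integral do rewrite /= ger0_norm ?sqr_ge0//.
Qed.

(** Cauchy-Schwarz is applied to each coordinate with the same kernel factor [M]. Summing the other
    factors over the coordinates rebuilds the integral of the squared Euclidean norm, so no
    dimensional constant appears. *)
Lemma drift_difference_le (M : R) :
  (\int[lebesgue_measure]_(s in `[0%R, T]) ((G s - G' s) ^+ 2)%:E <= M%:E)%E ->
  frobenius (drift_integral G drift T - drift_integral G' drift T) ^+ 2 <=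
  M * (T * fine (Linfty_norm T drift) ^+ 2).
Proof.
move=> hM; set L := fine _.
have mD : measurable (`[0, T]%classic : set (measurableTypeR R)) by exact: measurable_itv.
have mfr : measurable_fun `[0, T] (fun s => (frobenius (drift s) ^+ 2)%:E).
  by apply: (@measurable_frobenius_sqr _ (measurableTypeR R)); exact: hdrift.1.
have Lb i : square_integrable (@lebesgue_measure R) `[0, T] (fun s => drift s i 0).
  apply: (@square_integrable_le _ (measurableTypeR R) _ _ _ _ (L ^+ 2 * T)); first exact: hdrift.1.
  apply: le_trans (integral_Linfty_le T0 hdrift); apply: ge0_le_integral => //.
  - by move=> s _; rewrite lee_fin sqr_ge0.
  - by apply/measurable_EFinP; apply: measurable_funX; exact: hdrift.1.
  - move=> s _; rewrite lee_fin frobenius_sqr (bigD1 i)//= big_ord1 lerDl.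
    by apply: sumr_ge0 => j _; rewrite big_ord1 sqr_ge0.
have LG := square_integrable_reflect cG; have LG' := square_integrable_reflect cG'.
have hM' : (\int[lebesgue_measure]_(s in `[0%R, T]) ((G (T - s) - G' (T - s)) ^+ 2)%:E <= M%:E)%E.
  rewrite (@integral_itv_reflect R T (fun s => (G s - G' s) ^+ 2) T0)//.
  apply: (@continuous_within_sqr _ _ (fun s => G s - G' s)) => s.
  by apply: cvgB; [exact: cG|exact: cG'].
have mGG : measurable_fun `[0, T] (fun s => G (T - s) - G' (T - s)).
  by apply: measurable_funB; [exact: LG.1|exact: LG'.1].
have M0 : 0 <= M.
  by rewrite -lee_fin; apply: le_trans hM; apply: integral_ge0 => s _; rewrite lee_fin sqr_ge0.
pose b2 i : R := \int[lebesgue_measure]_(s in `[0, T]) (drift s i 0 ^+ 2).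
have E i : (drift_integral G drift T - drift_integral G' drift T) i 0 =
    \int[lebesgue_measure]_(s in `[0, T]) ((G (T - s) - G' (T - s)) * drift s i 0).
  rewrite !mxE -(@RintegralB _ (measurableTypeR R))//;
    [|exact: (@square_integrable_mul _ (measurableTypeR R) _ _ _ mD)..].
  by congr (fine _); apply: eq_integral => s _; rewrite mulrBl.
apply: (@le_trans _ _ (M * \sum_i b2 i)).
  rewrite frobenius_sqr mulr_sumr; apply: ler_sum => i _; rewrite big_ord1 E.
  apply: (@sqr_Rintegral_mul_le _ (measurableTypeR R) _ _ _ _ _ _ _ mD mGG (Lb i).1 hM').
  by rewrite (@square_integrableE _ (measurableTypeR R) _ _ _ _ (Lb i)).
apply: ler_wpM2l => //; rewrite mulrC -lee_fin.
apply: le_trans (integral_Linfty_le T0 hdrift).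
rewrite -sumEFin (_ : (\sum_i _)%E = (\sum_i (\int[lebesgue_measure]_(s in `[0%R, T]) (drift s i 0 ^+ 2)%:E))%E); last first.
  by apply: eq_bigr => i _; rewrite (@square_integrableE _ (measurableTypeR R) _ _ _ _ (Lb i)).
rewrite -ge0_integral_sum//; last 2 first.
- by move=> i; apply/measurable_EFinP; apply: measurable_funX; exact: hdrift.1.
- by move=> i s _; rewrite lee_fin sqr_ge0.
rewrite le_eqVlt; apply/orP; left; apply/eqP; apply: eq_integral => s _.
by rewrite sumEFin frobenius_sqr; congr EFin; apply: eq_bigr => i _; rewrite big_ord1.
Qed.

End drift_difference.

Lemma frobenius_sqrD_le (R : realType) p q (A A' : 'M[R]_(p, q)) :
  frobenius (A + A') ^+ 2 <= 2 * frobenius A ^+ 2 + 2 * frobenius A' ^+ 2.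
Proof.
rewrite !frobenius_sqr !mulr_sumr -big_split; apply: ler_sum => i _ /=.
rewrite !mulr_sumr -big_split; apply: ler_sum => j _ /=; rewrite !mxE.
have := sqr_ge0 (A i j - A' i j); nra.
Qed.

Lemma frobenius_sqrZ (R : realType) p q (c : R) (A : 'M[R]_(p, q)) :
  frobenius (c *: A) ^+ 2 = c ^+ 2 * frobenius A ^+ 2.
Proof.
rewrite !frobenius_sqr mulr_sumr; apply: eq_bigr => i _.
by rewrite mulr_sumr; apply: eq_bigr => j _; rewrite !mxE exprMn.
Qed.

Section volterra_difference.
Context d (Omega : measurableType d) (R : realType) (P : probability Omega R) (D : nat).
Variables (B : R -> Omega -> 'cV[R]_D) (X0 : Omega -> 'cV[R]_D) (kappa T : R).
Variables (G G' : R -> R) (drift : R -> 'cV[R]_D) (Sigma : R -> 'M[R]_D).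
Variables (X X' : R -> Omega -> 'cV[R]_D) (M : R).
Hypotheses (hB : brownian_motion P B) (T0 : 0 < T).
Hypotheses (cG : {within `[0, T], continuous G}) (cG' : {within `[0, T], continuous G'}).
Hypotheses (hdrift : Linfty T drift) (hSigma : Linfty T Sigma).
Hypothesis hM : (\int[lebesgue_measure]_(s in `[0%R, T]) ((G s - G' s) ^+ 2)%:E <= M%:E)%E.
Hypothesis hX : volterra_process P B X0 kappa T G drift Sigma X.
Hypothesis hX' : volterra_process P B X0 kappa T G' drift Sigma X'.

(** The terms with [X0] cancel pointwise in [w]. What remains is a deterministic drift difference
    plus a difference of Wiener integrals, and the squared norm of this sum produces the two factors
    2 in [C_T]. *)
Lemma volterra_difference_le :
  ('E_P[(fun w => (frobenius (X T w - X' T w) ^+ 2)%R)] <= (C_T T drift Sigma * M)%:E)%E.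
Proof.
have TT : 0 <= T <= T by rewrite (ltW T0) lexx.
have [Y wY EX] := hX TT; have [Y' wY' EX'] := hX' TT.
have mGS (g : R -> R) : {within `[0, T], continuous g} ->
    forall i j, measurable_fun `[0, T] (fun s => (g (T - s) *: Sigma s) i j).
  move=> cg i j; have -> : (fun s => (g (T - s) *: Sigma s) i j) = (fun s => g (T - s) * Sigma s i j).
    by apply/funext => s; rewrite mxE.
  apply: measurable_funM; [exact: (square_integrable_reflect T0 cg).1|exact: hSigma.1].
have hM' : (\int[lebesgue_measure]_(s in `[0%R, T]) ((G (T - s) - G' (T - s)) ^+ 2)%:E <= M%:E)%E.
  rewrite (@integral_itv_reflect R T (fun s => (G s - G' s) ^+ 2) T0)//.
  apply: (@continuous_within_sqr _ _ (fun s => G s - G' s)) => s.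
  by apply: cvgB; [exact: cG|exact: cG'].
have mGG : measurable_fun `[0, T] (fun s => G (T - s) - G' (T - s)).
  by apply: measurable_funB; [exact: (square_integrable_reflect T0 cG).1|exact: (square_integrable_reflect T0 cG').1].
have YY : (\int[P]_w (frobenius (Y w - Y' w) ^+ 2)%:E <= (fine (Linfty_norm T Sigma) ^+ 2 * M)%:E)%E.
  apply: (wiener_isometry_le hB (ltW T0) (mGS _ cG) (mGS _ cG') wY wY').
  apply: le_trans (integral_Linfty_mul_le T0 hSigma mGG hM').
  rewrite le_eqVlt; apply/orP; left; apply/eqP; apply: eq_integral => s _.
  by rewrite -scalerBl frobenius_sqrZ.
have dd := drift_difference_le T0 hdrift cG cG' hM.
set dG := drift_integral G drift T - drift_integral G' drift T in dd.
have XX w : X T w - X' T w = dG + (Y w - Y' w).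
  by rewrite EX EX' opprD addrACA; congr (_ + _); rewrite opprD addrACA subrr add0r.
have mYY : measurable_fun setT (fun w => (frobenius (Y w - Y' w) ^+ 2)%:E).
  apply: (measurable_frobenius_sqr (F := fun w => Y w - Y' w)).
  by apply: measurable_mx_sub => i j; rewrite (ord1 j); [exact: wY.1|exact: wY'.1].
rewrite unlock.
apply: (@le_trans _ _ (\int[P]_w ((2 * frobenius dG ^+ 2)%:E + 2%:E * (frobenius (Y w - Y' w) ^+ 2)%:E))%E).
  apply: ge0_le_integral => //.
  - by move=> w _; rewrite lee_fin sqr_ge0.
  - under eq_fun do rewrite XX; apply: measurable_frobenius_sqr => i j.
    under eq_fun do rewrite mxE; apply: measurable_funD; first exact: measurable_cst.
    by apply: (measurable_mx_sub (F := Y) (G := Y')) => {}i {}j; rewrite (ord1 j); [exact: wY.1|exact: wY'.1].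
  - by apply: emeasurable_funD; [exact: measurable_cst|apply: emeasurable_funM => //; exact: measurable_cst].
  - by move=> w _; rewrite -EFinD lee_fin XX; exact: frobenius_sqrD_le.
rewrite ge0_integralD//; last 3 first.
- by move=> w _; rewrite lee_fin mulr_ge0// sqr_ge0.
- by move=> w _; rewrite mule_ge0// lee_fin sqr_ge0.
- by apply: emeasurable_funM => //; exact: measurable_cst.
have -> : (\int[P]__ (2 * frobenius dG ^+ 2)%:E = (2 * frobenius dG ^+ 2)%:E)%E.
  by rewrite integral_cst// -[RHS]mule1; congr (_ * _)%E; exact: probability_setT.
rewrite ge0_integralZl_EFin//; last first.
  by move=> w _; rewrite lee_fin sqr_ge0.
apply: (@le_trans _ _ ((2 * frobenius dG ^+ 2)%:E + 2%:E * (fine (Linfty_norm T Sigma) ^+ 2 * M)%:E)%E).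
  by rewrite leeD2l// lee_wpmul2l// lee_fin.
rewrite -EFinM -EFinD lee_fin /C_T.
by move: dd; lra.
Qed.

End volterra_difference.

Theorem theorem3p3 (R : realType) (T : R) (D : nat) (H : R) (N : nat)
    (alpha beta a b : R) (m n : nat) (gamma omega : nat -> R)
    (delta1 delta2 : R)
    (hT : 0 < T) (hH : 1 / 2 < H < 1) (hN : (1 <= N)%N)
    (halpha : 0 < alpha) (hbeta : 0 < beta) (ha : 0 < a) (hb : 0 < b)
    (hm : (0 < m)%N) (hn : (0 < n)%N)
    (hxi : xi_first H N alpha a < xi_last H N alpha b)
    (hquad : quadrature H N alpha a b m n gamma omega)
    (hdelta1 : 0 < delta1) (hdelta2 : 0 < delta2)
    (hdelta2xi : delta2 <= xi_first H N alpha a) :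
  let GH := frac_kernel H in
  let Gt := approx_kernel m n gamma omega delta1 delta2 in
  let bound := 2 * Q_plus H T N alpha a b m n
               + 2 * T ^+ 5 / 5 * D_err m n omega delta1 delta2 ^+ 2 in
  (\int[lebesgue_measure]_(t in `[0%R, T]) (`|GH t - Gt t| ^+ 2)%:E
     <= bound%:E)%E
  /\
  (forall (d : measure_display) (Omega : measurableType d)
      (P : probability Omega R) (B : R -> Omega -> 'cV[R]_D)
      (X0 : Omega -> 'cV[R]_D) (kappa : R) (drift : R -> 'cV[R]_D)
      (Sigma : R -> 'M[R]_D) (X Xhat : R -> Omega -> 'cV[R]_D),
    brownian_motion P B ->
    random_vector X0 ->
    independent_of_process P X0 B ->
    0 < kappa ->
    Linfty T drift ->
    Linfty T Sigma ->
    volterra_process P B X0 kappa T GH drift Sigma X ->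
    volterra_process P B X0 kappa T Gt drift Sigma Xhat ->
    ('E_P[(fun w => (frobenius (X T w - Xhat T w) ^+ 2)%R)]
       <= (C_T T drift Sigma * bound)%:E)%E).
Proof.
move=> GH Gt bound.
have err : (\int[lebesgue_measure]_(t in `[0%R, T]) ((GH t - Gt t) ^+ 2)%:E <= bound%:E)%E.
  exact: kernel_error_le.
split.
  have -> // : (\int[lebesgue_measure]_(t in `[0%R, T]) (`|GH t - Gt t| ^+ 2)%:E =
    \int[lebesgue_measure]_(t in `[0%R, T]) ((GH t - Gt t) ^+ 2)%:E)%E.
  by apply: eq_integral => t _; rewrite real_normK// num_real.
move=> d Omega P B X0 kappa drift Sigma X Xhat hB _ _ _ hdrift hSigma hX hXhat.
apply: (volterra_difference_le hB hT _ _ hdrift hSigma err hX hXhat).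
- by apply: continuous_frac_kernel => //; case/andP: hH.
- by apply: continuous_subspaceT; exact: continuous_approx_kernel.
Qed.
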